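(* (1) Let $p\in(2,\infty)$ and $\Phi(x)=|x|^p/p$. There exists a bijection $\widetilde{\mathscr F}:\mathscr I_{p>2}\to\mathscr M$ such that $\Psi(\widetilde{\mathscr F}(\mathsf V))=\mathsf V$ for every $\mathsf V\in\mathscr I_{p>2}$. (2) Let $p\in(1,2)$ and $\Phi(x)=\langle x\rangle^p/p$. There exists a bijection $\widetilde{\mathscr F}:\mathscr I_{p<2}\to\mathscr M$ such that, for every $(\mathsf V_1,\mathsf V_2)\in\mathscr I_{p<2}$, the mass and energy components of $\Psi(\widetilde{\mathscr F}(\mathsf V_1,\mathsf V_2))$ equal $(\mathsf V_1,\mathsf V_2)$, i.e. $\Psi_1(\widetilde{\mathscr F}(\mathsf V_1,\mathsf V_2))=\mathsf V_1$ and $\Psi_2(\widetilde{\mathscr F}(\mathsf V_1,\mathsf V_2))=\mathsf V_2$.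
   Context: $\langle x\rangle=(1+|x|^2)^{1/2}$, and $x\wedge v=xv^\tau-vx^\tau=(x_iv_j-x_jv_i)_{3\times3}$. The conserved-moment map is $$\Psi(F)=(\Psi_1(F),\Psi_2(F),\Psi_3(F))=\int_{\mathbb R^6}\Big(1,\ \Phi(x)+\tfrac12|v|^2,\ x\wedge v\Big)F(x,v)\,dx\,dv.$$ The sets of moments are $$\mathscr I_{p>2}=\Big\{\Psi(F_0):F_0(x,v)\ge0,\ 0<\int_{\mathbb R^6}(\Phi(x)+|v|^2+1)F_0\,dx\,dv<\infty\Big\},$$ $$\mathscr I_{p<2}=\Big\{(\Psi_1(F_0),\Psi_2(F_0)):F_0(x,v)\ge0,\ 0<\int_{\mathbb R^6}(\Phi(x)+|v|^2+1)F_0\,dx\,dv<\infty\Big\}.$$ $\mathscr M$ is the set of all (positive) equilibria, i.e. entropy-invariant solutions of the Boltzmann equation $\partial_tF+v\cdot\nabla_xF-\nabla_x\Phi\cdot\nabla_vF=Q(F,F)$: sufficiently regular functions $M(t,x,v)>0$ such that for every $t\ge0$, $\int_{\mathbb R^6}(\Phi(x)+|v|^2+1)M\,dx\,dv<\infty$ and $\partial_tM+v\cdot\nabla_xM-\nabla_x\Phi\cdot\nabla_vM=0=Q(M,M)$. By the classification of equilibria, $\mathscr M$ consists exactly of the (time-independent) functions $m\exp\{-\alpha(\Phi(x)+\frac12|v|^2)+Rx\cdot v\}$ with $m>0$, $\alpha>0$, $R$ a real $3\times3$ skew-symmetric matrix if $p>2$, and of the functions $m\exp\{-\alpha(\Phi(x)+\frac12|v|^2)\}$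 with $m,\alpha>0$ if $1<p<2$. Here $Q(F,G)(v)=\int_{\mathbb R^3\times\mathbb S^2}B(v-v_*,\sigma)[F(v_*')G(v')-F(v_* )G(v)]\,d\sigma dv_*$, $v'=\frac{v+v_*}2+\frac{|v-v_*|}2\sigma$, $v'_*=\frac{v+v_*}2-\frac{|v-v_*|}2\sigma$, $B=|v-v_*|^\gamma b(\cos\theta)$ with $\gamma\in(-3,1]$, $\cos\theta=\frac{v-v_*}{|v-v_*|}\cdot\sigma$; $b\ge0$ is nontrivial, supported in $0\le\theta\le\pi/2$, and satisfies either $\int_{\mathbb S^2}b(\hat z\cdot\sigma)d\sigma<\infty$ or $c_b\theta^{-2-2s}\le b(\cos\theta)\le C_b\theta^{-2-2s}$ for $0<\theta\le\pi/2$, with some $s\in(0,1)$, $0<c_b\le C_b<\infty$. *)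

(* Defs.v *)
From HB Require Import structures.
From mathcomp Require Import all_boot all_order all_algebra.
From mathcomp Require Import all_classical all_reals all_analysis.
From mathcomp Require Import measurable_realfun lra.

Set Implicit Arguments.
Unset Strict Implicit.
Unset Printing Implicit Defensive.

Import Order.TTheory GRing.Theory Num.Theory.
Import numFieldNormedType.Exports.

Local Open Scope classical_set_scope.
Local Open Scope ring_scope.

(* m1 \x m2 under another name: on m1 \x m2 itself the canonical structure of
   sigma-finite measure is only inferred for products of (sub)probabilities. *)
Section product_measure.
Context d1 d2 (T1 : measurableType d1) (T2 : measurableType d2) (R : realType).
Variable m1 : {sigma_finite_measure set T1 -> \bar R}.
Variable m2 : {sigma_finite_measure set T2 -> \bar R}.
Local Open Scope ereal_scope.

Definition mprod : set (T1 * T2) -> \bar R := m1 \x m2.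

HB.instance Definition _ := Measure.on mprod.

Let mprod_sigma_finite : sigma_finite setT mprod.
Proof.
have /sigma_finiteP[F [TF ndF Foo]] := sigma_finiteT m1.
have /sigma_finiteP[G [TG ndG Goo]] := sigma_finiteT m2.
exists (fun n => F n `*` G n).
  rewrite -setXTT TF TG predeqE => -[x y]; split.
    move=> [/= [n _ Fnx] [k _ Gky]]; exists (maxn n k) => //; split.
    - by move: x Fnx; exact/subsetPset/ndF/leq_maxl.
    - by move: y Gky; exact/subsetPset/ndG/leq_maxr.
  by move=> [n _ []/= ? ?]; split; exists n.
move=> k; have [? ?] := Foo k; have [? ?] := Goo k.
split; first exact: measurableX.
by rewrite /mprod product_measure1E// lte_mul_pinfty// ge0_fin_numE.
Qed.

HB.instance Definition _ := Measure_isSigmaFinite.Build _ _ _ mprod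
  mprod_sigma_finite.

End product_measure.

Section vectors.
Context {R : realType}.

Definition dot (x y : 'cV[R]_3) : R := \sum_i x i 0 * y i 0.

(* The norm `|x| that the library puts on matrices is the sup norm; this is the
   Euclidean one. *)
Definition enorm (x : 'cV[R]_3) : R := Num.sqrt (dot x x).

Definition japanese (x : 'cV[R]_3) : R := Num.sqrt (1 + enorm x ^+ 2).

Definition wedge (x v : 'cV[R]_3) : 'M[R]_3 := x *m v^T - v *m x^T.

Definition grad (f : 'cV[R]_3 -> R) (x : 'cV[R]_3) : 'cV[R]_3 :=
  \col_i 'D_(delta_mx i 0) f x.

(* The value at 0 is 0. *)
Definition direction (x : 'cV[R]_3) : 'cV[R]_3 := (enorm x)^-1 *: x.

End vectors.

(* The library has Lebesgue measure on R, but no measure on 'cV[R]_3: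
   integrals over R^3 are taken over coordinate triples. *)
Notation coord3 R :=
  (measurableTypeR R * measurableTypeR R * measurableTypeR R)%type.

Section measures.
Context {R : realType}.

Definition vec (z : coord3 R) : 'cV[R]_3 :=
  \col_i [:: z.1.1; z.1.2; z.2]`_i.

Definition coords (x : 'cV[R]_3) : coord3 R := (x 0 0, x 1 0, x 2 0).

Definition leb3 : {sigma_finite_measure set (coord3 R) -> \bar R} :=
  mprod (mprod (@lebesgue_measure R) (@lebesgue_measure R))
    (@lebesgue_measure R).

Definition leb6 :
    {sigma_finite_measure set (coord3 R * coord3 R)%type -> \bar R} :=
  mprod leb3 leb3.

Definition punctured_ball : set (coord3 R) :=
  [set y | 0 < enorm (vec y) <= 1].

Definition to_sphere (y : coord3 R) : coord3 R := coords (direction (vec y)).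

Let enorm_vec (y : coord3 R) :
  enorm (vec y) = Num.sqrt (y.1.1 ^+ 2 + y.1.2 ^+ 2 + y.2 ^+ 2).
Proof.
by rewrite /enorm /dot !big_ord_recr big_ord0 /= add0r !mxE /= -!expr2.
Qed.

Let measurable_x1 : measurable_fun setT (fun y : coord3 R => y.1.1 : R).
Proof. exact: (measurableT_comp measurable_fst measurable_fst). Qed.

Let measurable_x2 : measurable_fun setT (fun y : coord3 R => y.1.2 : R).
Proof. exact: (measurableT_comp measurable_snd measurable_fst). Qed.

Let measurable_x3 : measurable_fun setT (fun y : coord3 R => y.2 : R).
Proof. exact: measurable_snd. Qed.

Lemma measurable_enorm_vec :
  measurable_fun setT (fun y : coord3 R => enorm (vec y)).
Proof.
under eq_fun do rewrite enorm_vec.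
apply: measurableT_comp.
  apply: continuous_measurable_fun; exact: sqrt_continuous.
by do 2?apply: measurable_funD => //; exact: measurable_funX.
Qed.

Lemma measurable_punctured_ball : measurable punctured_ball.
Proof.
have := @measurable_enorm_vec measurableT _ (measurable_itv `]0, 1]).
by rewrite setTI; congr measurable; apply/seteqP; split => y /=; rewrite in_itv.
Qed.

Lemma measurable_to_sphere : measurable_fun setT to_sphere.
Proof.
have me : measurable_fun setT (fun y : coord3 R => (enorm (vec y))^-1).
  under eq_fun do rewrite -powR_inv1 ?sqrtr_ge0//.
  exact: measurableT_comp (measurable_powR _) measurable_enorm_vec.
rewrite /to_sphere /coords.
by apply: measurable_fun_pair; first apply: measurable_fun_pair;
  under eq_fun do rewrite !mxE /=; apply: measurable_funM.
Qed.

(* Surface measure on the unit sphere: three times the volume of the cone over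
   a set. It is a measure on R^3 carried by the sphere. *)
Definition sphere (A : set (coord3 R)) : \bar R :=
  (3%:E * leb3 (to_sphere @^-1` A `&` punctured_ball))%E.

Let msphere : {measure set (coord3 R) -> \bar R} := mscale 3%:nng
  (measure_function_pushforward__canonical__measure_function_Measure
    (mrestr leb3 measurable_punctured_ball) measurable_to_sphere).

Let sphere0 : sphere set0 = 0%E.
Proof. exact: measure0 msphere. Qed.

Let sphere_ge0 A : (0 <= sphere A)%E.
Proof. exact: measure_ge0 msphere _. Qed.

Let sphere_sigma_additive : semi_sigma_additive sphere.
Proof.
move=> F mF tF mU.
exact: (@measure_semi_sigma_additive _ _ _ msphere F mF tF mU).
Qed.

HB.instance Definition _ := isMeasure.Build _ _ _ sphere
  sphere0 sphere_ge0 sphere_sigma_additive.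

Let fin_num_sphere : fin_num_fun sphere.
Proof.
apply: lty_fin_num_fun; rewrite /= /sphere preimage_setT setTI.
apply: lte_mul_pinfty => //.
pose I : set (measurableTypeR R) := `[-1, 1]%classic.
have sub : punctured_ball `<=` (I `*` I) `*` I.
  move=> y /= /andP[_]; rewrite enorm_vec => y1.
  have {y1} : y.1.1 ^+ 2 + y.1.2 ^+ 2 + y.2 ^+ 2 <= 1.
    by rewrite -sqrtr1 ler_sqrt// in y1.
  have := sqr_ge0 y.1.1; have := sqr_ge0 y.1.2; have := sqr_ge0 y.2.
  move=> h1 h2 h3 h; rewrite /I /= !in_itv /=.
  by split; [split|]; rewrite -ler_norml -(@expr_le1 _ 2) ?real_normK ?num_real//;
    apply: le_trans h; lra.
have mI : measurable I by exact: measurable_itv.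
apply: (@le_lt_trans _ _ (leb3 ((I `*` I) `*` I))).
  apply: le_measure; rewrite ?inE//; first exact: measurable_punctured_ball.
  by apply: measurableX => //; exact: measurableX.
have -> : leb3 ((I `*` I) `*` I) = (lebesgue_measure I * lebesgue_measure I *
    lebesgue_measure I)%E.
  transitivity (mprod (@lebesgue_measure R) (@lebesgue_measure R) (I `*` I) *
      lebesgue_measure I)%E.
    by apply: product_measure1E => //; exact: measurableX.
  by congr (_ * _)%E; exact: product_measure1E.
by rewrite /I lebesgue_measure_itv /= lte_fin; case: ifP => _;
  rewrite ?mul0e ?mule0 -?EFinD -?EFinM ltry.
Qed.

HB.instance Definition _ := Measure_isFinite.Build _ _ _ sphere fin_num_sphere.

End measures.

Section moments.
Context {R : realType}.
Implicit Types (Phi : 'cV[R]_3 -> R) (F : 'cV[R]_3 -> 'cV[R]_3 -> R).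

(* Phi(x) = |x|^p / p, for p > 2 *)
Definition potential_gt2 (p : R) (x : 'cV[R]_3) : R := enorm x `^ p / p.

(* Phi(x) = <x>^p / p, for 1 < p < 2 *)
Definition potential_lt2 (p : R) (x : 'cV[R]_3) : R := japanese x `^ p / p.

Definition mass F : R := \int[leb6]_z F (vec z.1) (vec z.2).

Definition energy Phi F : R :=
  \int[leb6]_z
    ((Phi (vec z.1) + enorm (vec z.2) ^+ 2 / 2) * F (vec z.1) (vec z.2)).

Definition angular_momentum F : 'M[R]_3 :=
  \matrix_(i, j)
    \int[leb6]_z (wedge (vec z.1) (vec z.2) i j * F (vec z.1) (vec z.2)).

Definition Psi Phi F : R * R * 'M[R]_3 :=
  (mass F, energy Phi F, angular_momentum F).

Definition total Phi F : \bar R :=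
  (\int[leb6]_z ((Phi (vec z.1) + enorm (vec z.2) ^+ 2 + 1) *
                 F (vec z.1) (vec z.2))%:E)%E.

Definition initial_datum Phi F : Prop :=
  [/\ measurable_fun setT
        (fun z : coord3 R * coord3 R => F (vec z.1) (vec z.2)),
      forall x v, 0 <= F x v
    & (0 < total Phi F < +oo)%E].

Definition moments_gt2 Phi : set (R * R * 'M[R]_3) :=
  [set Psi Phi F | F in initial_datum Phi].

Definition moments_lt2 Phi : set (R * R) :=
  [set (mass F, energy Phi F) | F in initial_datum Phi].

End moments.

Section Boltzmann.
Context {R : realType}.
Implicit Types (b : R -> R) (B : 'cV[R]_3 -> 'cV[R]_3 -> R).
Implicit Types (f g : 'cV[R]_3 -> R) (v w sigma : 'cV[R]_3).

Definition post_collision v w sigma : 'cV[R]_3 :=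
  2^-1 *: (v + w) + (enorm (v - w) / 2) *: sigma.

Definition post_collision_star v w sigma : 'cV[R]_3 :=
  2^-1 *: (v + w) - (enorm (v - w) / 2) *: sigma.

Definition collision_kernel (gamma : R) b : 'cV[R]_3 -> 'cV[R]_3 -> R :=
  fun z sigma => enorm z `^ gamma * b (dot (direction z) sigma).

Definition cutoff b : Prop := forall z : 'cV[R]_3, enorm z = 1 ->
  (\int[sphere]_sigma (b (dot z (vec sigma)))%:E < +oo)%E.

Definition noncutoff b : Prop := exists s cb Cb : R,
  [/\ 0 < s < 1, 0 < cb, cb <= Cb &
      forall theta, 0 < theta <= pi / 2 ->
        cb * theta `^ (- 2 - 2 * s) <= b (cos theta)
          <= Cb * theta `^ (- 2 - 2 * s)].

(* b is a function of cos theta, so that only its values on [-1, 1] matter;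
   the support condition theta <= pi / 2 reads cos theta >= 0. *)
Definition angular_kernel b : Prop :=
  [/\ measurable_fun setT b,
      forall c, 0 <= b c,
      forall c, c < 0 -> b c = 0,
      ~ {ae @lebesgue_measure R, forall c, -1 <= c <= 1 -> b c = 0}
    & cutoff b \/ noncutoff b].

(* The value is an extended real number, and oo - oo is -oo: if it is finite,
   the integral converges absolutely. *)
Definition Q B f g v : \bar R :=
  (\int[mprod leb3 sphere]_z
     (let w := vec z.1 in let sigma := vec z.2 in
      B (v - w) sigma *
      (f (post_collision_star v w sigma) * g (post_collision v w sigma)
       - f w * g v))%:E)%E.

(* The integrand of minus the entropy production, \int Q(f, f) ln f dv *)
Definition entropy_integrand B f (z : coord3 R * coord3 R * coord3 R) : R :=
  let v := vec z.1.1 in let w := vec z.1.2 in let sigma := vec z.2 in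
  B (v - w) sigma *
  (f (post_collision_star v w sigma) * f (post_collision v w sigma)
   - f w * f v) * ln (f v).

(* Time ranges over [0, +oo[. *)
Notation density := ({nonneg R} -> 'cV[R]_3 -> 'cV[R]_3 -> R).

Implicit Types (Phi : 'cV[R]_3 -> R) (M : density).

(* Differentiability in t is part of transport_equation. *)
Definition sufficiently_regular B M : Prop :=
  (forall t x v, differentiable
     (fun z : 'cV[R]_3 * 'cV[R]_3 => M t z.1 z.2) (x, v)) /\
  (forall t x, (mprod leb6 sphere).-integrable setT
     (EFin \o entropy_integrand B (M t x))).

(* The time derivative, one-sided at t = 0, exists and equals
   grad Phi . grad_v M - v . grad_x M. *)
Definition transport_equation Phi M : Prop :=
  forall (t : {nonneg R}) x v,
    (M `|s|%:nng x v - M t x v) / (s - t%:num)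
      @[s --> within [set s : R | 0 <= s] (t%:num)^'] -->
    'D_(grad Phi x) (M t x) v - 'D_v (fun y => M t y v) x.

Definition equilibria Phi B : set density :=
  [set M | [/\ sufficiently_regular B M,
               forall t x v, 0 < M t x v,
               forall t, (total Phi (M t) < +oo)%E,
               transport_equation Phi M
             & forall t x v, Q B (M t x) (M t x) v = 0%E]].

End Boltzmann.

(* Main.v *)
(* Since Q(f, f) = 0, the integral of Q(f, f) ln f vanishes, and H theorem
   symmetrization gives B (f' f'_* - f f_* ) = 0 almost everywhere. As b is not
   negligible, f' f'_* = f f_* holds everywhere along one fixed angle, and the
   rectangles in velocity space that this angle generates force ln f to be
   quadratic in v. The transport equation turns the coefficients into functions
   of x for which ln M is a combination of 1, Phi + |v|^2 / 2 and the components
   of x /\ v, because Phi is not harmonic; for p < 2 a rotation term destroys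
   integrability. Equilibria are therefore an exponential family exp(L . phi) in
   the conserved quantities phi. Its member with the moments V of a given datum
   F0 minimizes the integral of exp(L . phi) minus L . V over L, which is coercive
   because F0 is a nonzero density; it is unique because
   (M1 - M2) (ln M1 - ln M2) >= 0. *)
From HB Require Import structures.
Require Import Defs.
From mathcomp Require Import all_boot all_order all_algebra.
From mathcomp Require Import all_classical all_reals all_analysis.
From mathcomp Require Import measurable_realfun ring lra.

Set Implicit Arguments.
Unset Strict Implicit.
Unset Printing Implicit Defensive.

Import Order.TTheory GRing.Theory Num.Theory.
Import numFieldNormedType.Exports.

Local Open Scope classical_set_scope.
Local Open Scope ring_scope.

(** * Measure preserving maps *)

(** Two obstacles shape the proof. Regularity is scarce: a solution is differentiable once, and the
    coefficients of [ln M] as a polynomial in v come without any regularity in (t, x). So mixed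
    second derivatives are never exchanged. Identities come from computing one directional
    derivative in two ways, and time dependence is excluded by comparing how the two results scale
    in x. Secondly, the collision integrand vanishes only almost everywhere, which says something
    only where [b] is nonzero, a set that may contain no interval. The information is concentrated
    at one cosine [c0] such that every neighbourhood of its cotangent meets this set in a
    non-negligible part. As [c0] depends on [b] alone, it serves all t and x.

    No Jacobian of a collision is computed: surface measure is a volume of cones, so the passage
    from pre- to post-collisional velocities reduces to exchanging two factors of a product measure.

    The functional to be minimized takes the value +oo. It is finite exactly on the open half space
    where the coefficient of the energy is negative; openness is what makes a minimizer a critical
    point. *)

Section measure_preserving.
Local Open Scope ereal_scope.
Context {R : realType}.

Definition mpres d1 d2 (S : measurableType d1) (T : measurableType d2)
    (f : S -> T) (mu : set S -> \bar R) (nu : set T -> \bar R) :=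
  measurable_fun setT f /\ forall A, measurable A -> mu (f @^-1` A) = nu A.

Lemma mpres_id d (T : measurableType d) (mu : set T -> \bar R) :
  mpres (fun x => x) mu mu.
Proof. by split => // A mA; rewrite preimage_id. Qed.

Lemma mpres_comp d1 d2 d3 (T1 : measurableType d1) (T2 : measurableType d2)
    (T3 : measurableType d3) (f : T1 -> T2) (g : T2 -> T3)
    (m1 : set T1 -> \bar R) (m2 : set T2 -> \bar R) (m3 : set T3 -> \bar R) :
  mpres f m1 m2 -> mpres g m2 m3 -> mpres (fun x => g (f x)) m1 m3.
Proof.
move=> [mf f12] [mg g23]; split; first exact: measurableT_comp.
move=> A mA; rewrite -g23// -f12//.
by rewrite -[X in measurable X]setTI; exact: mg.
Qed.

(** Only a left inverse is required, since the preimage under [f] of the preimage of A under [g] is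
    A itself. Polar coordinates need this: the product of radii and directions also contains pairs
    that no vector produces. *)
Lemma mpres_retract d1 d2 (S : measurableType d1) (T : measurableType d2)
    (f : S -> T) (g : T -> S) (mu : set S -> \bar R) (nu : set T -> \bar R) :
  mpres f mu nu -> measurable_fun setT g -> cancel f g -> mpres g nu mu.
Proof.
move=> [mf fE] mg fg; split=> // A mA; rewrite -fE.
  by congr (mu _); apply/seteqP; split => x; rewrite /preimage /= fg.
by rewrite -[X in measurable X]setTI; exact: mg.
Qed.

Lemma mpres_ext d1 d2 (S : measurableType d1) (T : measurableType d2)
    (f g : S -> T) (mu : set S -> \bar R) (nu : set T -> \bar R) :
  (forall x, f x = g x) -> mpres f mu nu -> mpres g mu nu.
Proof. by move=> /funext ->. Qed.

Lemma mpres_ge0_integral d1 d2 (S : measurableType d1) (T : measurableType d2)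
    (f : S -> T) (mu : {measure set S -> \bar R})
    (nu : {measure set T -> \bar R}) (h : T -> \bar R) :
  mpres f mu nu -> measurable_fun setT h -> (forall x, 0 <= h x) ->
  \int[mu]_x h (f x) = \int[nu]_y h y.
Proof.
move=> [mf fE] mh h0; transitivity (\int[pushforward mu f]_y h y).
  by rewrite ge0_integral_pushforward.
apply: (eq_measure_integral nu
  (m1 := measure_function_pushforward__canonical__measure_function_Measure mu mf)).
by move=> A mA _; rewrite /= /pushforward fE.
Qed.

Lemma mpres_integrable d1 d2 (S : measurableType d1) (T : measurableType d2)
    (f : S -> T) (mu : {measure set S -> \bar R})
    (nu : {measure set T -> \bar R}) (h : T -> \bar R) :
  mpres f mu nu -> nu.-integrable setT h ->
  mu.-integrable setT (fun x => h (f x)).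
Proof.
move=> fp /integrableP[mh hoo]; apply/integrableP; split.
  exact: measurableT_comp mh fp.1.
by rewrite (mpres_ge0_integral fp (h := fun y => `|h y|))//;
  exact: measurableT_comp.
Qed.

Lemma mpres_integral d1 d2 (S : measurableType d1) (T : measurableType d2)
    (f : S -> T) (mu : {measure set S -> \bar R})
    (nu : {measure set T -> \bar R}) (h : T -> \bar R) :
  mpres f mu nu -> measurable_fun setT h ->
  \int[mu]_x h (f x) = \int[nu]_y h y.
Proof.
move=> fp mh; transitivity (\int[mu]_x (h \o f) x) => //.
rewrite integralE [RHS]integralE funepos_comp funeneg_comp; congr (_ - _).
    rewrite -(mpres_ge0_integral (h := h^\+) fp)//; last exact: measurable_funepos.

rewrite -(mpres_ge0_integral (h := h^\-) fp)//; last exact: measurable_funeneg.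

Qed.

Section products.
Context d1 d2 (T1 : measurableType d1) (T2 : measurableType d2).
Context e1 e2 (S1 : measurableType e1) (S2 : measurableType e2).
Variables (m1 : {sigma_finite_measure set T1 -> \bar R})
  (m2 : {sigma_finite_measure set T2 -> \bar R})
  (n1 : {sigma_finite_measure set S1 -> \bar R})
  (n2 : {sigma_finite_measure set S2 -> \bar R}).

Lemma mpres_rectangle d (T : measurableType d) (mu : {measure set T -> \bar R})
    (f : T -> S1 * S2) :
  measurable_fun setT f ->
  (forall A B, measurable A -> measurable B ->
    mu (f @^-1` (A `*` B)) = n1 A * n2 B) ->
  mpres f mu (mprod n1 n2).
Proof.
move=> mf fAB; split=> // X mX; apply/esym.
exact: (@product_measure_unique _ _ _ _ R n1 n2
  (measure_function_pushforward__canonical__measure_function_Measure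
    mu mf)).
Qed.

(** By integration over sections: the fibre over x of the preimage of a rectangle has measure [n2 B]
    or 0. Such triangular maps, with swaps and reassociations, generate the changes of variables
    below. *)
Lemma mpres_skew (f : T1 -> S1) (g : T1 -> T2 -> S2) :
  mpres f m1 n1 -> measurable_fun setT (fun z : T1 * T2 => g z.1 z.2) ->
  (forall x, mpres (g x) m2 n2) ->
  mpres (fun z : T1 * T2 => (f z.1, g z.1 z.2)) (mprod m1 m2) (mprod n1 n2).
Proof.
move=> [mf fE] mg gE; apply: mpres_rectangle.
  apply: measurable_fun_pair => //; exact: measurableT_comp mf measurable_fst.
move=> A B mA mB; rewrite /mprod /product_measure1 /=.
have mfA : measurable (f @^-1` A) by rewrite -[X in measurable X]setTI; exact: mf.
transitivity (\int[m1]_x (n2 B * (\1_(f @^-1` A) x)%:E)).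
  apply: eq_integral => x _; rewrite indicE.
  have [/set_mem xA|xA] := boolP (x \in f @^-1` A).
    rewrite mule1 -(gE x).2//; congr (m2 _); apply/seteqP; split => y /=.
      by rewrite /xsection /= inE => -[].
    by rewrite /xsection /= inE /=.
  rewrite mule0 -(measure0 m2); congr (m2 _); apply/seteqP; split => y //=.
  by rewrite /xsection /= inE /= => -[]; move: xA; rewrite notin_setE.
rewrite ge0_integralZl//; last exact/measurable_EFinP.
rewrite muleC; congr (_ * _); rewrite integral_indic// setIT; exact: fE.
Qed.

(** The push-forward divided by [k1 * k2] agrees with the product measure on rectangles, hence
    everywhere by uniqueness. *)
Lemma mprod_dilation (k1 k2 : R) (f : T1 -> S1) (g : T2 -> S2) :
  (0 < k1)%R -> (0 < k2)%R -> measurable_fun setT f -> measurable_fun setT g ->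
  (forall A, measurable A -> m1 (f @^-1` A) = k1%:E * n1 A) ->
  (forall A, measurable A -> m2 (g @^-1` A) = k2%:E * n2 A) ->
  forall A, measurable A ->
  mprod m1 m2 ((fun z => (f z.1, g z.2)) @^-1` A) = (k1 * k2)%:E * mprod n1 n2 A.
Proof.
move=> k10 k20 mf mg fE gE A mA.
have mfg : measurable_fun setT (fun z : T1 * T2 => (f z.1, g z.2)).
  by apply: measurable_fun_pair; exact: measurableT_comp.
have k0 : (0 <= (k1 * k2)^-1)%R by rewrite invr_ge0 mulr_ge0// ltW.
pose m' := mscale (NngNum k0)
  (measure_function_pushforward__canonical__measure_function_Measure
    (mprod m1 m2) mfg).
suff -> : mprod n1 n2 A = m' A.
  rewrite /m' /mscale /= muleA -EFinM mulfV ?mul1e//.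
  by rewrite mulf_neq0// gt_eqF.
apply: (@product_measure_unique _ _ _ _ R n1 n2 m') => // B C mB mC.
transitivity (((k1 * k2)^-1)%:E *
  mprod m1 m2 ((f @^-1` B) `*` (g @^-1` C))) => //.
transitivity (((k1 * k2)^-1)%:E * ((k1%:E * n1 B) * (k2%:E * n2 C))).
  rewrite -fE// -gE//; congr (_ * _); apply: product_measure1E.
  - by rewrite -[X in measurable X]setTI; exact: mf.
  - by rewrite -[X in measurable X]setTI; exact: mg.
rewrite [X in _ * X]muleACA -EFinM [LHS]muleA -EFinM mulVf ?mul1e//.
by rewrite mulf_neq0// gt_eqF.
Qed.

End products.

Lemma mpres_swap d1 d2 (T1 : measurableType d1) (T2 : measurableType d2)
  (m1 : {sigma_finite_measure set T1 -> \bar R})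
  (m2 : {sigma_finite_measure set T2 -> \bar R}) :
  mpres (fun z : T1 * T2 => (z.2, z.1)) (mprod m1 m2) (mprod m2 m1).
Proof.
apply: mpres_rectangle; first exact: measurable_fun_pair.
move=> A B mA mB; rewrite muleC.
have -> : (fun z : T1 * T2 => (z.2, z.1)) @^-1` (A `*` B) = B `*` A.
  by apply/seteqP; split => -[x y] [].
exact: product_measure1E.
Qed.

Lemma mpres_assoc d1 d2 d3 (T1 : measurableType d1) (T2 : measurableType d2)
  (T3 : measurableType d3)
  (m1 : {sigma_finite_measure set T1 -> \bar R})
  (m2 : {sigma_finite_measure set T2 -> \bar R})
  (m3 : {sigma_finite_measure set T3 -> \bar R}) :
  mpres (fun z : T1 * T2 * T3 => (z.1.1, (z.1.2, z.2)))
    (mprod (mprod m1 m2) m3) (mprod m1 (mprod m2 m3)).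
Proof.
apply: mpres_rectangle.
  apply: measurable_fun_pair; first exact: (measurableT_comp measurable_fst measurable_fst).
  apply: measurable_fun_pair => //; exact: (measurableT_comp measurable_snd measurable_fst).
move=> A D mA mD; rewrite /mprod /product_measure1 /=.
(* [D] is any measurable set of pairs, not a rectangle, so the mass of its sections is integrated
   over [T2] by Tonelli. *)
pose h (z : T1 * T2) := (\1_A z.1)%:E * m3 (xsection D z.2).
have mh2 : measurable_fun setT (fun y => m3 (xsection D y)).
  exact: (measurable_fun_xsection m3).
have mh : measurable_fun setT h.
  apply: emeasurable_funM; last exact: measurableT_comp mh2 measurable_snd.
  apply/measurable_EFinP; exact: measurableT_comp measurable_fst.
transitivity (\int[m1 \x m2]_z h z).
  apply: eq_integral => -[x y] _; rewrite /h /= indicE.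
  have [/set_mem xA|xA] := boolP (x \in A).
    rewrite mul1e; congr (m3 _); apply/seteqP; split => z /=.
      by rewrite /xsection /= !inE => -[].
    by rewrite /xsection /= !inE /=.
  rewrite mul0e -(measure0 m3); congr (m3 _); apply/seteqP; split => z //=.
  by rewrite /xsection /= inE /= => -[]; move: xA; rewrite notin_setE.
rewrite fubini_tonelli1//; last first.
  by move=> z; rewrite mule_ge0// lee_fin.
rewrite /fubini_F /h /=.
transitivity (\int[m1]_x ((\1_A x)%:E * \int[m2]_y m3 (xsection D y))).
  by apply: eq_integral => x _; rewrite ge0_integralZl// lee_fin.
rewrite ge0_integralZr ?integral_indic ?setIT//.
- exact/measurable_EFinP.
- exact: integral_ge0.
Qed.

End measure_preserving.

Section assoc_inverse.
Context {R : realType}.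

Lemma mpres_assocV d1 d2 d3 (T1 : measurableType d1) (T2 : measurableType d2)
  (T3 : measurableType d3)
  (m1 : {sigma_finite_measure set T1 -> \bar R})
  (m2 : {sigma_finite_measure set T2 -> \bar R})
  (m3 : {sigma_finite_measure set T3 -> \bar R}) :
  mpres (fun z : T1 * (T2 * T3) => ((z.1, z.2.1), z.2.2))
    (mprod m1 (mprod m2 m3)) (mprod (mprod m1 m2) m3).
Proof.
apply: mpres_retract (mpres_assoc m1 m2 m3) _ _; last by move=> [[]].
apply: measurable_fun_pair; last exact: (measurableT_comp measurable_snd measurable_snd).
apply: measurable_fun_pair => //; exact: (measurableT_comp measurable_fst measurable_snd).
Qed.

End assoc_inverse.

(** * Affine changes of variables for Lebesgue measure *)

Section lebesgue_affine.
Local Open Scope ereal_scope.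
Context {R : realType}.
Notation leb := (@lebesgue_measure R).

Lemma ocitv_itv (X : set R) : ocitv X -> X = set0 \/
  exists a b : R, (a < b)%R /\ X = `]a, b]%classic.
Proof. by move=> /ocitvP[->|[[a b] ab ->]]; [left|right; exists a, b]. Qed.

Lemma lebesgue_translation (a : R) :
  mpres (fun x : measurableTypeR R => (x + a)%R : measurableTypeR R) leb leb.
Proof.
have mf : measurable_fun setT
  (fun x : measurableTypeR R => (x + a)%R : measurableTypeR R).
  exact: measurable_funD.
split => // A mA; apply/esym.
apply: (@lebesgue_measure_unique R
  (measure_function_pushforward__canonical__measure_function_Measure leb mf)) => //.
move=> X /ocitv_itv[->|[u [v [uv ->]]]]; first by rewrite !measure0.
rewrite /= /pushforward.
have -> : (fun x => x + a)%R @^-1` `]u, v] = `](u - a)%R, (v - a)%R]%classic.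
  by apply/seteqP; split => x /=; rewrite !in_itv /= ltrBlDr lerBrDr.
rewrite [LHS]lebesgue_measure_itv [RHS]lebesgue_measure_itv /= !lte_fin uv ltrD2r uv -!EFinB.
by congr (_%:E); ring.
Qed.

Lemma lebesgue_scale (r : R) : r != 0%R ->
  forall A, measurable A ->
  leb ((fun x : measurableTypeR R => (r * x)%R : measurableTypeR R) @^-1` A) =
  (`|r|^-1)%:E * leb A.
Proof.
move=> r0 A mA.
have mf : measurable_fun setT
  (fun x : measurableTypeR R => (r * x)%R : measurableTypeR R).
  exact: measurable_funM.
have k0 : (0 <= `|r|)%R by [].
pose m' := mscale (NngNum k0)
  (measure_function_pushforward__canonical__measure_function_Measure leb mf).
suff -> : leb A = m' A.
  by rewrite /m' /mscale /= muleA -EFinM mulVf ?mul1e// normr_eq0.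
apply: lebesgue_measure_unique => //.
move=> X /ocitv_itv[->|[u [v [uv ->]]]]; first by rewrite !measure0.
transitivity (`|r|%:E * leb ( *%R r @^-1` `]u, v])) => //.
(* A negative factor reverses the interval, which moves its closed end to the left and leaves the
   length formula alone. *)
move: r0; rewrite neq_lt => /orP[r0|r0].
  have -> : ( *%R r) @^-1` `]u, v] = `[(r^-1 * v)%R, (r^-1 * u)%R[%classic.
    apply/seteqP; split => x /=; rewrite !in_itv /= => /andP[h1 h2]; apply/andP.
      by rewrite ler_ndivrMl// ltr_ndivlMl// mulrC.
    by move: h1 h2; rewrite ler_ndivrMl// ltr_ndivlMl// => -> ->.
  rewrite [LHS]lebesgue_measure_itv [in RHS]lebesgue_measure_itv /= !lte_fin uv ltr_nM2l ?invr_lt0// uv.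
  by rewrite -!EFinB -EFinM ltr0_norm//; congr (_%:E); field; rewrite lt_eqF.
have -> : ( *%R r) @^-1` `]u, v] = `](r^-1 * u)%R, (r^-1 * v)%R]%classic.
  apply/seteqP; split => x /=; rewrite !in_itv /= => /andP[h1 h2]; apply/andP.
    by rewrite ler_pdivlMl// ltr_pdivrMl.
  by move: h1 h2; rewrite ler_pdivlMl// ltr_pdivrMl// => -> ->.
rewrite [LHS]lebesgue_measure_itv [in RHS]lebesgue_measure_itv /= !lte_fin uv ltr_pM2l ?invr_gt0// uv.
by rewrite -!EFinB -EFinM gtr0_norm//; congr (_%:E); field; rewrite gt_eqF.
Qed.

End lebesgue_affine.

Section leb3.
Context {R : realType}.
Implicit Types (x : 'cV[R]_3) (y : coord3 R).

Lemma vecK y : coords (vec y) = y.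
Proof. by case: y => -[a b] c; rewrite /coords !mxE. Qed.

Lemma coordsK x : vec (coords x) = x.
Proof.
apply/matrixP => i j; rewrite !mxE ord1.
by case: i => -[|[|[|//]]] h; rewrite /=; congr (x _ _); exact: val_inj.
Qed.

Lemma coords_inj : injective (@coords R).
Proof. exact: can_inj coordsK. Qed.

Lemma vec_inj : injective (@vec R).
Proof. exact: can_inj vecK. Qed.

Lemma leb3_translation x : mpres (fun y => coords (vec y + x)) leb3 leb3.
Proof.
apply: (mpres_ext (f := fun y => ((y.1.1 + x 0 0, y.1.2 + x 1 0), y.2 + x 2 0))).
  by move=> -[[a b] c]; rewrite /coords !mxE.
have k (a b : R) : mpres (fun z : measurableTypeR R * measurableTypeR R =>
    (z.1 + a, z.2 + b)) (mprod lebesgue_measure lebesgue_measure)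
    (mprod lebesgue_measure lebesgue_measure).
  apply: (mpres_skew (f := fun x : measurableTypeR R => x + a : measurableTypeR R)
    (g := fun _ (y : measurableTypeR R) => y + b : measurableTypeR R)) => [||_];
    [exact: lebesgue_translation| |exact: lebesgue_translation].
  by apply: measurable_funD; [exact: measurable_snd|exact: measurable_cst].
apply: (mpres_skew (m1 := mprod lebesgue_measure lebesgue_measure)
  (n1 := mprod lebesgue_measure lebesgue_measure)
  (g := fun _ (y : measurableTypeR R) =>
  y + x 2 0 : measurableTypeR R) (k (x 0 0) (x 1 0))) => [|_];
  last exact: lebesgue_translation.
by apply: measurable_funD; [exact: measurable_snd|exact: measurable_cst].
Qed.

Lemma leb3_scale (r : R) (A : set (coord3 R)) : r != 0 -> measurable A ->
  leb3 ((fun y => coords (r *: vec y)) @^-1` A) = ((`|r| ^- 3)%:E * leb3 A)%E.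
Proof.
move=> r0 mA.
have -> : (fun y => coords (r *: vec y)) =
    (fun y => ((r * y.1.1, r * y.1.2), r * y.2)).
  by apply/funext => -[[a b] c]; rewrite /coords !mxE.
have rr : 0 < `|r|^-1 by rewrite invr_gt0 normr_gt0.
have mm : measurable_fun setT
  (fun x : measurableTypeR R => (r * x)%R : measurableTypeR R).
  exact: measurable_funM.
have -> : `|r| ^- 3 = `|r|^-1 * `|r|^-1 * `|r|^-1.
  by rewrite -exprVn !exprS expr0 mulr1 mulrA.
apply: (mprod_dilation (m1 := mprod lebesgue_measure lebesgue_measure)
  (n1 := mprod lebesgue_measure lebesgue_measure)
  (f := fun z : measurableTypeR R * measurableTypeR R => (r * z.1, r * z.2))) => //.
- exact: mulr_gt0.
- apply: measurable_fun_pair;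
    [exact: measurableT_comp mm measurable_fst|exact: measurableT_comp mm measurable_snd].
- apply: (mprod_dilation (f := fun x : measurableTypeR R => (r * x)%R : measurableTypeR R)
    (g := fun x : measurableTypeR R => (r * x)%R : measurableTypeR R)) => //; exact: lebesgue_scale.
- exact: lebesgue_scale.
Qed.

Lemma measurable_coords_scale (r : R) :
  measurable_fun setT (fun y => coords (r *: vec y)).
Proof.
have -> : (fun y => coords (r *: vec y)) =
    (fun y => ((r * y.1.1, r * y.1.2), r * y.2)).
  by apply/funext => -[[a b] c]; rewrite /coords !mxE.
do 2?apply: measurable_fun_pair; apply: measurable_funM => //.
- exact: (measurableT_comp measurable_fst measurable_fst).
- exact: (measurableT_comp measurable_snd measurable_fst).
Qed.

Lemma leb3_opp : mpres (fun y => coords (- vec y)) leb3 leb3.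
Proof.
split=> [|A mA].
  by under eq_fun do rewrite -scaleN1r; exact: measurable_coords_scale.
under eq_fun do rewrite -scaleN1r.
by rewrite leb3_scale// ?oppr_eq0 ?oner_eq0// normrN1 expr1n invr1 mul1e.
Qed.

End leb3.

(** * Measurability of continuous functions of vectors *)

Section borel_maps.
Context {R : realType}.

(** With a countable dense family [q], an open set is the union of the countably many balls of
    radius 1/(k + 1) around points of [q] that it contains. *)
Lemma measurable_open_preimage d (Z : measurableType d)
    (T : pseudoMetricType R) (I : countType) (q : I -> T) (h : Z -> T) :
  (forall x (e : R), 0 < e -> exists i, ball (q i) e x) ->
  (forall i (e : R), measurable (h @^-1` ball (q i) e)) ->
  forall U, open U -> measurable (h @^-1` U).
Proof.
move=> qd hm U oU.
pose J (p : I * nat) := `[< ball (q p.1) (p.2.+1%:R^-1 : R) `<=` U >].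
pose V n := if unpickle n is Some p then
  (if J p then h @^-1` ball (q p.1) (p.2.+1%:R^-1 : R) else set0) else set0.
have -> : h @^-1` U = \bigcup_n V n.
  apply/seteqP; split => [z Uz|z [n _]]; last first.
    rewrite /V; case: unpickle => // p; case: ifPn => // /asboolP; exact.
  have /nbhs_ballP[e e0 eU] : nbhs (h z) U by exact: open_nbhs_nbhs.
  have e20 : 0 < e / 2 by exact: divr_gt0.
  have [k _ ke] := near_infty_natSinv_lt (PosNum e20).
  have k0 : 0 < (k.+1%:R^-1 : R) by rewrite invr_gt0 ltr0n.
  have [i qi] := qd (h z) _ k0.
  exists (pickle (i, k)) => //; rewrite /V pickleK /=.
  rewrite ifT//; apply/asboolP => y qy; apply: eU.
  have := ke k (leqnn _) => /= ke'.
  apply: (@le_ball _ _ _ (k.+1%:R^-1 + k.+1%:R^-1)).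
    by rewrite [leRHS](splitr e) lerD// ltW.
  exact: ball_triangle (ball_sym qi) qy.
apply: bigcup_measurable => n _; rewrite /V; case: unpickle => // p.
by case: ifPn.
Qed.

(** The measurable structure lives on coordinate triples and the topology on ['cV[R]_3]; balls
    around a countable dense family link the two. This form passes to products, where a ball is a
    product of balls. *)
Definition borel_map d (Z : measurableType d) (T : pseudoMetricType R)
    (h : Z -> T) := exists (I : countType) (q : I -> T),
  (forall x (e : R), 0 < e -> exists i, ball (q i) e x) /\
  (forall i (e : R), measurable (h @^-1` ball (q i) e)).

Lemma borel_map_pair d1 d2 (Z1 : measurableType d1) (Z2 : measurableType d2)
    (T1 T2 : pseudoMetricType R) (h1 : Z1 -> T1) (h2 : Z2 -> T2) :
  borel_map h1 -> borel_map h2 ->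
  borel_map (fun z : Z1 * Z2 => (h1 z.1, h2 z.2)).
Proof.
move=> [I1 [q1 [d1' m1]]] [I2 [q2 [d2' m2]]].
exists (I1 * I2)%type, (fun i => (q1 i.1, q2 i.2)); split => [[x y] e e0|i e].
  have [i xi] := d1' x e e0; have [j yj] := d2' y e e0.
  by exists (i, j).
exact: (measurableX (m1 i.1 e) (m2 i.2 e)).
Qed.

Lemma borel_map_continuous d (Z : measurableType d) (T : pseudoMetricType R)
    (h : Z -> T) (f : T -> R) :
  borel_map h -> continuous f ->
  measurable_fun setT (fun z => f (h z) : measurableTypeR R).
Proof.
move=> [I [q [qd hm]]] fc.
apply: (measurability _ (RGenOInfty.measurableE R)) => _ [_ [a ->] <-].
rewrite setTI; apply: (measurable_open_preimage qd hm (U := f @^-1` `]a, +oo[)).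
by apply: open_comp => // x _; exact: fc.
Qed.

Lemma ltr_norm_cV3 (x : 'cV[R]_3) (e : R) : 0 < e ->
  (`|x| < e) = [&& `|x 0 0| < e, `|x 1 0| < e & `|x 2 0| < e].
Proof.
move=> e0; rewrite /Num.norm /= mx_normrE; apply/bigmax_ltP/and3P => [[_ h]|].
  by split; [exact: (h (0, 0))|exact: (h (1, 0))|exact: (h (2, 0))].
move=> [h0 h1 h2]; split=> // -[[[|[|[|//]]] i] j] _; rewrite ord1 /=.
- by rewrite (_ : Ordinal i = 0)//; exact: val_inj.
- by rewrite (_ : Ordinal i = 1)//; exact: val_inj.
- by rewrite (_ : Ordinal i = 2)//; exact: val_inj.
Qed.

(** Balls of the sup norm are boxes, hence products of intervals in coordinates, and vectors with
    rational entries are dense. *)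
Lemma borel_map_vec : borel_map (@vec R).
Proof.
exists ('cV[rat]_3 : countType), (fun q : 'cV[rat]_3 => \col_i ratr (q i 0)); split.
  move=> x e e0.
  have /choice[q qx] : forall i : 'I_3, exists q : rat,
      x i 0 - e < ratr q < x i 0 + e.
    move=> i; have : x i 0 - e < x i 0 + e by lra.
    by move=> /rat_in_itvoo[q]; rewrite in_itv /= => ?; exists q.
  exists (\col_i q i); rewrite -ball_normE /= /ball_ /= ltr_norm_cV3// !mxE.
  by rewrite !ltr_norml; have := qx 0; have := qx 1; have := qx 2; lra.
move=> q e; have [e0|e0] := leP e 0.
  rewrite (_ : _ @^-1` _ = set0)//; apply/seteqP; split => // y /=.
  by rewrite -ball_normE /ball_ /= => /(le_lt_trans (normr_ge0 _)); rewrite ltNge e0.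
rewrite [X in measurable X](_ : _ =
   (`]ratr (q 0 0) - e, ratr (q 0 0) + e[ `*`
    `]ratr (q 1 0) - e, ratr (q 1 0) + e[) `*`
    `]ratr (q 2 0) - e, ratr (q 2 0) + e[).
  apply: measurableX; first apply: measurableX; exact: measurable_itv.
apply/seteqP; split => [[[a b] c]|[[a b] c]] /=.
    rewrite -ball_normE /= /ball_ /= ltr_norm_cV3// !mxE /= !in_itv /= !ltr_norml.
    by move=> ?; split; [split|]; lra.
  rewrite !in_itv /= => -[[h0 h1] h2].
  by rewrite -ball_normE /= /ball_ /= ltr_norm_cV3// !mxE /= !ltr_norml; lra.
Qed.

Lemma measurable_continuous_vec (f : 'cV[R]_3 -> R) : continuous f ->
  measurable_fun setT (fun y => f (vec y) : measurableTypeR R).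
Proof. exact: borel_map_continuous borel_map_vec. Qed.

Lemma measurable_continuous_vec2 (f : 'cV[R]_3 * 'cV[R]_3 -> R) :
  continuous f ->
  measurable_fun setT (fun z : coord3 R * coord3 R =>
    f (vec z.1, vec z.2) : measurableTypeR R).
Proof. exact: borel_map_continuous (borel_map_pair borel_map_vec borel_map_vec). Qed.

End borel_maps.

(** * Polar coordinates and the collision map *)

Section euclidean.
Context {R : realType}.
Implicit Types (x y z : 'cV[R]_3) (k : R).

Lemma sum3E (V : nmodType) (f : 'I_3 -> V) : \sum_i f i = f 0 + f 1 + f 2.
Proof.
rewrite !big_ord_recr big_ord0 /= add0r.
by congr (f _ + f _ + f _); exact: val_inj.
Qed.

Lemma dotE x y : dot x y = x 0 0 * y 0 0 + x 1 0 * y 1 0 + x 2 0 * y 2 0.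
Proof. exact: sum3E. Qed.

Lemma cV3P x y : x 0 0 = y 0 0 -> x 1 0 = y 1 0 -> x 2 0 = y 2 0 -> x = y.
Proof. by move=> h0 h1 h2; apply: coords_inj; rewrite /coords h0 h1 h2. Qed.

Lemma dotC x y : dot x y = dot y x.
Proof. by rewrite !dotE; ring. Qed.

Lemma dotDl x y z : dot (x + y) z = dot x z + dot y z.
Proof. by rewrite !dotE !mxE; ring. Qed.

Lemma dotDr x y z : dot z (x + y) = dot z x + dot z y.
Proof. by rewrite !(dotC z) dotDl. Qed.

Lemma dotZl k x y : dot (k *: x) y = k * dot x y.
Proof. by rewrite !dotE !mxE; ring. Qed.

Lemma dotZr k x y : dot x (k *: y) = k * dot x y.
Proof. by rewrite !(dotC x) dotZl. Qed.

Lemma dotNl x y : dot (- x) y = - dot x y.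
Proof. by rewrite -scaleN1r dotZl mulN1r. Qed.

Lemma dotNr x y : dot x (- y) = - dot x y.
Proof. by rewrite !(dotC x) dotNl. Qed.

Lemma dotBl x y z : dot (x - y) z = dot x z - dot y z.
Proof. by rewrite dotDl dotNl. Qed.

Lemma dotBr x y z : dot z (x - y) = dot z x - dot z y.
Proof. by rewrite dotDr dotNr. Qed.

Lemma dot0l x : dot 0 x = 0.
Proof. by rewrite -(scale0r 0) dotZl mul0r. Qed.

Lemma dot0r x : dot x 0 = 0.
Proof. by rewrite dotC dot0l. Qed.

Lemma dot_ge0 x : 0 <= dot x x.
Proof. by rewrite dotE -!expr2 !addr_ge0 ?sqr_ge0. Qed.

Lemma dot_eq0 x : (dot x x == 0) = (x == 0).
Proof.
apply/eqP/eqP => [|->]; last exact: dot0l.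
rewrite dotE -!expr2 => h.
have h0 := sqr_ge0 (x 0 0); have h1 := sqr_ge0 (x 1 0); have h2 := sqr_ge0 (x 2 0).
by apply: cV3P; rewrite !mxE; apply/eqP; rewrite -sqrf_eq0; apply/eqP; lra.
Qed.

Lemma enorm_ge0 x : 0 <= enorm x.
Proof. exact: sqrtr_ge0. Qed.

Lemma enorm_sqr x : enorm x ^+ 2 = dot x x.
Proof. by rewrite sqr_sqrtr// dot_ge0. Qed.

Lemma enorm_eq0 x : (enorm x == 0) = (x == 0).
Proof. by rewrite -dot_eq0 -enorm_sqr sqrf_eq0. Qed.

Lemma enorm0 : enorm (0 : 'cV[R]_3) = 0.
Proof. by apply/eqP; rewrite enorm_eq0. Qed.

Lemma enorm_gt0 x : (0 < enorm x) = (x != 0).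
Proof. by rewrite lt0r enorm_eq0 enorm_ge0 andbT. Qed.

Lemma enorm_inj x y : dot x x = dot y y -> enorm x = enorm y.
Proof. by rewrite /enorm => ->. Qed.

Lemma enormZ k x : enorm (k *: x) = `|k| * enorm x.
Proof. by rewrite /enorm dotZl dotZr mulrA -expr2 sqrtrM ?sqr_ge0// sqrtr_sqr. Qed.

Lemma enormN x : enorm (- x) = enorm x.
Proof. by rewrite -scaleN1r enormZ normrN1 mul1r. Qed.

Lemma enorm_direction x : x != 0 -> enorm (direction x) = 1.
Proof.
move=> x0; rewrite enormZ ger0_norm ?invr_ge0 ?enorm_ge0// mulVf//.
by rewrite enorm_eq0.
Qed.

Lemma enorm_scale_direction x : enorm x *: direction x = x.
Proof.
have [->|x0] := eqVneq x 0; first by rewrite enorm0 scale0r.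
by rewrite scalerA mulfV ?scale1r// enorm_eq0.
Qed.

Lemma directionZ k x : 0 < k -> direction (k *: x) = direction x.
Proof.
move=> k0; rewrite /direction enormZ gtr0_norm// scalerA invfM.
by rewrite -mulrA mulrCA mulVf ?mulr1// gt_eqF.
Qed.

Lemma directionN x : direction (- x) = - direction x.
Proof. by rewrite /direction enormN scalerN. Qed.

Lemma direction_unit x : enorm x = 1 -> direction x = x.
Proof. by rewrite /direction => ->; rewrite invr1 scale1r. Qed.

Lemma continuous_coef (i : 'I_3) : continuous (fun x : 'cV[R]_3 => x i 0).
Proof. exact: coord_continuous. Qed.

Lemma continuous_enorm : continuous (@enorm R).
Proof.
move=> x; apply: (@continuous_comp _ _ _ (fun x => dot x x) Num.sqrt).
  rewrite (_ : (fun x => dot x x) = fun x => x 0 0 * x 0 0 + x 1 0 * x 1 0 + x 2 0 * x 2 0).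
    by apply: continuousD; [apply: continuousD|]; apply: continuousM; exact: continuous_coef.
  by apply/funext => y; exact: dotE.
exact: sqrt_continuous.
Qed.

Lemma measurable_vec (i : 'I_3) :
  measurable_fun setT (fun y : coord3 R => vec y i 0 : measurableTypeR R).
Proof.
apply: (measurable_continuous_vec (f := fun x : 'cV[R]_3 => x i 0)).
exact: continuous_coef.
Qed.

Lemma measurable_coords d (Z : measurableType d) (F : Z -> 'cV[R]_3) :
  (forall i, measurable_fun setT (fun z : Z => F z i 0 : measurableTypeR R)) ->
  measurable_fun setT (fun z : Z => coords (F z)).
Proof.
move=> mF; apply: measurable_fun_pair; first apply: measurable_fun_pair;
  exact: mF.
Qed.

End euclidean.

Section polar.
Context {R : realType}.
Local Open Scope ereal_scope.
Notation unorm := (fun y : coord3 R => enorm (vec y)).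

Let measurable_unorm : measurable_fun setT (unorm : coord3 R -> measurableTypeR R).
Proof. exact: measurable_enorm_vec. Qed.

Lemma leb3_point (y : coord3 R) : leb3 [set y] = 0.
Proof.
case: y => -[a b] c.
have -> : [set (a, b, c)] = ([set a] `*` [set b]) `*` [set c].
  by apply/seteqP; split => [_ ->|[[? ?] ?] [[/= -> ->] ->]].
transitivity (mprod (@lebesgue_measure R) (@lebesgue_measure R)
  ([set a] `*` [set b]) * lebesgue_measure [set c]).
  by apply: product_measure1E => //; exact: measurableX.
by rewrite lebesgue_measure_set1 mule0.
Qed.

Lemma leb3_punctured (A : set (coord3 R)) : measurable A ->
  leb3 (A `&` [set y | (0 < unorm y)%R]) = leb3 A.
Proof.
move=> mA.
have m0 : measurable [set y : coord3 R | (0 < unorm y)%R].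
  rewrite -[X in measurable X]setTI.
  have := @measurable_enorm_vec R measurableT _ (measurable_itv `]0%R, +oo[).
  by congr measurable; apply/seteqP; split => y /=; rewrite in_itv /= andbT.
have mN : measurable (A `\` [set y | (0 < unorm y)%R]) by exact: measurableD.
rewrite [RHS](measureDI _ mA m0) [X in X + _](_ : _ = 0) ?add0e//.
apply/eqP; rewrite eq_le measure_ge0 andbT -(leb3_point (coords 0)).
apply: le_measure; rewrite ?inE//.
  rewrite [X in measurable X](_ : _ = ([set 0%R] `*` [set 0%R]) `*` [set 0%R]).
    by apply: measurableX => //; exact: measurableX.
  apply/seteqP; split => [_ ->|[[? ?] ?] [[/= -> ->] ->]];
    rewrite /coords !mxE//.
move=> y /= [_ /negP]; rewrite -leNgt => h; apply: vec_inj.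
by apply/eqP; rewrite coordsK -enorm_eq0 eq_le h enorm_ge0.
Qed.

Let cone (r : R) (B : set (coord3 R)) : set (coord3 R) :=
  [set y | (0 < unorm y <= r)%R /\ B (to_sphere y)].

(** Dilation by 1/r carries this cone to the part of the unit ball that defines [sphere]; the factor
    3 in that definition leaves r^3/3. *)
Lemma leb3_cone (r : R) (B : set (coord3 R)) : (0 < r)%R -> measurable B ->
  leb3 (cone r B) = (r ^+ 3 / 3)%:E * sphere B.
Proof.
move=> r0 mB.
have m1 : measurable (to_sphere @^-1` B `&` @punctured_ball R).
  apply: measurableI; last exact: measurable_punctured_ball.
  by rewrite -[X in measurable X]setTI; exact: measurable_to_sphere.
have -> : cone r B = (fun y => coords (r^-1 *: vec y)) @^-1`
    (to_sphere @^-1` B `&` @punctured_ball R).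
  apply/seteqP; split => y; rewrite /cone /punctured_ball /to_sphere /= !coordsK;
    rewrite directionZ ?invr_gt0// enormZ gtr0_norm ?invr_gt0// mulrC pmulr_lgt0 ?invr_gt0//;
    rewrite ler_pdivrMr// mul1r => -[]//.
rewrite leb3_scale//; last by rewrite invr_eq0 gt_eqF.
rewrite gtr0_norm ?invr_gt0// exprVn invrK /sphere muleA -EFinM.
by rewrite -mulrA mulVf ?mulr1// pnatr_eq0.
Qed.

Lemma sphere_setT_gt0 : (0 < fine (@sphere R setT))%R.
Proof.
rewrite fine_gt0//; apply/andP; split; last by rewrite -ge0_fin_numE// fin_num_measure.
(* The cube with sides ]0, 1/2] avoids the origin and its points have squared norm at most 3/4, so
   it lies in [punctured_ball]. *)
pose I : set (measurableTypeR R) := [set` `]0%R, (2^-1)%R] ].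
have mI : measurable I by exact: measurable_itv.
have lI : lebesgue_measure I = (2^-1)%:E.
  rewrite /I lebesgue_measure_itv /= lte_fin invr_gt0 ltr0n -EFinB.
  by rewrite subr0.
apply: (@lt_le_trans _ _ (leb3 ((I `*` I) `*` I))).
  have -> : leb3 ((I `*` I) `*` I) = lebesgue_measure I * lebesgue_measure I *
    lebesgue_measure I.
    transitivity (mprod (@lebesgue_measure R) (@lebesgue_measure R) (I `*` I) *
      lebesgue_measure I).
      by apply: product_measure1E => //; exact: measurableX.
    by congr (_ * _)%E; exact: product_measure1E.
  by rewrite lI -!EFinM lte_fin !mulr_gt0// invr_gt0 ltr0n.
rewrite /sphere preimage_setT setTI.
apply: (@le_trans _ _ (leb3 (@punctured_ball R))).
  apply: le_measure; rewrite ?inE//.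
  - by apply: measurableX => //; exact: measurableX.
  - exact: measurable_punctured_ball.
  move=> [[a b] c] /= [[]]; rewrite /I /= !in_itv /= => /andP[a0 a1] /andP[b0 b1] /andP[c0 c1].
  rewrite /punctured_ball /= enorm_gt0; apply/andP; split.
    by apply/eqP => /matrixP/(_ 0%R 0%R); rewrite !mxE /= => a00; move: a0; rewrite a00 ltxx.
  rewrite -(@expr_le1 _ 2)// ?enorm_ge0// enorm_sqr dotE !mxE /=; nra.
by rewrite -[leLHS]mul1e lee_wpmul2r// lee_fin ler1n.
Qed.

(** This is r^2 dr on the positive half line, as its values r^3/3 on initial intervals show.
    Dividing by the total area makes its product with [sphere] correspond to Lebesgue measure. *)
Definition radial (A : set (measurableTypeR R)) : \bar R :=
  ((fine (sphere setT))^-1)%:E * leb3 (unorm @^-1` A).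

Let radial_weight : (0 <= (fine (@sphere R setT))^-1)%R.
Proof. by rewrite invr_ge0 ltW// sphere_setT_gt0. Qed.

Let mradial : {measure set (measurableTypeR R) -> \bar R} :=
  mscale (NngNum radial_weight)
  (measure_function_pushforward__canonical__measure_function_Measure leb3
    measurable_unorm).

Let radial0 : radial set0 = 0. Proof. exact: measure0 mradial. Qed.

Let radial_ge0 A : 0 <= radial A. Proof. exact: measure_ge0 mradial _. Qed.

Let radial_sigma_additive : semi_sigma_additive radial.
Proof.
move=> F mF tF mU.
exact: (@measure_semi_sigma_additive _ _ _ mradial F mF tF mU).
Qed.

HB.instance Definition _ := isMeasure.Build _ _ _ radial
  radial0 radial_ge0 radial_sigma_additive.

Let leb3_le_norm (r : R) (B : set (coord3 R)) : measurable B ->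
  leb3 (unorm @^-1` `]-oo, r] `&` to_sphere @^-1` B) =
  (Num.max r 0 ^+ 3 / 3)%:E * sphere B.
Proof.
move=> mB.
have mL : measurable (unorm @^-1` `]-oo, r] `&` to_sphere @^-1` B).
  apply: measurableI.
    by rewrite -[X in measurable X]setTI; apply: measurable_enorm_vec.
  by rewrite -[X in measurable X]setTI; exact: measurable_to_sphere.
rewrite -leb3_punctured//; have [r0|r0] := ltP 0%R r.
  rewrite -leb3_cone//; congr (leb3 _); apply/seteqP; split => y /=.
    by rewrite in_itv /= => -[[h1 h2] h3]; split => //; rewrite h3.
  by rewrite in_itv /= => -[/andP[h1 h2] h3].
rewrite expr0n /= mul0r mul0e -(measure0 leb3); congr (leb3 _).
apply/seteqP; split => // y /=; rewrite in_itv /= => -[[h1 h2] h3].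
by have := lt_le_trans h3 (le_trans h1 r0); rewrite ltxx.
Qed.

Let radial_itv (r : R) : radial `]-oo, r] = (Num.max r 0 ^+ 3 / 3)%:E.
Proof.
rewrite /radial; have := leb3_le_norm r measurableT.
rewrite preimage_setT setIT => ->.
rewrite -(@fineK _ (sphere setT)) ?fin_num_measure// -!EFinM /=.
by rewrite mulrCA mulVf ?mulr1// gt_eqF// sphere_setT_gt0.
Qed.

Let itvNy : \bigcup_k (`]-oo, (k%:R : R)]%classic) = setT.
Proof.
rewrite -subTset => x _; exists (Num.truncn `|x|).+1 => //=.
by rewrite in_itv /= (le_trans (ler_norm x))// ltW// truncnS_gt.
Qed.

Let radial_sigma_finite : sigma_finite setT radial.
Proof.
exists (fun k => `]-oo, (k%:R : R)]%classic); first exact/esym.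
by move=> k; split; [exact: measurable_itv|rewrite radial_itv ltry].
Qed.

HB.instance Definition _ := Measure_isSigmaFinite.Build _ _ _ radial
  radial_sigma_finite.

(** With the set of directions fixed, both sides are measures in the set of radii. They agree on
    half lines by the cone formula, and half lines are stable under intersection and generate the
    Borel sets. *)
Lemma mpres_polar :
  mpres (fun y : coord3 R => (unorm y : measurableTypeR R, to_sphere y)) leb3
    (mprod radial (@sphere R)).
Proof.
apply: (mpres_rectangle (mu := leb3) (n1 := radial) (n2 := @sphere R)).
  by apply: measurable_fun_pair;
    [exact: measurable_enorm_vec|exact: measurable_to_sphere].
move=> A B mA mB.
have mB' : measurable (to_sphere @^-1` B).
  by rewrite -[X in measurable X]setTI; exact: measurable_to_sphere.
have k0 : (0 <= fine (sphere B))%R by rewrite fine_ge0.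
pose m1 := measure_function_pushforward__canonical__measure_function_Measure
    (mrestr leb3 mB') measurable_unorm.
pose m2 : {measure set (measurableTypeR R) -> \bar R} := mscale (NngNum k0) radial.
transitivity (m1 A) => //; transitivity (m2 A); last first.
  by rewrite /m2 /= /mscale /= fineK ?fin_num_measure// muleC.
apply: (@measure_unique _ R (measurableTypeR R) [set X | exists r : R, X = `]-oo, r]%classic]
  (fun k => `]-oo, (k%:R : R)]%classic) _ _ _ itvNy m1 m2) => //.
- apply/seteqP; split.
    rewrite (RGenOInfty.measurableE R); apply: smallest_sub.
      exact: smallest_sigma_algebra.
    move=> _ [r ->]; rewrite -setCitvl.
    have [_ h _] := smallest_sigma_algebra setT
      [set X | exists r : R, X = `]-oo, r]%classic].
    by rewrite -setTD; apply: h; apply: sub_sigma_algebra; exists r.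
  apply: smallest_sub; first exact: sigma_algebra_measurable.
  by move=> _ [r ->]; exact: measurable_itv.
- move=> _ _ [r ->] [s ->]; exists (Num.min r s).
  by apply/seteqP; split => x /=; rewrite !in_itv /= le_min => /andP.
- by move=> k; exists k%:R.
- move=> _ [r ->]; rewrite /m2 /= /mscale /= radial_itv.
  rewrite fineK ?fin_num_measure// muleC -leb3_le_norm//.
- move=> k; apply: (@le_lt_trans _ _ (leb3 (unorm @^-1` `]-oo, (k%:R : R)] `&` to_sphere @^-1` B))) => //.
  by rewrite leb3_le_norm// lte_mul_pinfty// ?lee_fin// ?ltry ?divr_ge0// ?exprn_ge0//
    ?le_max ?lexx ?orbT// -ge0_fin_numE// fin_num_measure.
Qed.

Lemma mpres_recombine :
  mpres (fun p : measurableTypeR R * coord3 R => coords ((p.1 : R) *: vec p.2))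
    (mprod radial (@sphere R)) leb3.
Proof.
apply: mpres_retract mpres_polar _ _.
  apply: measurable_coords => i; under eq_fun do rewrite mxE.
  by apply: measurable_funM => //; exact: measurableT_comp (measurable_vec i) _.
by move=> y /=; rewrite /to_sphere coordsK enorm_scale_direction vecK.
Qed.

(** On a relative velocity u and a direction sigma this is (u, sigma) -> (|u| sigma, u/|u|), which
    is the effect of a collision. *)
Definition swap_directions (z : coord3 R * coord3 R) : coord3 R * coord3 R :=
  (coords (unorm z.1 *: vec z.2), to_sphere z.1).

(** In polar coordinates for u the map merely exchanges two factors [sphere]: [p1] separates radius
    and direction, [p3] swaps, [p6] recombines. *)
Lemma mpres_swap_directions :
  mpres swap_directions (mprod leb3 (@sphere R)) (mprod leb3 (@sphere R)).
Proof.
have p1 : mpres (fun z : coord3 R * coord3 R => ((unorm z.1, to_sphere z.1), z.2))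
    (mprod leb3 (@sphere R)) (mprod (mprod radial (@sphere R)) (@sphere R)).
  apply: (mpres_skew (m1 := leb3) (m2 := @sphere R)
    (n1 := mprod radial (@sphere R)) (n2 := @sphere R)
    (f := fun y : coord3 R => (unorm y : measurableTypeR R, to_sphere y))
    (g := fun _ s => s) mpres_polar) => [|_]; [exact: measurable_snd|exact: mpres_id].
have p2 := mpres_comp p1 (mpres_assoc radial (@sphere R) (@sphere R)).
have p3 : mpres (fun z : measurableTypeR R * (coord3 R * coord3 R) => (z.1, (z.2.2, z.2.1)))
    (mprod radial (mprod (@sphere R) (@sphere R)))
    (mprod radial (mprod (@sphere R) (@sphere R))).
  apply: (mpres_skew (m1 := radial) (m2 := mprod (@sphere R) (@sphere R))
    (n1 := radial) (n2 := mprod (@sphere R) (@sphere R))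
    (f := fun x => x) (g := fun _ (z : coord3 R * coord3 R) => (z.2, z.1))).
  - exact: mpres_id.
  - apply: measurable_fun_pair; first exact: (measurableT_comp measurable_snd measurable_snd).
    exact: (measurableT_comp measurable_fst measurable_snd).
  - by move=> _; exact: mpres_swap.
have p4 := mpres_comp p2 p3.
have p5 := mpres_comp p4 (mpres_assocV radial (@sphere R) (@sphere R)).
have p6 : mpres (fun z : measurableTypeR R * coord3 R * coord3 R =>
    (coords ((z.1.1 : R) *: vec z.1.2), z.2))
    (mprod (mprod radial (@sphere R)) (@sphere R)) (mprod leb3 (@sphere R)).
  apply: (mpres_skew (m1 := mprod radial (@sphere R)) (m2 := @sphere R)
    (n1 := leb3) (n2 := @sphere R) (g := fun _ s => s) mpres_recombine) => [|_];
    [exact: measurable_snd|exact: mpres_id].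
exact: mpres_comp p5 p6.
Qed.

End polar.

Section collisions.
Context {R : realType}.
Implicit Types (v w s : 'cV[R]_3).

Lemma sphere_unit : {ae @sphere R, forall s : coord3 R, enorm (vec s) = 1}.
Proof.
exists [set s : coord3 R | enorm (vec s) != 1]; split => //.
- have := @measurable_enorm_vec R measurableT _ (measurableC (measurable_set1 1)).
  rewrite setTI; congr measurable; apply/seteqP.
  by split => s /= /eqP.
- rewrite /sphere (_ : _ `&` _ = set0) ?measure0 ?mule0//.
  apply/seteqP; split => // y [] /=; rewrite /punctured_ball /to_sphere coordsK.
  by rewrite /= enorm_gt0 => /negP + /andP[y0 _]; rewrite enorm_direction.
- by move=> s /= /eqP.
Qed.

Lemma sphere_opp : mpres (fun s : coord3 R => coords (- vec s)) (@sphere R) (@sphere R).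
Proof.
split; first exact: leb3_opp.1.
move=> A mA.
have mA' : measurable (to_sphere @^-1` A `&` @punctured_ball R).
  apply: measurableI; last exact: measurable_punctured_ball.
  by rewrite -[X in measurable X]setTI; exact: measurable_to_sphere.
rewrite /sphere; congr (3%:E * _)%E; rewrite -[RHS](leb3_opp.2 _ mA').
congr (leb3 _); apply/seteqP.
by split => y; rewrite /punctured_ball /to_sphere /= !coordsK directionN enormN.
Qed.

Definition center_relative (z : coord3 R * coord3 R) : coord3 R * coord3 R :=
  (coords (2^-1 *: (vec z.1 + vec z.2)), coords (vec z.1 - vec z.2)).

Lemma measurable_vec_fst (i : 'I_3) : measurable_fun setT
  (fun z : coord3 R * coord3 R => vec z.1 i 0 : measurableTypeR R).
Proof. exact: measurableT_comp (measurable_vec i) measurable_fst. Qed.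

Lemma measurable_vec_snd (i : 'I_3) : measurable_fun setT
  (fun z : coord3 R * coord3 R => vec z.2 i 0 : measurableTypeR R).
Proof. exact: measurableT_comp (measurable_vec i) measurable_snd. Qed.

Lemma leb6_shear (L : 'cV[R]_3 -> 'cV[R]_3) :
  (forall i, measurable_fun setT (fun y : coord3 R => L (vec y) i 0 : measurableTypeR R)) ->
  mpres (fun z => (z.1, coords (vec z.2 + L (vec z.1)))) (@leb6 R) (@leb6 R).
Proof.
move=> mL; apply: (mpres_skew (f := fun x => x)
    (g := fun x y => coords (vec y + L (vec x)))) => [||x].
- exact: mpres_id.
- apply: measurable_coords => i; under eq_fun do rewrite mxE.
  apply: measurable_funD; first exact: measurable_vec_snd.
  exact: measurableT_comp (mL i) measurable_fst.
- exact: leb3_translation.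
Qed.

(** The unit Jacobian comes from a factorization into swaps and two shears: v - w is formed first,
    then half of it is added to w. *)
Lemma mpres_center_relative : mpres center_relative leb6 leb6.
Proof.
have opp2 : mpres (fun z : coord3 R * coord3 R => (z.1, coords (- vec z.2))) leb6 leb6.
  apply: (mpres_skew (f := fun x => x) (g := fun _ y => coords (- vec y))) => [||_].
  - exact: mpres_id.
  - exact: measurableT_comp (leb3_opp.1) measurable_snd.
  - exact: leb3_opp.
have mN i : measurable_fun setT (fun y : coord3 R => (- vec y) i 0 : measurableTypeR R).
  by under eq_fun do rewrite mxE; apply: measurableT_comp (measurable_vec i).
have mH i : measurable_fun setT
    (fun y : coord3 R => (2^-1 *: vec y) i 0 : measurableTypeR R).
  by under eq_fun do rewrite mxE; apply: measurable_funM => //; exact: measurable_vec.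
have sw := mpres_swap (@leb3 R) leb3.
have p1 := mpres_comp sw (leb6_shear mN).
have p2 := mpres_comp (mpres_comp p1 sw) (leb6_shear mH).
have p3 := mpres_comp p2 sw.
apply: mpres_ext p3 => -[v w] /=; rewrite /center_relative !coordsK.
by congr (coords _, coords _); apply/matrixP => i j; rewrite !mxE; field.
Qed.

(** The sign on sigma makes v' and v'_* trade places together with v and v_*. *)
Definition swap_velocities (z : coord3 R * coord3 R * coord3 R) :=
  ((z.1.2, z.1.1), coords (- vec z.2)).

Lemma mpres_swap_velocities :
  mpres swap_velocities (mprod leb6 sphere) (mprod leb6 sphere).
Proof.
apply: (mpres_skew (m1 := leb6) (n1 := leb6) (m2 := sphere) (n2 := sphere)
  (f := fun z : coord3 R * coord3 R => (z.2, z.1))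
  (g := fun _ (s : coord3 R) => coords (- vec s))) => [||_].
- exact: mpres_swap.
- exact: measurableT_comp (leb3_opp.1) measurable_snd.
- exact: sphere_opp.
Qed.

(** Keeping the old relative direction as third component makes the map its own inverse wherever
    sigma is a unit vector and v differs from v_*. *)
Definition collide (z : coord3 R * coord3 R * coord3 R) :=
  ((coords (post_collision (vec z.1.1) (vec z.1.2) (vec z.2)),
    coords (post_collision_star (vec z.1.1) (vec z.1.2) (vec z.2))),
   to_sphere (coords (vec z.1.1 - vec z.1.2))).

(** A collision fixes the center of mass and acts on relative velocity and sigma as
    [swap_directions]; [K2] returns from center and relative velocity to the two velocities. *)
Lemma mpres_collide : mpres collide (mprod leb6 sphere) (mprod leb6 sphere).
Proof.
pose K2 (z : coord3 R * coord3 R) : coord3 R * coord3 R :=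
  (coords (vec z.1 + 2^-1 *: vec z.2), coords (vec z.1 - 2^-1 *: vec z.2)).
have pK2 : mpres K2 leb6 leb6.
  apply: mpres_retract mpres_center_relative _ _.
    have mh i : measurable_fun setT
        (fun z : coord3 R * coord3 R => 2^-1 * vec z.2 i 0 : measurableTypeR R).
      by apply: measurable_funM => //; exact: measurable_vec_snd.
    apply: measurable_fun_pair; apply: measurable_coords => i.
      rewrite (_ : (fun _ => _) = fun z => vec z.1 i 0 + 2^-1 * vec z.2 i 0).
        by apply: measurable_funD; [exact: measurable_vec_fst|exact: mh].
      by apply/funext => z; rewrite !mxE.
    rewrite (_ : (fun _ => _) = fun z => vec z.1 i 0 - 2^-1 * vec z.2 i 0).
      by apply: measurable_funB; [exact: measurable_vec_fst|exact: mh].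
    by apply/funext => z; rewrite !mxE.
  move=> [v w]; rewrite /K2 /center_relative /= !coordsK.
  by congr pair; apply: vec_inj; rewrite coordsK;
    apply/matrixP => i j; rewrite !mxE; field.
have p1 : mpres (fun z : coord3 R * coord3 R * coord3 R => (center_relative z.1, z.2))
    (mprod leb6 sphere) (mprod leb6 sphere).
  apply: (mpres_skew (m1 := leb6) (n1 := leb6) (m2 := sphere) (n2 := sphere)
    (f := center_relative) (g := fun _ (s : coord3 R) => s)) => [||_];
    [exact: mpres_center_relative|exact: measurable_snd|exact: mpres_id].
have p2 := mpres_comp p1 (mpres_assoc leb3 leb3 sphere).
have p3 : mpres (fun z : coord3 R * (coord3 R * coord3 R) => (z.1, swap_directions z.2))
    (mprod leb3 (mprod leb3 sphere)) (mprod leb3 (mprod leb3 sphere)).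
  apply: (mpres_skew (m1 := leb3) (n1 := leb3) (m2 := mprod leb3 sphere)
    (n2 := mprod leb3 sphere) (f := fun x => x) (g := fun _ z => swap_directions z)).
  - exact: mpres_id.
  - exact: measurableT_comp (mpres_swap_directions.1) measurable_snd.
  - by move=> _; exact: mpres_swap_directions.
have p4 := mpres_comp (mpres_comp p2 p3) (mpres_assocV leb3 leb3 sphere).
have p5 : mpres (fun z : coord3 R * coord3 R * coord3 R => (K2 z.1, z.2))
    (mprod leb6 sphere) (mprod leb6 sphere).
  apply: (mpres_skew (m1 := leb6) (n1 := leb6) (m2 := sphere) (n2 := sphere)
    (f := K2) (g := fun _ (s : coord3 R) => s)) => [||_];
    [exact: pK2|exact: measurable_snd|exact: mpres_id].
apply: mpres_ext (mpres_comp p4 p5) => -[[v w] s].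
rewrite /K2 /collide /swap_directions /= !coordsK /post_collision /post_collision_star.
by rewrite !scalerA [2^-1 * _]mulrC.
Qed.

End collisions.

(** * The H theorem *)

Section negligible_products.
Context {R : realType}.
Local Open Scope ereal_scope.

Lemma ge0_integral_eq0_ae d (T : measurableType d) (mu : {measure set T -> \bar R})
    (f : T -> \bar R) : measurable_fun setT f -> (forall x, 0 <= f x) ->
  \int[mu]_x f x = 0 -> {ae mu, forall x, f x = 0}.
Proof.
move=> mf f0 If; have : ae_eq mu setT f (cst 0).
  apply/(ae_eq_integral_abs mu measurableT mf); rewrite -[RHS]If.
  by apply: eq_integral => x _; rewrite gee0_abs.
by apply: filterS => x /(_ I).
Qed.

Lemma ae_mprod_sections d1 d2 (T1 : measurableType d1) (T2 : measurableType d2)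
    (m1 : {sigma_finite_measure set T1 -> \bar R})
    (m2 : {sigma_finite_measure set T2 -> \bar R}) (P : T1 * T2 -> Prop) :
  {ae mprod m1 m2, forall z, P z} ->
  {ae m1, forall x, {ae m2, forall y, P (x, y)}}.
Proof.
move=> [N [mN N0 PN]].
have : {ae m1, forall x, m2 (xsection N x) = 0}.
  apply: ge0_integral_eq0_ae => //; exact: measurable_fun_xsection.
apply: filterS => x Nx; exists (xsection N x); split => //.
  exact: measurable_xsection.
by move=> y /= Pxy; rewrite /xsection /= inE; exact: PN.
Qed.

Lemma ae_mprod_snd d1 d2 (T1 : measurableType d1) (T2 : measurableType d2)
    (m1 : {sigma_finite_measure set T1 -> \bar R})
    (m2 : {sigma_finite_measure set T2 -> \bar R}) (P : T2 -> Prop) :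
  {ae m2, forall y, P y} -> {ae mprod m1 m2, forall z, P z.2}.
Proof.
move=> [N [mN N0 PN]]; exists (setT `*` N); split.
- exact: measurableX.
- transitivity (m1 setT * m2 N); first exact: product_measure1E.
  by rewrite N0 mule0.
- by move=> z /= Pz; split => //; exact: PN.
Qed.

Lemma ae_mpres d1 d2 (S : measurableType d1) (T : measurableType d2)
    (f : S -> T) (mu : {measure set S -> \bar R})
    (nu : {measure set T -> \bar R}) (P : T -> Prop) :
  mpres f mu nu -> {ae nu, forall y, P y} -> {ae mu, forall x, P (f x)}.
Proof.
move=> [mf fE] [N [mN N0 PN]]; exists (f @^-1` N); split.
- by rewrite -[X in measurable X]setTI; exact: mf.
- by rewrite fE.
- by move=> x /= Px; exact: PN.
Qed.

End negligible_products.

Section entropy_production.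
Context {R : realType}.
Variables (gamma : R) (b : R -> R).
Hypothesis b0 : forall c, 0 <= b c.
Notation B := (collision_kernel gamma b).
Variable f : 'cV[R]_3 -> R.
Hypothesis f0 : forall v, 0 < f v.
Notation e := (entropy_integrand B f).

Let D v w s := f (post_collision_star v w s) * f (post_collision v w s) - f w * f v.

Lemma post_collision_swap (v w s : 'cV[R]_3) :
  post_collision w v (- s) = post_collision_star v w s.
Proof.
by rewrite /post_collision /post_collision_star addrC -opprB enormN scalerN addrC [v + w]addrC addrC.
Qed.

Lemma post_collision_star_swap (v w s : 'cV[R]_3) :
  post_collision_star w v (- s) = post_collision v w s.
Proof. by rewrite -post_collision_swap opprK. Qed.

Lemma post_collision_sub (v w s : 'cV[R]_3) :
  post_collision v w s - post_collision_star v w s = enorm (v - w) *: s.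
Proof.
by apply/matrixP => i j; rewrite !mxE; field.
Qed.

Lemma post_collisionK (v w s : 'cV[R]_3) : enorm s = 1 ->
  post_collision (post_collision v w s) (post_collision_star v w s)
    (direction (v - w)) = v.
Proof.
move=> s1; rewrite {1}/post_collision post_collision_sub enormZ s1 mulr1.
rewrite ger0_norm ?enorm_ge0// mulrC -scalerA enorm_scale_direction.
by apply/matrixP => i j; rewrite !mxE; field.
Qed.

Lemma post_collision_starK (v w s : 'cV[R]_3) : enorm s = 1 ->
  post_collision_star (post_collision v w s) (post_collision_star v w s)
    (direction (v - w)) = w.
Proof.
move=> s1; rewrite {1}/post_collision_star post_collision_sub enormZ s1 mulr1.
rewrite ger0_norm ?enorm_ge0// mulrC -scalerA enorm_scale_direction.
by apply/matrixP => i j; rewrite !mxE; field.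
Qed.

Lemma kernel_swap (v w s : 'cV[R]_3) : B (w - v) (- s) = B (v - w) s.
Proof.
by rewrite /collision_kernel -[w - v]opprB enormN directionN dotNl dotNr opprK.
Qed.

(** The kernel depends on |u| and on the inner product of u/|u| with sigma: the length is preserved,
    and the inner product is symmetric in the two directions that are exchanged. For v = w both
    inner products are 0, by the value of [direction] at 0. *)
Lemma kernel_collide (v w s : 'cV[R]_3) : enorm s = 1 ->
  B (post_collision v w s - post_collision_star v w s) (direction (v - w)) =
  B (v - w) s.
Proof.
move=> s1; rewrite post_collision_sub /collision_kernel.
rewrite enormZ s1 mulr1 ger0_norm ?enorm_ge0//.
have [->|u0] := eqVneq (v - w) 0.
  by rewrite enorm0 scale0r /direction !scaler0 !dot0l.
by rewrite directionZ ?enorm_gt0// direction_unit// dotC.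
Qed.

Lemma entropy_swap z : e (swap_velocities z) =
  B (vec z.1.1 - vec z.1.2) (vec z.2) * D (vec z.1.1) (vec z.1.2) (vec z.2) *
  ln (f (vec z.1.2)).
Proof.
rewrite /entropy_integrand /swap_velocities /= coordsK kernel_swap.
by rewrite post_collision_swap post_collision_star_swap /D mulrC [f (vec z.1.2) * _]mulrC
  [f (post_collision _ _ _) * _]mulrC mulrC.
Qed.

Lemma entropy_collide z : enorm (vec z.2) = 1 -> e (collide z) =
  - (B (vec z.1.1 - vec z.1.2) (vec z.2) * D (vec z.1.1) (vec z.1.2) (vec z.2)) *
  ln (f (post_collision (vec z.1.1) (vec z.1.2) (vec z.2))).
Proof.
move=> s1; rewrite /entropy_integrand /collide /= /to_sphere !coordsK.
by rewrite kernel_collide// post_collisionK// post_collision_starK// /D; ring.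
Qed.

Lemma entropy_swap_collide z : enorm (vec z.2) = 1 ->
  e (swap_velocities (collide z)) =
  - (B (vec z.1.1 - vec z.1.2) (vec z.2) * D (vec z.1.1) (vec z.1.2) (vec z.2)) *
  ln (f (post_collision_star (vec z.1.1) (vec z.1.2) (vec z.2))).
Proof.
move=> s1; rewrite entropy_swap /collide /= /to_sphere !coordsK /D.
by rewrite kernel_collide// post_collisionK// post_collision_starK//; ring.
Qed.

Lemma kernel_ge0 (v s : 'cV[R]_3) : 0 <= B v s.
Proof. by rewrite /collision_kernel mulr_ge0// powR_ge0. Qed.

Lemma entropy_production_le0 (x y : R) : 0 < x -> 0 < y ->
  (x - y) * (ln y - ln x) <= 0 ?= iff (x == y).
Proof.
move=> x0 y0; apply/leifP; case: ifPn => [/eqP ->|xy].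
  by rewrite subrr mul0r.
move: xy; rewrite neq_lt => /orP[xy|xy].
  by rewrite nmulr_rlt0 ?subr_lt0// subr_gt0 ltr_ln.
by rewrite pmulr_rlt0 ?subr_gt0// subr_lt0 ltr_ln.
Qed.

Hypothesis ie : (mprod leb6 sphere).-integrable setT (EFin \o e).
Hypothesis Q0 : forall v, Q B f f v = 0%E.

(** Integrating over v_* and sigma first gives [ln (f v)] times [Q B f f v], which is zero. *)
Lemma integral_entropy : (\int[mprod leb6 sphere]_z (e z)%:E = 0)%E.
Proof.
have mp := mpres_assocV (@leb3 R) leb3 sphere.
have ie' := mpres_integrable mp ie.
rewrite -(mpres_integral mp (h := EFin \o e)); last exact: measurable_int ie.
have /= <- := integral12_prod_meas1 ie'.
transitivity (\int[leb3]_(x in setT) cst 0 (x : coord3 R))%E; last exact: integral0.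
apply: ae_eq_integral => //.
  exact: (measurable_fubini_F ie').
have := ae_integrable1 ie'; apply: filterS => v iv _.
set c := ln (f (vec v)).
(* Integrability of the integrand of [Q] is obtained by dividing by [ln (f v)]; where this logarithm
   is 0, the inner integral vanishes anyway. *)
have [c0|c0] := eqVneq c 0.
  by apply: integral0_eq => z _ /=; rewrite /entropy_integrand /= -/c c0 mulr0.
rewrite -[RHS](mule0 c%:E) -(Q0 (vec v)) /Q -integralZl//.
  by apply: eq_integral => z _; rewrite -EFinM mulrC.
apply: eq_integrable (integrableZl measurableT c^-1 iv) => // z _ /=.
by rewrite -EFinM /entropy_integrand /= -/c mulrC mulfK.
Qed.

Let e4 z := e z + e (swap_velocities z) + e (collide z) +
  e (swap_velocities (collide z)).

(** The symmetries move the logarithm to v_*, v' and v'_*. The sum [e4] of the four integrands has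
    integral zero and equals B (x - y)(ln y - ln x) with x = f' f'_* and y = f f_*; this is
    nonpositive, and zero only if B = 0 or x = y. *)
Theorem H_theorem : {ae mprod leb6 sphere, forall z,
  B (vec z.1.1 - vec z.1.2) (vec z.2) * D (vec z.1.1) (vec z.1.2) (vec z.2) = 0}.
Proof.
have pS := @mpres_swap_velocities R; have pT := @mpres_collide R.
have pST := mpres_comp pT pS.
have iS := mpres_integrable pS ie; have iT := mpres_integrable pT ie.
have iST := mpres_integrable pST ie.
have me := measurable_int _ ie.
have i4 : (mprod leb6 sphere).-integrable setT (EFin \o e4).
  by apply: (integrableD measurableT (integrableD measurableT (integrableD measurableT ie iS) iT) iST).
have I4 : (\int[mprod leb6 sphere]_z (e4 z)%:E = 0)%E.
  under eq_integral do rewrite /e4 !EFinD.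
  rewrite integralD//; last exact: (integrableD measurableT (integrableD measurableT ie iS) iT).
  rewrite integralD//; last exact: (integrableD measurableT ie iS).
  rewrite integralD//.
  rewrite (mpres_integral pS me) (mpres_integral pT me) (mpres_integral pST me).
  by rewrite integral_entropy !adde0.
have unit_ae := ae_mprod_snd leb6 (@sphere_unit R).
have e4E z : enorm (vec z.2) = 1 -> e4 z =
    B (vec z.1.1 - vec z.1.2) (vec z.2) * (D (vec z.1.1) (vec z.1.2) (vec z.2) *
    (ln (f (vec z.1.2) * f (vec z.1.1)) -
     ln (f (post_collision_star (vec z.1.1) (vec z.1.2) (vec z.2)) *
         f (post_collision (vec z.1.1) (vec z.1.2) (vec z.2))))).
  move=> s1; rewrite /e4 entropy_swap entropy_collide// entropy_swap_collide//.
  by rewrite !lnM ?posrE// /entropy_integrand /= -/(D _ _ _); ring.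
have : ae_eq (mprod leb6 sphere) setT (EFin \o e4) (cst 0%E).
  have m4 := measurable_int _ i4.
  apply/(ae_eq_integral_abs _ measurableT m4).
  rewrite (ae_eq_integral (fun z => - (e4 z)%:E)%E)//.
  - by rewrite integralN ?I4 ?oppe0//; exact: integrable_add_def.
  - exact: measurableT_comp.
  - exact: measurableT_comp.
  - move: unit_ae; apply: filterS => z z1 _ /=; congr (_%:E).
    rewrite ler0_norm// e4E// mulr_ge0_le0 ?kernel_ge0//.
    by rewrite (entropy_production_le0 _ _)// mulr_gt0.
apply: filterS2 unit_ae => z z1 /(_ I) /= [].
rewrite e4E// => /eqP; rewrite mulf_eq0 => /orP[/eqP ->|]; first by rewrite mul0r.
rewrite (entropy_production_le0 _ _)// ?mulr_gt0// => /eqP DE.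
by rewrite /D DE subrr mulr0.
Qed.

End entropy_production.

(** * Collision invariance at one deflection angle *)

Section negligible_images.
Context {R : realType}.
Local Open Scope ereal_scope.
Notation leb := (@lebesgue_measure R).

(** A cover by open intervals of small total length is mapped into closed balls of no larger total
    length. This is used to pass from cosines to cotangents. *)
Lemma lipschitz_negligible (phi : R -> R) (N : set R) :
  (forall x y, (`|phi x - phi y| <= `|x - y|)%R) ->
  leb.-negligible N -> leb.-negligible (phi @` N).
Proof.
move=> lip /negligible_outer_measure N0; apply/negligible_outer_measure.
apply/eqP; rewrite eq_le outer_measure_ge0 andbT.
apply/lee_addgt0Pr => e e0; rewrite add0e.
have := outer_measure_open_itv_cover N; rewrite N0 => /esym inf0.
have fin : ereal_inf [set \sum_(k <oo) wlength idfun (F k) | F in open_itv_cover N] \is a fin_num.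
  by rewrite inf0.
have [_ [F [Fitv NF] <-]] := lb_ereal_inf_adherent e0 fin.
rewrite inf0 add0e => Fe.
apply: le_trans (ltW Fe).
apply: (@le_trans _ _ ((wlength idfun)^* (\bigcup_k (phi @` F k)))%mu).
  apply: le_outer_measure => _ [x Nx <-]; have [k _ Fx] := NF x Nx.
  by exists k => //; exists x.
apply: le_trans (outer_measure_sigma_subadditive _ _) _.
apply: lee_nneseries => [k _ _|k _]; first exact: outer_measure_ge0.
have [[a c] -> ] := Fitv k; rewrite wlength_itv /= lte_fin.
case: ifPn => [ac|ac]; last first.
  rewrite (_ : phi @` _ = set0) ?outer_measure0//.
  apply/seteqP; split => // z [x + _]; rewrite /= in_itv /= => /andP[ax xc].
  by rewrite (lt_trans ax xc) in ac.
apply: (@le_trans _ _ (leb (closed_ball (phi ((a + c) / 2)%R) ((c - a) / 2)%R))).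
  apply: le_outer_measure => _ [x + <-]; rewrite /= in_itv /= => /andP[ax xc].
  rewrite closed_ballE; last by rewrite divr_gt0// subr_gt0.
  apply: le_trans (lip _ _) _; rewrite ler_norml; lra.
rewrite lebesgue_measure_closed_ball; last by rewrite divr_ge0// subr_ge0 ltW.
by rewrite -EFinB lee_fin; lra.
Qed.

(** Otherwise each point of P lies in a ball with rational center and radius 1/(k + 1) that meets P
    in a null set, and countably many such balls cover P. *)
Lemma not_negligible_point (P : set R) : ~ leb.-negligible P ->
  exists t, forall e, (0 < e)%R -> ~ leb.-negligible (P `&` ball t e).
Proof.
apply: contra_notP => /forallNP nP.
pose A (p : rat * nat) := P `&` ball (ratr p.1 : R) (p.2.+1%:R^-1 : R).
pose V n := if unpickle n is Some p then
  (if `[< leb.-negligible (A p) >] then A p else set0) else set0.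
have VN : leb.-negligible (\bigcup_n V n).
  apply: negligible_bigcup => n; rewrite /V; case: unpickle => [p|];
    last exact: negligible_set0.
  by case: ifPn => [/asboolP//|_]; exact: negligible_set0.
suff sub (t : R) : P t -> (\bigcup_n V n) t by exact: negligibleS VN.
move=> Pt; have := nP t; move=> /existsNP[e /not_implyP[e0 /contrapT nt]].
have e20 : (0 < e / 2)%R by exact: divr_gt0.
have [k _ ke] := near_infty_natSinv_lt (PosNum e20).
have k0 : (0 < (k.+1%:R^-1 : R))%R by rewrite invr_gt0 ltr0n.
have [q] : exists q : rat, (ratr q : R) \in `](t - k.+1%:R^-1)%R, (t + k.+1%:R^-1)%R[.
  by apply: rat_in_itvoo; rewrite ltrBlDr -addrA ltrDl addr_gt0.
rewrite in_itv /= => qt.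
have tq : ball (ratr q : R) (k.+1%:R^-1 : R) t.
  move/andP: qt => [q1 q2].
  by rewrite /ball /= ltr_norml ltrBrDr ltrBlDr addrC q1 addrC q2.
have nA : leb.-negligible (A (q, k)).
  apply: negligibleS nt => x [Px qx]; split; first exact: Px.
  have /= ke' := ke k (leqnn _).
  apply: le_ball (ball_triangle (ball_sym tq) qx).
  by rewrite [leRHS](splitr e) lerD// ltW.
exists (pickle (q, k)); first exact: I.
rewrite /V pickleK (asboolT nA); split; [exact: Pt|exact: tq].
Qed.

Lemma ae_lebesgue_affine (k d : R) (P : R -> Prop) : k != 0%R ->
  {ae leb, forall t, P t} -> {ae leb, forall t, P (k * t + d)%R}.
Proof.
move=> k0 /(ae_mpres (lebesgue_translation d)) [N [mN N0 PN]].
exists ((fun x : measurableTypeR R => (k * x)%R : measurableTypeR R) @^-1` N); split.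
- by rewrite -[X in measurable X]setTI; apply: measurable_funM.
- by rewrite lebesgue_scale// N0 mule0.
- by move=> t /= nPt; apply: PN.
Qed.

(** Fubini after the measure preserving shear (t, y) -> (t, y + t a): its sections at fixed y are
    the lines of direction [a]. *)
Lemma ae_leb3_lines (a : 'cV[R]_3) (P : coord3 R -> Prop) :
  {ae leb3, forall y, P y} ->
  {ae leb3, forall y, {ae leb, forall t : R, P (coords (vec y + t *: a))}}.
Proof.
move=> /(ae_mprod_snd leb) aeP.
have ps : mpres (fun z : measurableTypeR R * coord3 R =>
    (z.1, coords (vec z.2 + (z.1 : R) *: a))) (mprod leb leb3) (mprod leb leb3).
  apply: (mpres_skew (f := fun x : measurableTypeR R => x)
    (g := fun (t : measurableTypeR R) y => coords (vec y + (t : R) *: a))) => [||t].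
  - exact: mpres_id.
  - apply: measurable_coords => i.
    rewrite (_ : (fun _ => _) = fun z => vec z.2 i 0 + (z.1 : R) * a i 0)%R.
      apply: measurable_funD; first exact: measurableT_comp (measurable_vec i) measurable_snd.
      by apply: measurable_funM => //; exact: measurable_fst.
    by apply/funext => z; rewrite !mxE.
  - exact: leb3_translation.
have := ae_mpres (mpres_swap leb3 leb) (ae_mpres ps aeP).
exact: ae_mprod_sections.
Qed.

(** A null set of directions spans a null cone. This moves the problem from the sphere to the ball,
    where straight lines are available. *)
Lemma ae_sphere_ball (P : coord3 R -> Prop) : {ae sphere, forall s, P s} ->
  {ae leb3, forall y, punctured_ball y -> P (to_sphere y)}.
Proof.
move=> [N [mN N0 PN]]; exists (to_sphere @^-1` N `&` @punctured_ball R); split.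
- apply: measurableI; last exact: measurable_punctured_ball.
  by rewrite -[X in measurable X]setTI; exact: measurable_to_sphere.
- by move/eqP: N0; rewrite /sphere mule_eq0 => /orP[|/eqP//]; rewrite eqe pnatr_eq0.
- by move=> y /= /not_implyP[yb nP]; split => //; exact: PN.
Qed.

Lemma ae_leb3_dense (P : coord3 R -> Prop) (x : 'cV[R]_3) (e : R) : (0 < e)%R ->
  {ae leb3, forall y, P y} -> exists y, ball x e (vec y) /\ P y.
Proof.
move=> e0 [N [mN N0 PN]]; apply: contrapT => /forallNP nP.
pose I (i : 'I_3) : set (measurableTypeR R) := [set` `](x i 0%R - e)%R, (x i 0%R + e)%R[].
have mI i : measurable (I i) by exact: measurable_itv.
have lI i : lebesgue_measure (I i) = (e + e)%:E.
  rewrite /I lebesgue_measure_itv /= lte_fin ifT; last by lra.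
  by rewrite -EFinB; congr (_%:E); lra.
have : leb3 ((I 0%R `*` I 1%R) `*` I 2%R) <= leb3 N.
  apply: le_measure; rewrite ?inE//; first by do 2?[apply: measurableX => //].
  move=> [[y0 y1] y2] /= [[]]; rewrite /I /= !in_itv /= => h0 h1 h2; apply: PN => /= Py.
  apply: (nP (y0, y1, y2)); split => //.
  by rewrite -ball_normE /= /ball_ /= ltr_norm_cV3// !mxE /= !ltr_norml; lra.
have -> : leb3 ((I 0%R `*` I 1%R) `*` I 2%R) =
    leb (I 0%R) * leb (I 1%R) * leb (I 2%R).
  transitivity (mprod leb leb (I 0%R `*` I 1%R) * leb (I 2%R)).
    by apply: product_measure1E => //; exact: measurableX.
  by congr (_ * _)%E; exact: product_measure1E.
by rewrite N0 !lI -!EFinM lee_fin leNgt !mulr_gt0// addr_gt0.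
Qed.

Lemma ae_leb6_dense (P : coord3 R * coord3 R -> Prop) (x v : 'cV[R]_3) (e : R) :
  (0 < e)%R -> {ae leb6, forall y, P y} ->
  exists y, [/\ ball x e (vec y.1), ball v e (vec y.2) & P y].
Proof.
move=> e0 /ae_mprod_sections /(ae_leb3_dense x e0)[y [xy]].
by move=> /(ae_leb3_dense v e0)[z [vz Pz]]; exists (y, z).
Qed.

End negligible_images.

Section cone.
Context {R : realType}.

(* The cosine of the angle whose cotangent is t. *)
Definition cos_cotan (t : R) := t / Num.sqrt (1 + t ^+ 2).

Lemma sqrt_1sqr_ge1 (t : R) : 1 <= Num.sqrt (1 + t ^+ 2).
Proof. by rewrite -[leLHS]sqrtr1 ler_sqrt ?lerDl ?sqr_ge0// addr_ge0 ?sqr_ge0. Qed.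

Lemma sqr_sqrt_1sqr (t : R) : Num.sqrt (1 + t ^+ 2) ^+ 2 = 1 + t ^+ 2.
Proof. by rewrite sqr_sqrtr// addr_ge0// sqr_ge0. Qed.

Lemma cos_cotan_lipschitz (x y : R) :
  `|cos_cotan x - cos_cotan y| <= `|x - y|.
Proof.
rewrite -ler_sqr ?nnegrE// !real_normK ?num_real// /cos_cotan.
set p := Num.sqrt (1 + x ^+ 2); set q := Num.sqrt (1 + y ^+ 2).
have p1 : 1 <= p := sqrt_1sqr_ge1 x; have q1 : 1 <= q := sqrt_1sqr_ge1 y.
have p2 : p ^+ 2 = 1 + x ^+ 2 := sqr_sqrt_1sqr x.
have q2 : q ^+ 2 = 1 + y ^+ 2 := sqr_sqrt_1sqr y.
have pq1 : 1 <= p * q by nra.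
(* Distance of the unit vectors (x, 1) / p and (y, 1) / q. *)
have E : (x / p - y / q) ^+ 2 + (p^-1 - q^-1) ^+ 2 = (2 * (p * q) - 2 * (x * y) - 2) / (p * q).
  have p0 : p != 0 by lra. have q0 : q != 0 by lra.
  transitivity ((x ^+ 2 + 1) / p ^+ 2 + (y ^+ 2 + 1) / q ^+ 2 - 2 * (x * y + 1) / (p * q)).
    by field; rewrite p0 q0.
  by rewrite ![_ ^+ 2 + 1]addrC -p2 -q2; field; rewrite p0 q0.
have : (2 * (p * q) - 2 * (x * y) - 2) / (p * q) <= (x - y) ^+ 2.
  rewrite ler_pdivrMr; last by lra.
  apply: (@le_trans _ _ ((x - y) ^+ 2)); last first.
    by rewrite -[leLHS]mulr1 ler_wpM2l// sqr_ge0.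
  have : 2 * (p * q) <= p ^+ 2 + q ^+ 2.
    by rewrite -subr_ge0 (_ : _ - _ = (p - q) ^+ 2) ?sqr_ge0//; ring.
  rewrite p2 q2 (_ : (x - y) ^+ 2 = x ^+ 2 + y ^+ 2 - 2 * (x * y)); last by ring.
  by clear; clearbody p q; lra.
have := sqr_ge0 (p^-1 - q^-1); lra.
Qed.

Lemma cos_cotan_itv t : -1 < cos_cotan t < 1.
Proof.
rewrite -ltr_norml -(@expr_lt1 _ 2)// real_normK ?num_real// expr_div_n.
by rewrite sqr_sqrt_1sqr ltr_pdivrMr ?mul1r ?ltrDr ?ltr01// ltr_wpDr ?sqr_ge0.
Qed.

Lemma cos_cotan_surj c : -1 < c < 1 -> exists t, cos_cotan t = c.
Proof.
move=> c1; have c20 : 0 < 1 - c ^+ 2 by nra.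
exists (c / Num.sqrt (1 - c ^+ 2)); rewrite /cos_cotan expr_div_n sqr_sqrtr ?ltW//.
have -> : 1 + c ^+ 2 / (1 - c ^+ 2) = (1 - c ^+ 2)^-1 by field; lra.
rewrite sqrtrV ?ltW// invrK -mulrA mulVf ?mulr1// gt_eqF// sqrtr_gt0//.
Qed.

Lemma cvg_coef (T : Type) (F : set_system T) {FF : Filter F} (f : T -> 'cV[R]_3)
  (a : 'cV[R]_3) (i : 'I_3) : f x @[x --> F] --> a -> f x i 0 @[x --> F] --> a i 0.
Proof.
move=> fa; apply: (@cvg_comp _ _ _ f (fun x : 'cV[R]_3 => x i 0) _ _ _ fa).
exact: continuous_coef.
Qed.

Lemma cvg_dot (T : Type) (F : set_system T) {FF : Filter F} (f g : T -> 'cV[R]_3)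
  (a c : 'cV[R]_3) : f x @[x --> F] --> a -> g x @[x --> F] --> c ->
  dot (f x) (g x) @[x --> F] --> dot a c.
Proof.
move=> fa gc; rewrite dotE; under eq_fun do rewrite dotE.
by apply: cvgD; [apply: cvgD|]; apply: cvgM; exact: cvg_coef.
Qed.

Lemma cvg_enorm (T : Type) (F : set_system T) {FF : Filter F} (f : T -> 'cV[R]_3)
  (a : 'cV[R]_3) : f x @[x --> F] --> a -> enorm (f x) @[x --> F] --> enorm a.
Proof. by move=> fa; apply: (cvg_comp _ _ fa); exact: continuous_enorm. Qed.

Lemma cvg_direction (T : Type) (F : set_system T) {FF : Filter F} (f : T -> 'cV[R]_3)
  (a : 'cV[R]_3) : a != 0 -> f x @[x --> F] --> a ->
  direction (f x) @[x --> F] --> direction a.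
Proof.
move=> a0 fa; apply: cvgZ => //; apply: cvgV; first by rewrite enorm_eq0.
exact: cvg_enorm.
Qed.

Lemma cvg_post_collision (T : Type) (F : set_system T) {FF : Filter F}
  (f g h : T -> 'cV[R]_3) (v w s : 'cV[R]_3) :
  f x @[x --> F] --> v -> g x @[x --> F] --> w -> h x @[x --> F] --> s ->
  post_collision (f x) (g x) (h x) @[x --> F] --> post_collision v w s.
Proof.
move=> fv gw hs; apply: cvgD; first by apply: cvgZr; exact: cvgD.
by apply: cvgZ => //; apply: cvgM; [apply: cvg_enorm; exact: cvgB|exact: cvg_cst].
Qed.

Lemma cvg_post_collision_star (T : Type) (F : set_system T) {FF : Filter F}
  (f g h : T -> 'cV[R]_3) (v w s : 'cV[R]_3) :
  f x @[x --> F] --> v -> g x @[x --> F] --> w -> h x @[x --> F] --> s ->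
  post_collision_star (f x) (g x) (h x) @[x --> F] --> post_collision_star v w s.
Proof.
move=> fv gw hs; apply: cvgB; first by apply: cvgZr; exact: cvgD.
by apply: cvgZ => //; apply: cvgM; [apply: cvg_enorm; exact: cvgB|exact: cvg_cst].
Qed.

Section tilt.
Implicit Types (e y : 'cV[R]_3) (t : R).

Let perp e y := y - dot e y *: e.

(** For a unit vector [e], this point of the line y + R e makes with [e] the angle of cotangent t.
    It is affine in t, so null sets on the line become null sets of cotangents. *)
Let tilt e y t := perp e y + (enorm (perp e y) * t) *: e.

Let dot_perp e y : enorm e = 1 -> dot e (perp e y) = 0.
Proof. by move=> e1; rewrite dotBr dotZr -enorm_sqr e1 expr1n mulr1 subrr. Qed.

Let enorm_tilt e y t : enorm e = 1 ->
  enorm (tilt e y t) = enorm (perp e y) * Num.sqrt (1 + t ^+ 2).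
Proof.
move=> e1; rewrite -[enorm (perp e y) in RHS]ger0_norm ?enorm_ge0// -sqrtr_sqr.
rewrite -sqrtrM ?sqr_ge0//; congr Num.sqrt.
have := dot_perp y e1; rewrite /tilt; move: (perp e y) => z ez.
by rewrite dotDl !dotDr !dotZl !dotZr (dotC z e) ez -!enorm_sqr e1; ring.
Qed.

Let tilt_neq0 e y t : enorm e = 1 -> perp e y != 0 -> tilt e y t != 0.
Proof.
move=> e1 y0; rewrite -enorm_eq0 enorm_tilt// mulf_neq0 ?enorm_eq0//.
by have := sqrt_1sqr_ge1 t; lra.
Qed.

Let dot_direction_tilt e y t : enorm e = 1 -> perp e y != 0 ->
  dot e (direction (tilt e y t)) = cos_cotan t.
Proof.
move=> e1 y0; rewrite /direction dotZr enorm_tilt// /tilt dotDr dotZr dot_perp//.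
rewrite -enorm_sqr e1 expr1n mulr1 add0r /cos_cotan.
have s1 := sqrt_1sqr_ge1 t; field.
by rewrite enorm_eq0 y0 andbT; lra.
Qed.

(** Identifies s/2 as its own tilt at cotangent t, and shows that it is not parallel to [e], a
    finite cotangent excluding the cosines 1 and -1. *)
Let perp_half e (s : 'cV[R]_3) t : enorm e = 1 -> enorm s = 1 ->
  dot e s = cos_cotan t ->
  enorm (perp e (2^-1 *: s)) * t = cos_cotan t / 2 /\ perp e (2^-1 *: s) != 0.
Proof.
move=> e1 s1 es; have s1t := sqrt_1sqr_ge1 t.
have E : enorm (perp e (2^-1 *: s)) = (2 * Num.sqrt (1 + t ^+ 2))^-1.
  rewrite -[RHS]ger0_norm; last by rewrite invr_ge0; lra.
  rewrite -sqrtr_sqr; congr Num.sqrt.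
  rewrite /perp dotBl !dotBr !dotZl !dotZr (dotC s e) es -!enorm_sqr e1 s1 /cos_cotan.
  have sq := sqr_sqrt_1sqr t.
  rewrite exprVn exprMn sq expr1n.
  transitivity (4^-1 - 4^-1 * (t ^+ 2 / Num.sqrt (1 + t ^+ 2) ^+ 2)).
    by field; lra.
  by rewrite sq; field; have := sqr_ge0 t; lra.
split; first by rewrite E /cos_cotan; field; lra.
by rewrite -enorm_eq0 E invr_eq0; lra.
Qed.

(** If the identity fails at the angle [c0], it fails nearby by continuity. Fubini yields a pair of
    velocities and a line along their relative velocity on which the kernel times the difference
    vanishes at almost every point of the ball. So [b] vanishes at almost every angle near [c0],
    contrary to the choice of [c0]. Quantifying [c0] before [f] keeps it independent of the
    solution. *)
Theorem gain_loss_eq0 (gamma : R) (b : R -> R) : angular_kernel b ->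
  exists c0, -1 < c0 < 1 /\ forall f : 'cV[R]_3 -> R, continuous f ->
  {ae mprod leb6 sphere, forall z : coord3 R * coord3 R * coord3 R,
    collision_kernel gamma b (vec z.1.1 - vec z.1.2) (vec z.2) *
    (f (post_collision_star (vec z.1.1) (vec z.1.2) (vec z.2)) *
     f (post_collision (vec z.1.1) (vec z.1.2) (vec z.2)) -
     f (vec z.1.2) * f (vec z.1.1)) = 0} ->
  forall v w s, v != w -> enorm s = 1 -> dot (direction (v - w)) s = c0 ->
    f (post_collision_star v w s) * f (post_collision v w s) = f w * f v.
Proof.
move=> [mb b0 _ bn0 _].
(* [cos_cotan] is Lipschitz, so if this set were null then [b] would vanish almost everywhere on
   ]-1, 1[; the endpoints, which have no cotangent, are null. *)
have nP : ~ (@lebesgue_measure R).-negligible [set t | b (cos_cotan t) != 0].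
  move=> /(lipschitz_negligible cos_cotan_lipschitz) ng; apply: bn0.
  have n1 (a : R) : (@lebesgue_measure R).-negligible [set a].
    by apply/negligibleP => //; exact: lebesgue_measure_set1.
  apply: negligibleS (negligibleU (negligibleU ng (n1 1)) (n1 (-1))).
  move=> c /= /not_implyP[c1 /eqP bc].
  have [->|c1'] := eqVneq c 1; first by left; right.
  have [->|c1''] := eqVneq c (-1); first by right.
  left; left; have [t tc] : exists t, cos_cotan t = c.
    by apply: cos_cotan_surj; rewrite !lt_neqAle eq_sym c1' c1''.
  by exists t => //=; rewrite tc.
have [t0 t0P] := not_negligible_point nP.
exists (cos_cotan t0); split; first exact: cos_cotan_itv.
move=> f cf aeB v0 w0 s0 vw0 s1 es; apply: contrapT => /eqP nD.
set D := fun v w s => f (post_collision_star v w s) * f (post_collision v w s) - f w * f v.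
have u0 : v0 - w0 != 0 by rewrite subr_eq0.
have e1 : enorm (direction (v0 - w0)) = 1 by exact: enorm_direction.
have [yt yp0] := perp_half e1 s1 es.
(* Half of s0 leaves room in the unit ball, so that tilts of nearby points stay in
   [punctured_ball]. *)
pose y0 : 'cV[R]_3 := 2^-1 *: s0.
pose E (p : 'cV[R]_3 * 'cV[R]_3 * 'cV[R]_3 * R) := direction (p.1.1.1 - p.1.1.2).
pose p0 : 'cV[R]_3 * 'cV[R]_3 * 'cV[R]_3 * R := (v0, w0, y0, t0).
pose m (p : 'cV[R]_3 * 'cV[R]_3 * 'cV[R]_3 * R) := tilt (E p) p.1.2 p.2.
have m0 : m p0 = y0.
  by rewrite /m /tilt yt /perp dotZr es mulrC subrK.
have cv : p.1.1.1 @[p --> p0] --> v0.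
  by apply: (cvg_comp _ _ (cvg_comp _ _ cvg_fst cvg_fst) cvg_fst).
have cw : p.1.1.2 @[p --> p0] --> w0.
  by apply: (cvg_comp _ _ (cvg_comp _ _ cvg_fst cvg_fst) cvg_snd).
have cy : p.1.2 @[p --> p0] --> y0 by apply: (cvg_comp _ _ cvg_fst cvg_snd).
have ct : p.2 @[p --> p0] --> t0 by exact: cvg_snd.
have cu : p.1.1.1 - p.1.1.2 @[p --> p0] --> v0 - w0 by exact: cvgB.
have cE : E p @[p --> p0] --> E p0 by exact: cvg_direction.
have cp : perp (E p) p.1.2 @[p --> p0] --> perp (E p0) y0.
  exact: cvgB cy (cvgZ (cvg_dot cE cy) cE).
have cm : m p @[p --> p0] --> m p0.
  exact: cvgD cp (cvgZ (cvgM (cvg_enorm cp) ct) cE).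
have m00 : m p0 != 0 by exact: tilt_neq0.
have cs : direction (m p) @[p --> p0] --> s0.
  have <- : direction (m p0) = s0 by rewrite m0 directionZ ?invr_gt0// direction_unit.
  exact: cvg_direction.
have cfc (g : _ -> 'cV[R]_3) a : g p @[p --> p0] --> a -> f (g p) @[p --> p0] --> f a.
  by move=> ga; exact: (@cvg_comp _ _ _ g f _ _ _ ga (cf a)).
have cD : D p.1.1.1 p.1.1.2 (direction (m p)) @[p --> p0] --> D v0 w0 s0.
  apply: cvgB; apply: cvgM.
  - exact: (cfc (fun p => post_collision_star p.1.1.1 p.1.1.2 (direction (m p))) _ (cvg_post_collision_star cv cw cs)).
  - exact: (cfc (fun p => post_collision p.1.1.1 p.1.1.2 (direction (m p))) _ (cvg_post_collision cv cw cs)).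
  - exact: (cfc (fun p => p.1.1.2) _ cw).
  - exact: (cfc (fun p => p.1.1.1) _ cv).
have em0 : enorm (m p0) < 1.
  by rewrite m0 enormZ s1 mulr1 ger0_norm ?invr_ge0// invf_lt1 ?ltr1n.
have : \forall p \near p0, [/\ p.1.1.1 - p.1.1.2 != 0, perp (E p) p.1.2 != 0,
    enorm (m p) < 1 & D p.1.1.1 p.1.1.2 (direction (m p)) != 0].
  near=> p; split.
  - near: p; exact: (cvgr_neq0 _ cu).
  - near: p; exact: (cvgr_neq0 _ cp).
  - near: p; exact: (cvgr_lt _ (cvg_enorm cm)).
  - near: p; apply: (cvgr_neq0 _ cD); rewrite subr_eq0//.
move=> /nbhs_ballP[r /= r0 rP].
(* Good parameters are dense. The velocities are fixed before the base point, because they determine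
   the direction of the line. *)
have /(ae_leb6_dense v0 w0 r0)[[v' w'] [/= vr wr]] := ae_mprod_sections aeB.
move=> /ae_sphere_ball/(ae_leb3_lines (direction (vec v' - vec w'))).
move=> /(ae_leb3_dense y0 r0)[y' [yr]].
set v := vec v' in vr *; set w := vec w' in wr *; set y := vec y' in yr *.
set e := direction (v - w) => aet.
have rP' t : ball t0 r t -> [/\ v - w != 0, perp e y != 0,
    enorm (tilt e y t) < 1 & D v w (direction (tilt e y t)) != 0].
  by move=> tr; apply: (rP (v, w, y, t)).
have [vw yp _ _] := rP' t0 (ballxx _ r0).
have e1' : enorm e = 1 by exact: enorm_direction.
have yp' : enorm (perp e y) != 0 by rewrite enorm_eq0.
(* The tilt at cotangent t sits on the line at parameter |perp| t - e.y, an affine function of t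
   with nonzero slope. *)
apply: (t0P r r0); apply: negligibleS (ae_lebesgue_affine (- dot e y) yp' aet).
move=> t /= [bt /rP'[_ _ mt Dt]].
have -> : y + (enorm (perp e y) * t - dot e y) *: e = tilt e y t.
  by rewrite /tilt /perp scalerBl; apply/matrixP => i j; rewrite !mxE; ring.
have mt0 : tilt e y t != 0 by exact: tilt_neq0.
have pb : punctured_ball (coords (tilt e y t)).
  by rewrite /punctured_ball /= coordsK enorm_gt0 mt0 ltW.
move=> /(_ pb); rewrite /to_sphere !coordsK => /eqP; rewrite mulf_eq0 (negbTE Dt) orbF.
rewrite /collision_kernel mulf_eq0 dot_direction_tilt// (negbTE bt) orbF.
by rewrite gt_eqF// powR_gt0// enorm_gt0.
Unshelve. all: by end_near. Qed.

End tilt.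

End cone.

(** * Maxwellians *)

Lemma dnbhs_cvg (R : realType) (k : R -> R) (a l : R) :
  k t @[t --> a] --> l -> k t @[t --> a^'] --> l.
Proof. by move=> kl A /kl; exact: nbhs_dnbhs. Qed.

Section derivatives_on_lines.
Context {R : realType} {V : normedModType R}.
Implicit Types (f : V -> R) (x v : V).

Lemma is_derive_cvg f x v (l : R) :
  (h^-1 * (f (h *: v + x) - f x)) @[h --> (0 : R)^'] --> l -> is_derive x v f l.
Proof.
move=> fl; have fl' : (fun h => h^-1 *: ((f \o shift x) (h *: v) - f x)) @ (0 : R)^' --> l.
  exact: fl.
by split; [apply/cvg_ex; exists l|exact: cvg_lim].
Qed.

Lemma cvg_is_derive f x v (l : R) : is_derive x v f l ->
  (h^-1 * (f (h *: v + x) - f x)) @[h --> (0 : R)^'] --> l.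
Proof. by move=> [df <-]; exact: df. Qed.

Lemma is_derive_line f x v (t l : R) : is_derive (x + t *: v) v f l ->
  is_derive t 1 (fun s : R => f (x + s *: v)) l.
Proof.
move=> /cvg_is_derive fl; split.
  apply/cvg_ex; exists l; apply: cvg_trans fl; apply: near_eq_cvg.
  apply: nearW => h /=; congr (_ * (f _ - _)).
  by rewrite [h *: 1]mulr1 scalerDl addrCA.
apply: cvg_lim => //; apply: cvg_trans fl; apply: near_eq_cvg.
apply: nearW => h /=; congr (_ * (f _ - _)).
by rewrite [h *: 1]mulr1 scalerDl addrCA.
Qed.

Lemma differentiable_is_derive f x v : differentiable f x ->
  is_derive x v f ('d f x v).
Proof. by move=> df; split; [exact: diff_derivable|exact: deriveE]. Qed.

Lemma eq_const_of_derive0 f : (forall x v, is_derive x v f 0) ->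
  forall x, f x = f 0.
Proof.
move=> f0 x; have := @is_derive_0_is_cst R (fun s : R => f (0 + s *: x)) 1 0.
by rewrite scale1r scale0r addr0 add0r; apply => s; exact: is_derive_line.
Qed.

Lemma is_derive_eq_near f g x v (l : R) : (\forall h \near (0 : R), g (h *: v + x) = f (h *: v + x)) ->
  is_derive x v f l -> is_derive x v g l.
Proof.
move=> gf /cvg_is_derive fl; apply: is_derive_cvg; apply: cvg_trans fl.
apply: near_eq_cvg.
have g0 : g x = f x by have := nbhs_singleton gf; rewrite scale0r add0r.
by move/nbhs_dnbhs : gf; apply: filterS => h -> ; rewrite g0.
Qed.

End derivatives_on_lines.

Section maxwellian.
Context {R : realType}.
Implicit Types (x y v w s : 'cV[R]_3).

Definition cross x y : 'cV[R]_3 := \col_i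
  [:: x 1 0 * y 2 0 - x 2 0 * y 1 0; x 2 0 * y 0 0 - x 0 0 * y 2 0;
      x 0 0 * y 1 0 - x 1 0 * y 0 0]`_i.

Lemma dot_crossl x y : dot x (cross x y) = 0.
Proof. by rewrite dotE !mxE /=; ring. Qed.

Lemma dot_crossr x y : dot y (cross x y) = 0.
Proof. by rewrite dotE !mxE /=; ring. Qed.

Lemma dot_cross_sqr x y :
  dot (cross x y) (cross x y) = dot x x * dot y y - dot x y ^+ 2.
Proof. by rewrite !dotE !mxE /=; ring. Qed.

Section normal_increments.
Variable G : 'cV[R]_3 -> 'cV[R]_3 -> R.
Hypothesis GD : forall v x y, G v (x + y) = G v x + G v y.
Hypothesis GZ : forall v k x, G v (k *: x) = k * G v x.
Hypothesis G_normal : forall x a v, dot a v = 0 -> G (x + a) v = G x v.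

Let e (i : 'I_3) : 'cV[R]_3 := delta_mx i 0.

Let dot_e (i j : 'I_3) : dot (e i) (e j) = (i == j)%:R.
Proof.
rewrite /dot (bigD1 i)//= big1 ?addr0.
  by rewrite !mxE !eqxx /= mul1r andbT.
by move=> k ki; rewrite !mxE (negbTE ki) mul0r.
Qed.

Let dot_ex (i : 'I_3) x : dot x (e i) = x i 0.
Proof.
rewrite /dot (bigD1 i)//= big1 ?addr0.
  by rewrite !mxE !eqxx mulr1.
by move=> k ki; rewrite !mxE (negbTE ki) mulr0.
Qed.

Let cV_e x : x = \sum_i x i 0 *: e i.
Proof.
apply/matrixP => j k; rewrite ord1 summxE (bigD1 j)//= big1 ?addr0.
  by rewrite !mxE !eqxx mulr1.
by move=> i ij; rewrite !mxE eq_sym (negbTE ij) mulr0.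
Qed.

(** Increment of the i-th partial derivative, which by orthogonality depends on the i-th coordinate
    alone. *)
Let K i a := G (a *: e i) (e i) - G 0 (e i).

Let G_coord v i : G v (e i) = G 0 (e i) + K i (v i 0).
Proof.
rewrite /K [RHS]addrC subrK.
have := @G_normal (v i 0 *: e i) (v - v i 0 *: e i) (e i).
by rewrite addrCA subrr addr0; apply; rewrite dotBl dotZl dot_ex dot_e eqxx mulr1 subrr.
Qed.

(** As b e_i - a e_j is orthogonal to a e_i + b e_j, the differential in the first direction is the
    same at 0 and at the second vector. *)
Let K_cross (i j : 'I_3) a b : i != j -> b * K i a = a * K j b.
Proof.
move=> ij; have := @G_normal 0 (a *: e i + b *: e j) (b *: e i - a *: e j).
have ji : (j == i) = false by rewrite eq_sym (negbTE ij).
rewrite add0r dotDl !dotBr !dotZl !dotZr !dot_e (negbTE ij) ji !eqxx.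
have -> : a * (b * 1%:R) - a * (a * 0%:R) + (b * (b * 0%:R) - b * (a * 1%:R)) = 0 :> R by ring.
have vi : (a *: e i + b *: e j) i 0 = a.
  by rewrite -dot_ex dotDl !dotZl !dot_e eqxx ji mulr1 mulr0 addr0.
have vj : (a *: e i + b *: e j) j 0 = b.
  by rewrite -dot_ex dotDl !dotZl !dot_e eqxx (negbTE ij) mulr1 mulr0 add0r.
move=> /(_ erefl); rewrite -scaleNr !GD !GZ (G_coord _ i) (G_coord _ j) vi vj.
by move: (K i a) (K j b) (G 0 (e i)) (G 0 (e j)) => *; lra.
Qed.

(** [K_cross] with one argument 1 shows that all [K i] are linear with a common slope: a gradient
    with this invariance is affine, with scalar linear part. *)
Lemma normal_increments : exists be lam, forall x w,
  G x w = dot be w + lam * dot x w.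
Proof.
have K01 : forall i j : 'I_3, i != j -> K i 1 = K j 1.
  by move=> i j /(@K_cross i j 1 1); rewrite !mul1r.
have KE i a : K i a = K 0 1 * a.
  have [j ij] : exists j : 'I_3, i != j.
    by case: (eqVneq i 0) => [->|i0]; [exists 1|exists 0].
  have := K_cross a 1 ij; rewrite mul1r => ->; rewrite mulrC; congr (_ * _).
  by case: (eqVneq j 0) => [->//|j0]; exact: K01.
exists (\col_i G 0 (e i)), (K 0 1) => x w.
transitivity (G x (\sum_i w i 0 *: e i)); first by rewrite -cV_e.
have beE i : (\col_i G 0 (e i)) i 0 = G 0 (e i) by rewrite mxE.
rewrite sum3E 2!GD 3!GZ (G_coord x 0) (G_coord x 1) (G_coord x 2) (KE 0 (x 0 0)) (KE 1 (x 1 0)) (KE 2 (x 2 0)) !dotE !beE.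
by move: (G 0 (e 0)) (G 0 (e 1)) (G 0 (e 2)) (K 0 1) => *; ring.
Qed.

End normal_increments.

Variables (c0 : R) (f : 'cV[R]_3 -> R).
Hypothesis c01 : -1 < c0 < 1.
Hypothesis df : forall v, differentiable f v.
Hypothesis f0 : forall v, 0 < f v.
Hypothesis fE : forall v w s, v != w -> enorm s = 1 ->
  dot (direction (v - w)) s = c0 ->
  f (post_collision_star v w s) * f (post_collision v w s) = f w * f v.

Let g v := ln (f v).

Let gE v w s : v != w -> enorm s = 1 -> dot (v - w) s = c0 * enorm (v - w) ->
  g (post_collision_star v w s) + g (post_collision v w s) = g w + g v.
Proof.
move=> vw s1 vws; rewrite /g -!lnM ?posrE// fE//.
rewrite /direction dotZl vws mulrCA mulVf ?mulr1//.
by rewrite enorm_eq0 subr_eq0.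
Qed.

(* Both diagonals of the rectangle with sides a and c collide into the same
   pair of velocities, along the direction m below. *)
Let rectangle x a c : a != 0 -> c != 0 -> dot a c = 0 ->
  c0 ^+ 2 * (dot a a + dot c c) <= dot a a ->
  g (x + a + c) + g x = g (x + a) + g (x + c).
Proof.
move=> a0 c'0 ac small.
have A0 : 0 < dot a a by rewrite lt0r dot_eq0 a0 dot_ge0.
have C0 : 0 < dot c c by rewrite lt0r dot_eq0 c'0 dot_ge0.
have dd : dot (a + c) (a + c) = dot a a + dot c c.
  by rewrite dotDl !dotDr (dotC c a) ac; ring.
have dd' : dot (a - c) (a - c) = dot a a + dot c c.
  by rewrite dotBl !dotBr (dotC c a) ac; ring.
set d := enorm (a + c).
have dE' : enorm (a - c) = d by apply: enorm_inj; rewrite dd dd'.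
have d2 : d ^+ 2 = dot a a + dot c c by rewrite enorm_sqr.
(* The component of [m] along [a] gives cosine [c0] with both diagonals, and [be] completes it to a
   unit vector along the cross product; [small] makes the radicand nonnegative. *)
pose be := Num.sqrt ((1 - c0 ^+ 2 * d ^+ 2 / dot a a) / (dot a a * dot c c)).
pose m := (c0 * d / dot a a) *: a + be *: cross a c.
have be2 : be ^+ 2 = (1 - c0 ^+ 2 * d ^+ 2 / dot a a) / (dot a a * dot c c).
  rewrite sqr_sqrtr// divr_ge0 ?mulr_ge0 ?dot_ge0// subr_ge0 ler_pdivrMr// mul1r.
  by rewrite d2.
have am : dot a m = c0 * d.
  by rewrite dotDr !dotZr dot_crossl mulr0 addr0 -mulrA mulVf ?mulr1// gt_eqF.
have cm : dot c m = 0.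
  by rewrite dotDr !dotZr dot_crossr (dotC c a) ac !mulr0 addr0.
have m1 : enorm m = 1.
  rewrite /enorm [dot m m](_ : _ = 1) ?sqrtr1//.
  rewrite {1}/m dotDl !dotZl am /m dotDr !dotZr (dotC _ a) dot_crossl dot_cross_sqr ac.
  rewrite mulr0 add0r expr0n subr0.
  transitivity (c0 ^+ 2 * d ^+ 2 / dot a a + be ^+ 2 * (dot a a * dot c c)).
    by field; rewrite gt_eqF.
  by rewrite be2; field; rewrite !gt_eqF.
have := @gE (x + a + c) x m; have := @gE (x + a) (x + c) m.
have -> : x + a + c - x = a + c by rewrite -(addrA x) addrAC subrr add0r.
have -> : x + a - (x + c) = a - c by rewrite opprD addrACA subrr add0r.
have n1 : x + a + c != x by rewrite -subr_eq0 (_ : _ - _ = a + c) -?dot_eq0 ?dd ?gt_eqF ?addr_gt0// -(addrA x) addrAC subrr add0r.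
have n2 : x + a != x + c.
  rewrite -subr_eq0 (_ : _ - _ = a - c) -?dot_eq0 ?dd' ?gt_eqF ?addr_gt0//.
  by rewrite opprD addrACA subrr add0r.
rewrite dotBl dotDl am cm subr0 addr0 dE' -/d.
move=> /(_ n2 m1 erefl) + /(_ n1 m1 erefl).
rewrite /post_collision /post_collision_star.
have -> : x + a + c - x = a + c by rewrite -(addrA x) addrAC subrr add0r.
have -> : x + a - (x + c) = a - c by rewrite opprD addrACA subrr add0r.
have -> : x + a + c + x = x + a + (x + c) by rewrite -addrA [c + x]addrC.
rewrite dE' -/d => -> h; rewrite addrC -h addrC//.
Qed.

Let dg v : differentiable g v.
Proof.
apply: differentiable_comp; first exact: df.
by apply/derivable1_diffP; apply: ex_derive; exact: is_derive1_ln.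
Qed.

Let G v x := 'd g v x.

Let GD v x y : G v (x + y) = G v x + G v y.
Proof. exact: linearD. Qed.

Let GZ v k x : G v (k *: x) = k * G v x.
Proof. exact: linearZ. Qed.

Let G0 v : G v 0 = 0.
Proof. by have := GZ v 0 0; rewrite scale0r mul0r. Qed.

(** The rectangle with sides a and t v is admissible for small t because c0^2 < 1, so y -> g (y + a)
    - g y is constant along v near x. *)
Let G_normal x a v : dot a v = 0 -> G (x + a) v = G x v.
Proof.
move=> av; have [->|a0] := eqVneq a 0; first by rewrite addr0.
have [->|v0] := eqVneq v 0; first by rewrite !G0.
have A0 : 0 < dot a a by rewrite lt0r dot_eq0 a0 dot_ge0.
suff h : is_derive x v (fun y => g (y + a) - g y) 0.
  have h1 : is_derive x v (fun y => g (y + a)) (G (x + a) v).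
    have := differentiable_is_derive v (dg (x + a)) => /cvg_is_derive h1.
    apply: is_derive_cvg; apply: cvg_trans h1; apply: near_eq_cvg; apply: nearW => t.
    by rewrite addrA.
  have h2 := is_deriveB h1 (differentiable_is_derive v (dg x)).
  have := @derive_val _ _ _ _ _ _ _ h2.
  rewrite (@derive_val _ _ _ _ _ _ _ h) => /esym/eqP.
  by rewrite subr_eq0 => /eqP.
apply: (is_derive_eq_near (f := cst (g (x + a) - g x))).
have c20 : 0 < dot a a * (1 - c0 ^+ 2).
  have /andP[c1 c2] := c01; have -> : 1 - c0 ^+ 2 = (1 - c0) * (1 + c0) by ring.
  by apply: mulr_gt0 => //; rewrite mulr_gt0 ?subr_gt0 ?(addrC 1) -?ltrBlDr ?sub0r.
have cc : c0 ^+ 2 * (dot a a + t ^+ 2 * dot v v) @[t --> (0 : R)] -->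
    c0 ^+ 2 * (dot a a + 0 ^+ 2 * dot v v).
  apply: cvgM; first exact: cvg_cst.
  by apply: cvgD; [exact: cvg_cst|apply: cvgM; [exact: exprn_continuous|exact: cvg_cst]].
have : \forall t \near (0 : R), c0 ^+ 2 * (dot a a + t ^+ 2 * dot v v) < dot a a.
  apply: (cvgr_lt _ cc); rewrite expr0n mul0r addr0; lra.
apply: filterS => t tlt /=.
have [->|t0] := eqVneq t 0; first by rewrite scale0r add0r.
have := @rectangle x a (t *: v) a0; rewrite scaler_eq0 negb_or t0 v0.
rewrite dotZr av mulr0 dotZl dotZr mulrA -expr2 => /(_ isT erefl (ltW tlt)).
by rewrite addrAC (addrC x (t *: v)) => h; lra.
Qed.

Theorem maxwellian : exists a be lam, forall v,
  ln (f v) = a + dot be v + lam * (dot v v / 2).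
Proof.
have [be [lam GE]] := normal_increments GD GZ G_normal.
exists (g 0), be, lam => v; rewrite -/(g v).
pose h v := g v - (dot be v + lam * (dot v v / 2)).
suff : h v = h 0 by rewrite /h !dot0r mul0r mulr0 addr0 subr0 => <-; ring.
apply: eq_const_of_derive0 => x w.
have h1 := differentiable_is_derive w (dg x).
have h2 : is_derive x w (fun v => dot be v + lam * (dot v v / 2)) (dot be w + lam * dot x w).
  apply: is_derive_cvg.
  have /dnbhs_cvg : dot be w + lam * (dot x w + t * (dot w w / 2)) @[t --> (0 : R)] -->
      dot be w + lam * (dot x w + 0 * (dot w w / 2)).
    apply: cvgD; first exact: cvg_cst.
    apply: cvgM; first exact: cvg_cst.
    by apply: cvgD; [exact: cvg_cst|apply: cvgM; [exact: cvg_id|exact: cvg_cst]].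
  rewrite mul0r addr0; apply: cvg_trans.
  apply: near_eq_cvg; near=> t.
  have t0 : t != 0 by near: t; exact: nbhs_dnbhs_neq.
  rewrite !dotDr !dotDl !dotZl !dotZr (dotC w x); field; exact: t0.
have -> : 0 = G x w - (dot be w + lam * dot x w) by rewrite GE subrr.
exact: is_deriveB h1 h2.
Unshelve. all: by end_near. Qed.

End maxwellian.

(** * Rigidity under transport *)

Section real_derivatives.
Context {R : realType}.

Lemma is_derive_unique (V : normedModType R) (f : V -> R) (x v : V) (a c : R) :
  is_derive x v f a -> is_derive x v f c -> a = c.
Proof. by move=> [_ <-] [_ <-]. Qed.

Lemma near_gt0 (t : R) : 0 < t -> \forall s \near t, 0 < s.
Proof. by have := @cvg_id _ (nbhs t); move/(cvgr_gt t); apply. Qed.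

Lemma is_derive_gt0_ext (f h : R -> R) (t l : R) : 0 < t ->
  (forall s : R, 0 < s -> h s = f s) -> is_derive t 1 f l -> is_derive t 1 h l.
Proof.
move=> t0 hf; apply: near_eq_is_derive; have := near_gt0 t0.
by apply: filterS => s /hf.
Qed.

(** Composition with [expR] turns the half line into the whole line. *)
Lemma eq_const_of_derive0_gt0 (f : R -> R) :
  (forall t : R, 0 < t -> is_derive t 1 f 0) -> forall t : R, 0 < t -> f t = f 1.
Proof.
move=> f0 t t0; have := @is_derive_0_is_cst R (f \o expR) (ln t) 0.
rewrite /= expR0 lnK//; apply => u.
have := f0 _ (expR_gt0 u) => fu.
have := is_derive1_comp fu (is_derive_expR u).
by rewrite mul0r.
Qed.

Lemma is_derive_dot (x v b : 'cV[R]_3) : is_derive x v (fun y => dot b y) (dot b v).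
Proof.
apply: is_derive_cvg; apply: cvg_near_cst; near=> h.
rewrite dotDr dotZr addrK mulKf//; near: h; exact: nbhs_dnbhs_neq.
Unshelve. all: by end_near. Qed.

Lemma is_derive_sqr (x v : 'cV[R]_3) : is_derive x v (fun y => dot y y / 2) (dot x v).
Proof.
apply: is_derive_cvg.
have /dnbhs_cvg : dot x v + t * (dot v v / 2) @[t --> (0 : R)] --> dot x v + 0 * (dot v v / 2).
  by apply: cvgD; [exact: cvg_cst|apply: cvgM; [exact: cvg_id|exact: cvg_cst]].
rewrite mul0r addr0; apply: cvg_trans; apply: near_eq_cvg; near=> t.
have t0 : t != 0 by near: t; exact: nbhs_dnbhs_neq.
rewrite !dotDr !dotDl !dotZl !dotZr (dotC v x); field; exact: t0.
Unshelve. all: by end_near. Qed.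

End real_derivatives.

Section skew_increments.
Context {R : realType}.
Implicit Types (x y v : 'cV[R]_3) (C : 'cV[R]_3 -> 'cV[R]_3).

Lemma dot_delta x (i : 'I_3) : dot x (delta_mx i 0) = x i 0.
Proof.
rewrite /dot (bigD1 i)//= big1 ?addr0.
  by rewrite !mxE !eqxx mulr1.
by move=> k ki; rewrite !mxE (negbTE ki) mulr0.
Qed.

Lemma delta_mxE (i j : 'I_3) : (delta_mx i 0 : 'cV[R]_3) j 0 = (j == i)%:R.
Proof. by rewrite mxE andbT. Qed.

(** For C x = C 0 + cross omega x, these three entries are the components of omega. *)
Definition rotation_vector C : 'cV[R]_3 := \col_i
  [:: (C (delta_mx 1 0) - C 0) 2 0; (C (delta_mx 2 0) - C 0) 0 0;
      (C (delta_mx 0 0) - C 0) 1 0]`_i.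

(** Put w = C - C 0. The hypothesis reads (w x - w y).(x - y) = 0; y = 0 gives w x . x = 0, then w x
    . y = - w y . x, and so every coordinate of w is linear. No regularity of C enters. *)
Lemma skew_increments C : (forall x v, dot (C (x + v)) v = dot (C x) v) ->
  forall x, C x = C 0 + cross (rotation_vector C) x.
Proof.
move=> CE; have [w wE] : exists w, forall x, w x = C x - C 0.
  by exists (fun x => C x - C 0).
have ww x y : dot (w x - w y) (x - y) = 0.
  have := CE y (x - y); rewrite addrC subrK => h.
  by rewrite !wE opprB addrA subrK dotBl h subrr.
have w0 : w 0 = 0 by rewrite wE subrr.
have wx x : dot (w x) x = 0 by have := ww x 0; rewrite w0 !subr0.
have wxy x y : dot (w x) y = - dot (w y) x.
  by have := ww x y; rewrite dotBl !dotBr !wx; lra.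
have wc x i : w x i 0 = - dot (w (delta_mx i 0)) x.
  by rewrite -dot_delta wxy.
have wd (i j : 'I_3) : w (delta_mx i 0) j 0 = - w (delta_mx j 0) i 0.
  by rewrite -!dot_delta wxy.
have wdd (i : 'I_3) : w (delta_mx i 0) i 0 = 0 by have := wd i i; lra.
move=> x; apply/eqP; rewrite addrC -subr_eq -wE; apply/eqP.
have r0 : rotation_vector C 0 0 = w (delta_mx 1 0) 2 0 by rewrite mxE /= wE.
have r1 : rotation_vector C 1 0 = w (delta_mx 2 0) 0 0 by rewrite mxE /= wE.
have r2 : rotation_vector C 2 0 = w (delta_mx 0 0) 1 0 by rewrite mxE /= wE.
apply: cV3P; rewrite [LHS]wc [in LHS]dotE [RHS]mxE /= ?r0 ?r1 ?r2 wdd.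
- by rewrite (wd 0 2); ring.
- by rewrite (wd 1 0); ring.
- by rewrite (wd 2 1); ring.
Qed.

Lemma cross_eq0 w : (forall x v, dot (cross w x) v = 0) -> w = 0 :> 'cV[R]_3.
Proof.
move=> h; apply: cV3P; rewrite !mxE.
- by have := h (delta_mx 1 0) (delta_mx 2 0); rewrite dot_delta !mxE /=; lra.
- by have := h (delta_mx 2 0) (delta_mx 0 0); rewrite dot_delta !mxE /=; lra.
- by have := h (delta_mx 0 0) (delta_mx 1 0); rewrite dot_delta !mxE /=; lra.
Qed.

End skew_increments.

Section transport_rigidity.
Context {R : realType}.
Implicit Types (x y v w : 'cV[R]_3).
Variables Phi psi : 'cV[R]_3 -> R.
Hypothesis dPhi : forall x v, is_derive x v Phi (psi x * dot x v).
Hypothesis PhiN : forall x, Phi (- x) = Phi x.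
Hypothesis psiN : forall x, psi (- x) = psi x.

(** Times -2 [kap], this is the rate of change of a quantity that is quadratic in x at every time,
    see [kap0]. For Phi = |x|^2 / 2 it is 2 |x|^2, itself quadratic. *)
Let virial x := 2 * (Phi x - Phi 0) + psi x * dot x x.

(* These two exclude the harmonic potential, for which the period of the
   oscillations does not depend on the energy. *)
Hypothesis virial_not_quadratic : exists u r, virial (r *: u) != r ^+ 2 * virial u.
Hypothesis psi_not_const : forall u, u != 0 -> exists2 r, r != 0 & psi (r *: u) != psi u.

Variables (g : R -> 'cV[R]_3 -> 'cV[R]_3 -> R) (A L : R -> 'cV[R]_3 -> R)
  (B : R -> 'cV[R]_3 -> 'cV[R]_3).
Hypothesis gE : forall (t : R) x v, 0 < t ->
  g t x v = A t x + dot (B t x) v + L t x * (dot v v / 2).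
Variable Dx : R -> 'cV[R]_3 -> 'cV[R]_3 -> 'cV[R]_3 -> R.
Hypothesis DxZ : forall (t : R) x v k w, 0 < t -> Dx t x v (k *: w) = k * Dx t x v w.
Hypothesis dgx : forall (t : R) x v w, 0 < t ->
  is_derive x w (fun y => g t y v) (Dx t x v w).
(** The right-hand side of the transport equation for ln M: the vector B + L v is the velocity
    gradient of [g]. *)
Let T (t : R) x v := psi x * dot x (B t x + L t x *: v) - Dx t x v v.
Hypothesis dgt : forall (t : R) x v, 0 < t -> is_derive t 1 (fun s => g s x v) (T t x v).

Let is_deriveE (V : normedModType R) (f h : V -> R) (x v : V) (a c : R) :
  is_derive x v f a -> (forall y : V, h y = f y) -> c = a -> is_derive x v h c.
Proof. by move=> ? /funext -> ->. Qed.

Let Dx0 (t : R) x v : 0 < t -> Dx t x v 0 = 0.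
Proof. by move=> t0; have := DxZ x v 0 0 t0; rewrite scale0r mul0r. Qed.

(** The coefficients carry no regularity of their own. Each is a combination of values of [g] at v,
    - v and 0, and so inherits derivatives in t and x. *)
Let AE (t : R) x : 0 < t -> A t x = g t x 0.
Proof. by move=> t0; rewrite gE// dot0r dot0l; lra. Qed.

Let BE (t : R) x v : 0 < t -> dot (B t x) v = (g t x v - g t x (- v)) / 2.
Proof. by move=> t0; rewrite !gE// !dotNr !dotNl opprK; lra. Qed.

Let LE (t : R) x v : 0 < t ->
  L t x * (dot v v / 2) = (g t x v + g t x (- v)) / 2 - g t x 0.
Proof. by move=> t0; rewrite !gE// !dotNr !dotNl opprK !dot0r; lra. Qed.

Let odd_part (V : normedModType R) (f h : V -> R) (x v : V) (a c : R) :
  is_derive x v f a -> is_derive x v h c ->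
  is_derive x v (fun y : V => (f y - h y) / 2) ((a - c) / 2).
Proof.
move=> fa hc; apply: (is_deriveE (is_deriveZ 2^-1 (is_deriveB fa hc))).
  by move=> y; rewrite mulrC.
by rewrite mulrC.
Qed.

Let even_part (V : normedModType R) (f h k : V -> R) (x v : V) (a c d : R) :
  is_derive x v f a -> is_derive x v h c -> is_derive x v k d ->
  is_derive x v (fun y : V => (f y + h y) / 2 - k y) ((a + c) / 2 - d).
Proof.
move=> fa hc kd; apply: (is_deriveE (is_deriveB (is_deriveZ 2^-1 (is_deriveD fa hc)) kd)).
  by move=> y; rewrite mulrC.
by rewrite mulrC.
Qed.

Let scaled (V : normedModType R) (f : V -> R) (x v : V) (a k : R) :
  is_derive x v f a -> is_derive x v (fun y : V => k * f y) (k * a).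
Proof. by move=> fa; apply: (is_deriveE (is_deriveZ k fa)). Qed.

Let DA (t : R) x w := Dx t x 0 w.
Let DB (t : R) x v w := (Dx t x v w - Dx t x (- v) w) / 2.
Let DL (t : R) x v w := (Dx t x v w + Dx t x (- v) w) / 2 - Dx t x 0 w.

Let dAx (t : R) x w : 0 < t -> is_derive x w (A t) (DA t x w).
Proof. by move=> t0; apply: (is_deriveE (dgx x 0 w t0)) => // y; exact: AE. Qed.

Let dBx (t : R) x v w : 0 < t -> is_derive x w (fun y => dot (B t y) v) (DB t x v w).
Proof.
by move=> t0; apply: (is_deriveE (odd_part (dgx x v w t0) (dgx x (- v) w t0))) => // y;
  exact: BE.
Qed.

Let dLx (t : R) x v w : 0 < t ->
  is_derive x w (fun y => L t y * (dot v v / 2)) (DL t x v w).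
Proof.
by move=> t0; apply: (is_deriveE (even_part (dgx x v w t0) (dgx x (- v) w t0) (dgx x 0 w t0)))
  => // y; exact: LE.
Qed.

Let DBZ (t : R) x v w k : 0 < t -> DB t x (k *: v) w = k * DB t x v w.
Proof.
move=> t0; apply: (is_derive_unique (dBx x (k *: v) w t0)).
by apply: (is_deriveE (scaled k (dBx x v w t0))) => // y; rewrite dotZr.
Qed.

Let DLZ (t : R) x v w k : 0 < t -> DL t x (k *: v) w = k ^+ 2 * DL t x v w.
Proof.
move=> t0; apply: (is_derive_unique (dLx x (k *: v) w t0)).
by apply: (is_deriveE (scaled (k ^+ 2) (dLx x v w t0))) => // y; rewrite dotZr dotZl; ring.
Qed.

(** Sorted by degree in v: the first term has degree 0, the bracket 1, [DB] 2 and [DL] 3. *)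
Let TE (t : R) x v : T t x v = psi x * dot x (B t x) +
  (L t x * psi x * dot x v - DA t x v) - DB t x v v - DL t x v v.
Proof. by rewrite /T /DA /DB /DL dotDr dotZr; lra. Qed.

Let TN (t : R) x v : 0 < t -> T t x (- v) = psi x * dot x (B t x) -
  (L t x * psi x * dot x v - DA t x v) - DB t x v v + DL t x v v.
Proof.
move=> t0; rewrite TE -scaleN1r DBZ// DLZ// dotZr /DA /DB /DL !DxZ//; lra.
Qed.

Let dAt (t : R) x : 0 < t -> is_derive t 1 (fun s => A s x) (psi x * dot x (B t x)).
Proof.
move=> t0; apply: (is_derive_gt0_ext t0 (fun s s0 => AE x s0)).
apply: (is_deriveE (dgt x 0 t0)) => //.
by rewrite TE /DB /DL oppr0 dot0r /DA !Dx0//; lra.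
Qed.

Let dBt0 (t : R) x v : 0 < t -> is_derive t 1 (fun s => dot (B s x) v)
  (L t x * psi x * dot x v - DA t x v - DL t x v v).
Proof.
move=> t0; apply: (is_derive_gt0_ext t0 (fun s s0 => BE x v s0)).
apply: (is_deriveE (odd_part (dgt x v t0) (dgt x (- v) t0))) => //.
by rewrite TN// TE; lra.
Qed.

Let dLt (t : R) x v : 0 < t ->
  is_derive t 1 (fun s => L s x * (dot v v / 2)) (- DB t x v v).
Proof.
move=> t0; apply: (is_derive_gt0_ext t0 (fun s s0 => LE x v s0)).
apply: (is_deriveE (even_part (dgt x v t0) (dgt x (- v) t0) (dgt x 0 t0))) => //.
rewrite TN// TE (TE t x 0) /DB /DL /DA oppr0 dot0r.
by rewrite !Dx0//; lra.
Qed.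

(** The time derivative of B . v is linear in v while [DL t x v v] is cubic; comparing v with 2 v
    removes the latter. *)
Let DL0 (t : R) x v : 0 < t -> DL t x v v = 0.
Proof.
move=> t0; have h1 := dBt0 x (2 *: v) t0.
have h2 := is_deriveE (scaled 2 (dBt0 x v t0)) (fun s => dotZr 2 (B s x) v) erefl.
have := is_derive_unique h1 h2; rewrite DLZ// /DA /DL !DxZ// dotZr.
by lra.
Qed.

Let lam (t : R) := L t 0.

Let LlamE (t : R) x : 0 < t -> L t x = lam t.
Proof.
move=> t0; apply: eq_const_of_derive0 => y v.
have [->|v0] := eqVneq v 0; first exact: is_derive0.
have vv : dot v v != 0 by rewrite dot_eq0.
apply: (is_deriveE (scaled (2 / dot v v) (dLx y v v t0))).
  by move=> z; field; exact: vv.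
by rewrite DL0// mulr0.
Qed.

Let kap (t : R) := DB t 0 (delta_mx 0 0) (delta_mx 0 0).

Let dlam (t : R) : 0 < t -> is_derive t 1 lam (- (2 * kap t)).
Proof.
move=> t0; apply: (is_deriveE (scaled 2 (dLt 0 (delta_mx 0 0) t0))).
  by move=> s; rewrite dot_delta delta_mxE eqxx mulr1n mul1r mulrC mulfVK ?pnatr_eq0.
by rewrite /kap; ring.
Qed.

(** Since L depends on t alone, so does its time derivative; hence the symmetric gradient of B is
    [kap] times the identity. *)
Let DB_kap (t : R) x v : 0 < t -> DB t x v v = kap t * dot v v.
Proof.
move=> t0; have h1 := dLt x v t0.
have h2 : is_derive t 1 (fun s => L s x * (dot v v / 2)) (dot v v / 2 * - (2 * kap t)).
  apply: (is_derive_gt0_ext t0 _ (scaled (dot v v / 2) (dlam t0))) => s s0.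
  by rewrite LlamE// mulrC.
by have := is_derive_unique h1 h2; lra.
Qed.

(** Without its dilation part, B has skew gradient: it is an infinitesimal rigid motion. *)
Let C (t : R) x := B t x - kap t *: x.

Let C_line (t : R) x v : 0 < t -> dot (C t (x + v)) v = dot (C t x) v.
Proof.
move=> t0; have := @is_derive_0_is_cst R (fun s : R => dot (C t (x + s *: v)) v) 1 0.
rewrite scale1r scale0r addr0; apply => s.
apply: (is_derive_line (f := fun y => dot (C t y) v)).
have h1 := dBx (x + s *: v) v v t0.
have h2 := scaled (kap t) (is_derive_dot (x + s *: v) v v).
apply: (is_deriveE (is_deriveB h1 h2)) => [y|]; first by rewrite /= dotBl dotZl (dotC y).
by rewrite DB_kap// subrr.
Qed.

Let om (t : R) := rotation_vector (B t).

Let B_affine (t : R) x : 0 < t -> B t x = B t 0 + kap t *: x + cross (om t) x.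
Proof.
move=> t0; have := skew_increments (fun x v => C_line x v t0) x.
have -> : rotation_vector (C t) = om t.
  rewrite /om /rotation_vector /C; apply: cV3P; rewrite !mxE /= ?oppr0 ?mulr0 ?mulr1; lra.
rewrite /C scaler0 subr0 => /eqP; rewrite subr_eq => /eqP ->.
by rewrite addrAC.
Qed.

Let Bt (t : R) x v := lam t * psi x * dot x v - DA t x v.

Let dBt (t : R) x v : 0 < t -> is_derive t 1 (fun s => dot (B s x) v) (Bt t x v).
Proof.
by move=> t0; apply: (is_deriveE (dBt0 x v t0)) => //; rewrite DL0// subr0 LlamE.
Qed.

(** [b1], [kap1] and [om1] are the time derivatives of B t 0, [kap] and [om], read off from [Bt] at
    0 and at unit vectors. *)
Let b1 (t : R) : 'cV[R]_3 := \col_i Bt t 0 (delta_mx i 0).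
Let kap1 (t : R) := Bt t (delta_mx 0 0) (delta_mx 0 0) - Bt t 0 (delta_mx 0 0).
Let om1 (t : R) : 'cV[R]_3 := \col_i
  [:: Bt t (delta_mx 1 0) (delta_mx 2 0) - Bt t 0 (delta_mx 2 0);
      Bt t (delta_mx 2 0) (delta_mx 0 0) - Bt t 0 (delta_mx 0 0);
      Bt t (delta_mx 0 0) (delta_mx 1 0) - Bt t 0 (delta_mx 1 0)]`_i.

Let db1 (t : R) i : 0 < t -> is_derive t 1 (fun s => B s 0 i 0) (b1 t i 0).
Proof.
move=> t0; apply: (is_deriveE (dBt 0 (delta_mx i 0) t0)).
  by move=> s; rewrite dot_delta.
by rewrite mxE.
Qed.

Let dkap1 (t : R) : 0 < t -> is_derive t 1 kap (kap1 t).
Proof.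
move=> t0; apply: (is_derive_gt0_ext t0 _
  (is_deriveB (dBt (delta_mx 0 0) (delta_mx 0 0) t0) (dBt 0 (delta_mx 0 0) t0))).
move=> s s0; rewrite /= !fctE (B_affine (delta_mx 0 0) s0) !dotDl dotZl.
by rewrite !dot_delta delta_mxE /cross !mxE /=; lra.
Qed.

Let dom1 (t : R) i : 0 < t -> is_derive t 1 (fun s => om s i 0) (om1 t i 0).
Proof.
move=> t0; case: i => -[|[|[|//]]] i.
- rewrite (_ : Ordinal i = 0); last exact: val_inj.
  apply: (is_deriveE (is_deriveB (dBt (delta_mx 1 0) (delta_mx 2 0) t0) (dBt 0 (delta_mx 2 0) t0))).
    by move=> s; rewrite !fctE !dot_delta /om /rotation_vector !mxE.
  by rewrite mxE.
- rewrite (_ : Ordinal i = 1); last exact: val_inj.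
  apply: (is_deriveE (is_deriveB (dBt (delta_mx 2 0) (delta_mx 0 0) t0) (dBt 0 (delta_mx 0 0) t0))).
    by move=> s; rewrite !fctE !dot_delta /om /rotation_vector !mxE.
  by rewrite mxE.
- rewrite (_ : Ordinal i = 2); last exact: val_inj.
  apply: (is_deriveE (is_deriveB (dBt (delta_mx 0 0) (delta_mx 1 0) t0) (dBt 0 (delta_mx 1 0) t0))).
    by move=> s; rewrite !fctE !dot_delta /om /rotation_vector !mxE.
  by rewrite mxE.
Qed.

Let BtE (t : R) x v : 0 < t ->
  Bt t x v = dot (b1 t) v + kap1 t * dot x v + dot (cross (om1 t) x) v.
Proof.
move=> t0; apply: (is_derive_unique (dBt x v t0)).
have db i := scaled (v i 0) (db1 i t0).
have dk := scaled (dot x v) (dkap1 t0).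
have do0 := scaled (x 1 0 * v 2 0 - x 2 0 * v 1 0) (dom1 0 t0).
have do1 := scaled (x 2 0 * v 0 0 - x 0 0 * v 2 0) (dom1 1 t0).
have do2 := scaled (x 0 0 * v 1 0 - x 1 0 * v 0 0) (dom1 2 t0).
have D := is_deriveD (is_deriveD (is_deriveD (is_deriveD (db 0) (db 1)) (db 2)) dk)
  (is_deriveD (is_deriveD do0 do1) do2).
have crossE w : dot (cross w x) v = (x 1 0 * v 2 0 - x 2 0 * v 1 0) * w 0 0 +
    (x 2 0 * v 0 0 - x 0 0 * v 2 0) * w 1 0 + (x 0 0 * v 1 0 - x 1 0 * v 0 0) * w 2 0.
  by rewrite (dotE (cross w x)) /cross !mxE /=; ring.
apply: (is_derive_gt0_ext t0 _ (is_deriveE D (fun=> erefl) _)).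
  by move=> s s0; rewrite B_affine// !dotDl dotZl crossE !fctE (dotE (B s 0)); ring.
by rewrite crossE (dotE (b1 t)); ring.
Qed.

(** By the formula for [Bt], the derivative of H is that of a pure rotation, which vanishes along
    rays. So H is constant, and then the rotation is zero. This replaces the symmetry of second
    derivatives of A, which need not exist. *)
Let H (t : R) x := A t x - lam t * Phi x + dot (b1 t) x + kap1 t * (dot x x / 2).

Let dH (t : R) x v : 0 < t -> is_derive x v (H t) (- dot (cross (om1 t) x) v).
Proof.
move=> t0; apply: (is_deriveE (is_deriveD (is_deriveD (is_deriveB (dAx x v t0)
  (scaled (lam t) (dPhi x v))) (is_derive_dot x v (b1 t)))
  (scaled (kap1 t) (is_derive_sqr x v)))) => //.
by have := BtE x v t0; rewrite /Bt; lra.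
Qed.

Let H_const (t : R) x : 0 < t -> H t x = H t 0.
Proof.
move=> t0; have := @is_derive_0_is_cst R (fun s : R => H t (0 + s *: x)) 1 0.
rewrite scale1r scale0r add0r addr0; apply => s.
apply: (is_derive_line (f := H t)).
apply: (is_deriveE (dH (0 + s *: x) x t0)) => //.
by rewrite add0r [dot _ _](_ : _ = 0) ?oppr0// (dotE (cross _ _)) /cross !mxE /=; ring.
Qed.

Let om1_0 (t : R) : 0 < t -> om1 t = 0.
Proof.
move=> t0; apply: cross_eq0 => x v.
have h : is_derive x v (H t) 0.
  apply: (is_deriveE (is_derive_cst (H t 0) x v)) => // y; exact: H_const.
by have := is_derive_unique (dH x v t0) h; lra.
Qed.

Let A_formula (t : R) x : 0 < t -> A t x = A t 0 + lam t * (Phi x - Phi 0) -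
  dot (b1 t) x - kap1 t * (dot x x / 2).
Proof.
by move=> t0; have := H_const x t0; rewrite /H !dot0r; lra.
Qed.

Let x_B (t : R) x : 0 < t -> dot x (B t x) = dot x (B t 0) + kap t * dot x x.
Proof.
move=> t0; rewrite B_affine// !dotDr dotZr [dot x (cross _ _)](_ : _ = 0) ?addr0//.
by rewrite (dotE x (cross _ _)) /cross !mxE /=; ring.
Qed.

(** The even part of A in x makes [E x s] quadratic in x at each time, so its time derivative -2 kap
    [virial x] is quadratic too. Differentiating the definition of E through A avoids a second
    derivative of [kap]. *)
Let kap0 (t : R) : 0 < t -> kap t = 0.
Proof.
move=> t0; pose E x s := 2 * A s 0 + 2 * (Phi x - Phi 0) * lam s - A s x - A s (- x).
have EE x s : 0 < s -> E x s = kap1 s * dot x x.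
  move=> s0; rewrite /E (A_formula x s0) (A_formula (- x) s0) PhiN !dotNr dotNl; lra.
have dE x : is_derive t 1 (E x) (- (2 * kap t) * virial x).
  have D := is_deriveB (is_deriveB (is_deriveD (scaled 2 (dAt 0 t0))
    (scaled (2 * (Phi x - Phi 0)) (dlam t0))) (dAt x t0)) (dAt (- x) t0).
  apply: (is_deriveE D) => //; rewrite dot0l psiN !x_B// !dotNl dotNr /virial; lra.
have [u [r ur]] := virial_not_quadratic.
have h : is_derive t 1 (E (r *: u)) (r ^+ 2 * (- (2 * kap t) * virial u)).
  apply: (is_derive_gt0_ext t0 _ (scaled (r ^+ 2) (dE u))) => s s0.
  by rewrite !EE// dotZl dotZr; ring.
have := is_derive_unique (dE (r *: u)) h => /eqP.
rewrite -subr_eq0 (_ : _ - _ = - (2 * kap t) * (virial (r *: u) - r ^+ 2 * virial u)); last by ring.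
rewrite mulf_eq0 oppr_eq0 mulf_eq0 pnatr_eq0 /= subr_eq0 (negbTE ur) orbF.
by move=> /eqP.
Qed.

(** The odd part of A in x is linear in x, and so is its time derivative, a multiple of psi x (x .
    u) with u = B t 0. Along the ray of u this contradicts [psi_not_const]. *)
Let B0 (t : R) : 0 < t -> B t 0 = 0.
Proof.
move=> t0; apply/eqP; apply: contrapT => /negP u0.
set u := B t 0 in u0 *.
pose O x s := A s (- x) - A s x.
have OE x s : 0 < s -> O x s = 2 * dot (b1 s) x.
  move=> s0; rewrite /O (A_formula x s0) (A_formula (- x) s0) PhiN !dotNr dotNl; lra.
have dO x : is_derive t 1 (O x) (- (2 * psi x * dot x u)).
  have D := is_deriveB (dAt (- x) t0) (dAt x t0).
  apply: (is_deriveE D) => //; rewrite psiN !x_B// !dotNl dotNr -/u; lra.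
have [r r0 ru] := psi_not_const u0.
have h : is_derive t 1 (O (r *: u)) (r * - (2 * psi u * dot u u)).
  apply: (is_derive_gt0_ext t0 _ (scaled r (dO u))) => s s0.
  by rewrite !OE// dotZr; ring.
have := is_derive_unique (dO (r *: u)) h; rewrite dotZl => /eqP.
rewrite -subr_eq0 (_ : _ - _ = - (2 * (r * dot u u)) * (psi (r *: u) - psi u)); last by ring.
by rewrite mulf_eq0 oppr_eq0 !mulf_eq0 pnatr_eq0 /= subr_eq0 (negbTE ru) (negbTE r0) dot_eq0 (negbTE u0).
Qed.

(** Once B t 0 and [kap] vanish at all positive times, so do their derivatives [b1] and [kap1]; what
    remains, namely [lam], [om] and A t 0, is constant in time. *)
Theorem transport_rigidity : exists a l w, forall (t : R) x v, 0 < t ->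
  g t x v = a + l * (Phi x + dot v v / 2) + dot (cross w x) v.
Proof.
have lamE (t : R) : 0 < t -> lam t = lam 1.
  apply: eq_const_of_derive0_gt0 => s s0.
  by apply: (is_deriveE (dlam s0)) => //; rewrite kap0// mulr0 oppr0.
have omE (t : R) : 0 < t -> om t = om 1.
  move=> t0; apply/matrixP => i j; rewrite ord1.
  apply: (@eq_const_of_derive0_gt0 _ (fun s => om s i 0)) => // s s0.
  by apply: (is_deriveE (dom1 i s0)) => //; rewrite om1_0// mxE.
have AE0 (t : R) : 0 < t -> A t 0 = A 1 0.
  apply: (@eq_const_of_derive0_gt0 _ (fun s => A s 0)) => s s0.
  by apply: (is_deriveE (dAt 0 s0)) => //; rewrite dot0l mulr0.
have b10 (t : R) : 0 < t -> b1 t = 0.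
  move=> t0; apply/matrixP => i j; rewrite ord1 [RHS]mxE.
  apply: (is_derive_unique (db1 i t0)).
  apply: (is_derive_gt0_ext t0 _ (is_derive_cst (0 : R) t 1)) => s s0.
  by rewrite B0// mxE.
have kap10 (t : R) : 0 < t -> kap1 t = 0.
  move=> t0; apply: (is_derive_unique (dkap1 t0)).
  apply: (is_derive_gt0_ext t0 _ (is_derive_cst (0 : R) t 1)) => s s0.
  by rewrite kap0.
exists (A 1 0 - lam 1 * Phi 0), (lam 1), (om 1) => t x v t0.
rewrite gE// A_formula// AE0// LlamE// lamE// b10// kap10// dot0l.
rewrite B_affine// B0// kap0// scale0r !add0r omE//; ring.
Qed.

End transport_rigidity.

(** * Potentials *)

Section radial_potentials.
Context {R : realType}.
Implicit Types (x v : 'cV[R]_3) (p : R).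

Lemma differentiable_sqr x : differentiable (fun y : 'cV[R]_3 => dot y y) x.
Proof.
have -> : (fun y : 'cV[R]_3 => dot y y) = (fun y => y 0 0) * (fun y => y 0 0) +
    (fun y => y 1 0) * (fun y => y 1 0) + (fun y => y 2 0) * (fun y => y 2 0).
  by apply/funext => y; exact: dotE.
by apply: differentiableD; [apply: differentiableD|]; apply: differentiableM;
  exact: differentiable_coord.
Qed.

Section composition.
Variables q dq : R -> R.
Hypothesis dqE : forall u : R, 0 <= u -> is_derive u 1 q (dq u).

Lemma differentiable_radial x : differentiable (fun y : 'cV[R]_3 => q (dot y y)) x.
Proof.
apply: (differentiable_comp (f := fun y : 'cV[R]_3 => dot y y) (g := q)).
  exact: differentiable_sqr.
by apply/derivable1_diffP; apply: ex_derive; apply: dqE; exact: dot_ge0.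
Qed.

Lemma is_derive_radial x v :
  is_derive x v (fun y : 'cV[R]_3 => q (dot y y)) (2 * dq (dot x x) * dot x v).
Proof.
have dN := differentiable_sqr x.
have dq1 := dqE (dot_ge0 x).
have dqd : differentiable q (dot x x) by apply/derivable1_diffP; exact: ex_derive.
have := differentiable_is_derive v (differentiable_radial x).
rewrite (diff_comp (f := fun y : 'cV[R]_3 => dot y y) (g := q))//= diff1E//.
have -> : 'd (fun y : 'cV[R]_3 => dot y y) x v = 2 * dot x v.
  apply: (is_derive_unique (differentiable_is_derive v dN)).
  have := is_deriveZ 2 (is_derive_sqr x v).
  by congr (is_derive _ _ _ _); apply/funext => y /=; rewrite /GRing.scale /=; field.
rewrite derive1E (@derive_val _ _ _ _ _ _ _ dq1).
by congr (is_derive _ _ _ _); rewrite /GRing.scale /=; ring.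
Qed.

Lemma grad_radial x :
  grad (fun y : 'cV[R]_3 => q (dot y y)) x = (2 * dq (dot x x)) *: x.
Proof.
apply/matrixP => i j; rewrite ord1 !mxE.
by rewrite (@derive_val _ _ _ _ _ _ _ (is_derive_radial x (delta_mx i 0))) dot_delta.
Qed.

End composition.

Lemma enorm_powR x p : enorm x `^ p = dot x x `^ (p / 2).
Proof. by rewrite /enorm -powR12_sqrt ?dot_ge0// -powRrM mulrC. Qed.

Lemma japanese_powR x p : japanese x `^ p = (1 + dot x x) `^ (p / 2).
Proof.
by rewrite /japanese enorm_sqr -powR12_sqrt -?powRrM 1?mulrC// addr_ge0// dot_ge0.
Qed.

Lemma powR_inj_exp (a x y : R) : a != 0 -> 0 < x -> 0 < y ->
  x `^ a = y `^ a -> x = y.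
Proof.
move=> a0 x0 y0 /(congr1 (@ln R)); rewrite !ln_powR => /(mulfI a0).
by move=> /(congr1 (@expR R)); rewrite !lnK.
Qed.

Lemma powR_unbounded (a K : R) : 0 < a -> exists2 y, 2 <= y & K < y `^ a.
Proof.
move=> a0; pose m := Num.max 1 (K / a); exists (expR m).
  apply: le_trans (expR_ge1Dx m); have : 1 <= m by rewrite le_max lexx.
  by lra.
have -> : expR m `^ a = expR (a * m).
  by rewrite -[expR m `^ a]lnK ?posrE ?powR_gt0 ?expR_gt0// ln_powR expRK.
apply: lt_le_trans (expR_ge1Dx _).
have : K <= a * m by rewrite mulrC -ler_pdivrMr// le_max lexx orbT.
by lra.
Qed.

Definition psi_gt2 p x : R := dot x x `^ (p / 2 - 1).

(** The absolute value serves the two-sided derivative at u = 0, the boundary point of the range of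
    |x|^2. *)
Let q_gt2 p (u : R) := `|u| `^ (p / 2) / p.

Lemma potential_gt2E p x : potential_gt2 p x = q_gt2 p (dot x x).
Proof. by rewrite /potential_gt2 enorm_powR /q_gt2 ger0_norm// dot_ge0. Qed.

Let dq_gt2 p (u : R) : 2 < p -> 0 <= u ->
  is_derive u 1 (q_gt2 p) (u `^ (p / 2 - 1) / 2).
Proof.
move=> p2; rewrite le_eqVlt => /orP[/eqP <-|u0].
  rewrite powR0 ?mul0r; last by lra.
  apply: is_derive_cvg; rewrite /q_gt2 normr0 powR0 ?mul0r; last by lra.
  have a0 : 0 < p / 2 - 1 by lra.
  apply/cvgr0Pnorm_lt => e e0; near=> h.
  have h0 : h != 0 by near: h; exact: nbhs_dnbhs_neq.
  (* This radius r solves r^(p/2 - 1) = e p, where the exponent is positive since p > 2. *)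
  have hd : `|h| < (e * p) `^ (p / 2 - 1)^-1.
    near: h; apply: dnbhs0_lt; rewrite powR_gt0// mulr_gt0//; lra.
  rewrite [h *: 1]mulr1 addr0 subr0.
  have -> : `|h| `^ (p / 2) = `|h| * `|h| `^ (p / 2 - 1).
    by rewrite mulr_powRB1//; lra.
  rewrite !normrM normfV normr_id (ger0_norm (powR_ge0 _ _)) (ger0_norm (_ : 0 <= p^-1)); last first.
    by rewrite invr_ge0; lra.
  rewrite -mulrA mulKf ?normr_eq0// ltr_pdivrMr; last by lra.
  have := gt0_ltr_powR a0; move=> /(_ `|h| ((e * p) `^ (p / 2 - 1)^-1)).
  rewrite !nnegrE normr_ge0 powR_ge0 -powRrM mulVf ?gt_eqF// powRr1; last first.
    by rewrite mulr_ge0//; lra.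
  exact.
have h : is_derive u 1 (fun s : R => p^-1 * s `^ (p / 2)) (u `^ (p / 2 - 1) / 2).
  have := is_deriveZ p^-1 (is_derive1_powR (p / 2) u0).
  congr (is_derive _ _ _ _); rewrite /GRing.scale /=.
  have p0 : p != 0 by lra.
  by field.
apply: near_eq_is_derive h; have := near_gt0 u0; apply: filterS => s s0.
by rewrite /q_gt2 gtr0_norm// mulrC.
Unshelve. all: by end_near. Qed.

Let potential_gt2_fun p : potential_gt2 p = fun x => q_gt2 p (dot x x).
Proof. by apply/funext => x; exact: potential_gt2E. Qed.

Lemma differentiable_potential_gt2 p x : 2 < p -> differentiable (potential_gt2 p) x.
Proof.
move=> p2; rewrite potential_gt2_fun; apply: differentiable_radial => u.
by move=> u0; exact: dq_gt2.
Qed.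

Lemma is_derive_potential_gt2 p x v : 2 < p ->
  is_derive x v (potential_gt2 p) (psi_gt2 p x * dot x v).
Proof.
move=> p2; rewrite potential_gt2_fun.
have := is_derive_radial (fun u => @dq_gt2 p u p2) x v.
by congr (is_derive _ _ _ _); rewrite /psi_gt2; field.
Qed.

Lemma grad_potential_gt2 p x : 2 < p -> grad (potential_gt2 p) x = psi_gt2 p x *: x.
Proof.
move=> p2; rewrite potential_gt2_fun (grad_radial (fun u => @dq_gt2 p u p2)).
by rewrite /psi_gt2 mulrC mulfVK ?pnatr_eq0.
Qed.

Lemma potential_gt2N p x : potential_gt2 p (- x) = potential_gt2 p x.
Proof. by rewrite /potential_gt2 enormN. Qed.

Lemma psi_gt2N p x : psi_gt2 p (- x) = psi_gt2 p x.
Proof. by rewrite /psi_gt2 dotNl dotNr opprK. Qed.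

Lemma potential_gt2_ge0 p x : 2 < p -> 0 <= potential_gt2 p x.
Proof. by move=> p2; rewrite mulr_ge0 ?powR_ge0// invr_ge0; lra. Qed.

Lemma psi_gt2_not_const p u : 2 < p -> u != 0 ->
  exists2 r, r != 0 & psi_gt2 p (r *: u) != psi_gt2 p u.
Proof.
move=> p2 u0; have uu : 0 < dot u u by rewrite lt0r dot_eq0 u0 dot_ge0.
exists 2; first by rewrite pnatr_eq0.
apply/eqP; rewrite /psi_gt2 dotZl dotZr => /powR_inj_exp.
have a0 : p / 2 - 1 != 0 by lra.
by move=> /(_ a0); rewrite !mulr_gt0// => /(_ isT uu); lra.
Qed.

Lemma virial_gt2_not_quadratic p : 2 < p -> exists (u : 'cV[R]_3) r,
  2 * (potential_gt2 p (r *: u) - potential_gt2 p 0) +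
    psi_gt2 p (r *: u) * dot (r *: u) (r *: u) !=
  r ^+ 2 * (2 * (potential_gt2 p u - potential_gt2 p 0) + psi_gt2 p u * dot u u).
Proof.
(* The virial is homogeneous of degree p, so doubling multiplies it by 2^p rather than 4. *)
move=> p2; exists (delta_mx 0 0), 2.
have ee : dot (delta_mx 0 0 : 'cV[R]_3) (delta_mx 0 0) = 1.
  by rewrite dot_delta delta_mxE eqxx.
rewrite !potential_gt2E /psi_gt2 /q_gt2 !dotZl !dotZr ee dot0l !mulr1 normr0 normr1.
rewrite !powR1 powR0 ?mul0r ?subr0; last by lra.
have n4 : 2 * 2 = 4 :> R by ring.
rewrite n4 ger0_norm// [X in _ + X]mulrC mulr_powRB1//; last by lra.
have p0 : p != 0 by lra.
have -> : 2 * (4 `^ (p / 2) / p) + 4 `^ (p / 2) = 4 `^ (p / 2) * (2 / p + 1) :> R by field.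
have -> : 2 ^+ 2 * (2 * (1 / p) + 1) = 4 * (2 / p + 1) :> R by field.
rewrite -subr_eq0 -mulrBl mulf_neq0//; last first.
  have : 0 < 2 / p by rewrite divr_gt0//; lra.
  by lra.
rewrite subr_eq0; apply/eqP => h.
have a0 : p / 2 - 1 != 0 by lra.
have : 4 `^ (p / 2 - 1) = 1 `^ (p / 2 - 1) :> R.
  rewrite powR1; apply: (@mulfI _ 4); first by lra.
  by rewrite mulr_powRB1 ?mulr1//; lra.
by move=> /(powR_inj_exp a0); lra.
Qed.

(** Growth faster than quadratic lets the potential absorb a rotation of any speed. Beyond the
    threshold [y] one has |K| p < u^(p/2 - 1); below it the constant takes over. *)
Lemma potential_gt2_growth p (K : R) : 2 < p ->
  exists C, forall x, K * dot x x <= potential_gt2 p x + C.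
Proof.
move=> p2; have a0 : 0 < p / 2 - 1 by lra.
have [y y2 yK] := powR_unbounded (`|K| * p) a0.
exists (`|K| * y) => x; rewrite potential_gt2E /q_gt2 ger0_norm ?dot_ge0//.
have u0 := dot_ge0 x; move: (dot x x) u0 => u u0.
have K1 := ler_norm K; have K0 := normr_ge0 K.
have [uy|yu] := leP u y.
  have : 0 <= u `^ (p / 2) / p by rewrite mulr_ge0 ?powR_ge0// invr_ge0; lra.
  have : K * u <= `|K| * y by apply: le_trans (ler_wpM2r u0 K1) _; exact: ler_wpM2l.
  by lra.
have : `|K| * u <= u `^ (p / 2) / p.
  rewrite ler_pdivlMr; last by lra.
  rewrite -(mulr_powRB1 u0); last by lra.
  rewrite mulrAC [leLHS]mulrC ler_wpM2l//; apply: le_trans (ltW yK) _.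
  by apply: ge0_ler_powR; rewrite ?nnegrE//; lra.
have : K * u <= `|K| * u by exact: ler_wpM2r.
have : 0 <= `|K| * y by rewrite mulr_ge0//; lra.
by lra.
Qed.

Definition psi_lt2 p x : R := (1 + dot x x) `^ (p / 2 - 1).

Let q_lt2 p (u : R) := (1 + u) `^ (p / 2) / p.

Lemma potential_lt2E p x : potential_lt2 p x = q_lt2 p (dot x x).
Proof. by rewrite /potential_lt2 japanese_powR. Qed.

Let dq_lt2 p (u : R) : 0 < p -> 0 <= u ->
  is_derive u 1 (q_lt2 p) ((1 + u) `^ (p / 2 - 1) / 2).
Proof.
move=> p0 u0; have u1 : 0 < 1 + u by lra.
have d1 : is_derive u (1 : R) (fun s : R => 1 + s) 1.
  by apply: is_derive_eq (is_deriveD _ _) _; rewrite ?add0r.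
have := is_deriveZ p^-1 (is_derive1_comp (is_derive1_powR (p / 2) u1) d1).
have p0' : p != 0 by lra.
have -> : q_lt2 p = p^-1 \*: (powR (R:=R) ^~ (p / 2) \o +%R 1).
  by apply/funext => s; exact: mulrC.
by move=> h; apply: is_derive_eq h _; rewrite /GRing.scale /=; field.
Qed.

Let potential_lt2_fun p : potential_lt2 p = fun x => q_lt2 p (dot x x).
Proof. by apply/funext => x; exact: potential_lt2E. Qed.

Lemma differentiable_potential_lt2 p x : 0 < p -> differentiable (potential_lt2 p) x.
Proof.
move=> p2; rewrite potential_lt2_fun; apply: differentiable_radial => u.
by move=> u0; exact: dq_lt2.
Qed.

Lemma is_derive_potential_lt2 p x v : 0 < p ->
  is_derive x v (potential_lt2 p) (psi_lt2 p x * dot x v).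
Proof.
move=> p2; rewrite potential_lt2_fun.
have := is_derive_radial (fun u => @dq_lt2 p u p2) x v.
by congr (is_derive _ _ _ _); rewrite /psi_lt2; field.
Qed.

Lemma grad_potential_lt2 p x : 0 < p -> grad (potential_lt2 p) x = psi_lt2 p x *: x.
Proof.
move=> p2; rewrite potential_lt2_fun (grad_radial (fun u => @dq_lt2 p u p2)).
by rewrite /psi_lt2 mulrC mulfVK ?pnatr_eq0.
Qed.

Lemma potential_lt2N p x : potential_lt2 p (- x) = potential_lt2 p x.
Proof. by rewrite /potential_lt2 /japanese enormN. Qed.

Lemma psi_lt2N p x : psi_lt2 p (- x) = psi_lt2 p x.
Proof. by rewrite /psi_lt2 dotNl dotNr opprK. Qed.

Lemma potential_lt2_ge0 p x : 0 < p -> 0 <= potential_lt2 p x.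
Proof. by move=> p2; rewrite mulr_ge0 ?powR_ge0// invr_ge0; lra. Qed.

Lemma psi_lt2_not_const p u : p < 2 -> u != 0 ->
  exists2 r, r != 0 & psi_lt2 p (r *: u) != psi_lt2 p u.
Proof.
move=> p2 u0; have uu : 0 < dot u u by rewrite lt0r dot_eq0 u0 dot_ge0.
exists 2; first by rewrite pnatr_eq0.
apply/eqP; rewrite /psi_lt2 dotZl dotZr => /powR_inj_exp.
have a0 : p / 2 - 1 != 0 by lra.
by move=> /(_ a0); rewrite !addr_gt0 ?mulr_gt0// => /(_ isT isT); lra.
Qed.

Lemma virial_lt2_not_quadratic p : 0 < p < 2 -> exists (u : 'cV[R]_3) r,
  2 * (potential_lt2 p (r *: u) - potential_lt2 p 0) +
    psi_lt2 p (r *: u) * dot (r *: u) (r *: u) !=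
  r ^+ 2 * (2 * (potential_lt2 p u - potential_lt2 p 0) + psi_lt2 p u * dot u u).
Proof.
move=> /andP[p0 p2]; exists (delta_mx 0 0).
have ee : dot (delta_mx 0 0 : 'cV[R]_3) (delta_mx 0 0) = 1.
  by rewrite dot_delta delta_mxE eqxx.
rewrite [potential_lt2 p (delta_mx 0 0)]potential_lt2E [potential_lt2 p 0]potential_lt2E.
rewrite [psi_lt2 p (delta_mx 0 0)]/psi_lt2 /q_lt2 ee dot0l addr0 powR1.
set c := 2 * _ + _ * 1.
have c0 : 0 < c.
  have : 0 < (1 + 1 : R) `^ (p / 2 - 1) by rewrite powR_gt0.
  have : 1 <= (1 + 1 : R) `^ (p / 2).
    have p20 : 0 <= p / 2 by lra.
    have := ge0_ler_powR p20; move=> /(_ 1 (1 + 1)); rewrite powR1; apply;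
      by rewrite ?nnegrE//; lra.
  have pV : 0 < p^-1 by rewrite invr_gt0.
  by rewrite /c -mulrBl; nra.
have a0 : 0 < 1 - p / 2 by lra.
(* With 1 + r^2 = y, the virial at r u is at most (2/p + 1) y^(p/2), of lower order than r^2. The
   threshold lets (y - 1) c exceed this, using y <= 2 (y - 1). *)
have [y y2 yK] := powR_unbounded (2 * (2 / p + 1) / c) a0.
exists (Num.sqrt (y - 1)); rewrite sqr_sqrtr; last by lra.
rewrite potential_lt2E /psi_lt2 /q_lt2 dotZl dotZr ee mulr1 -expr2 sqr_sqrtr; last by lra.
have -> : 1 + (y - 1) = y by ring.
apply/eqP => E.
have yy : y `^ (p / 2) * y `^ (1 - p / 2) = y.
  by rewrite -powRD ?(addrC (p / 2)) ?subrK ?powRr1//; [lra|apply/implyP => _; lra].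
have y0 : 0 < y `^ (p / 2) by rewrite powR_gt0//; lra.
have y1 : y `^ (p / 2 - 1) * (y - 1) <= y `^ (p / 2).
  rewrite -(@mulr_powRB1 _ y (p / 2)); [|lra|lra].
  by rewrite mulrC ler_wpM2r ?powR_ge0//; lra.
have bound : (y - 1) * c <= (2 / p + 1) * y `^ (p / 2).
  rewrite -E mulrBr.
  have : 0 <= 2 * (1 / p) by rewrite mulr_ge0// divr_ge0//; lra.
  have -> : (2 / p + 1) * y `^ (p / 2) = 2 * (y `^ (p / 2) / p) + y `^ (p / 2) by field; lra.
  by lra.
move: yK; rewrite ltr_pdivrMr// => yK.
have : y `^ (p / 2) * (2 * (2 / p + 1)) < y * c.
  by rewrite -[X in _ < X * c]yy -mulrA ltr_pM2l.
have : y * c <= 2 * ((y - 1) * c) by nra.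
by move: bound; rewrite [(2 / p + 1) * _]mulrC; lra.
Qed.

(** As <x> >= 1 and p > 1, one has |x| <= <x> <= <x>^p. *)
Lemma potential_lt2_growth p x : 1 < p -> enorm x <= p * potential_lt2 p x.
Proof.
move=> p1; rewrite /potential_lt2 mulrCA mulfV ?mulr1; last by lra.
have e0 := enorm_ge0 x.
have j1 : 1 <= japanese x.
  by rewrite /japanese -[leLHS]sqrtr1 ler_sqrt ?lerDl ?sqr_ge0// addr_ge0// sqr_ge0.
apply: (@le_trans _ _ (japanese x)); last exact: le1r_powR (ltW p1).
rewrite -ler_sqr ?nnegrE//; last by lra.
by rewrite /japanese [leRHS]sqr_sqrtr; [rewrite lerDr|rewrite addr_ge0// sqr_ge0].
Qed.

End radial_potentials.

(** * Integrability of Gibbs functions *)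

Section decay.
Context {R : realType}.
Local Open Scope ereal_scope.
Notation leb := (@lebesgue_measure R).

Lemma lebesgue_opp : mpres (fun x : measurableTypeR R => (- x)%R : measurableTypeR R) leb leb.
Proof.
split; first exact: measurableT_comp.
move=> A mA; have := @lebesgue_scale R (-1) _ A mA; rewrite normrN1 invr1 mul1e.
rewrite oppr_eq0 oner_eq0 => /(_ isT) <-; congr (leb _).
by apply/seteqP; split => x; rewrite /preimage /= mulN1r.
Qed.

Let mexp (d : R) : measurable_fun setT
  (fun x : measurableTypeR R => expR (- (d * `|x|)) : R).
Proof.
apply: measurableT_comp => //; apply: measurableT_comp => //.
by apply: measurable_funM => //; exact: measurableT_comp.
Qed.

Lemma integral_expR_abs_lty (d : R) : (0 < d)%R ->
  \int[leb]_x (expR (- (d * `|x|)))%:E < +oo.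
Proof.
move=> d0; have me : measurable_fun setT (exponential_pdf d : measurableTypeR R -> R).
  exact: measurable_exponential_pdf.
have me' : measurable_fun setT (fun x : measurableTypeR R => exponential_pdf d (- x)%R : R).
  exact: measurableT_comp me _.
have e0 x : (0 <= exponential_pdf d x)%R by rewrite exponential_pdf_ge0// ltW.
have Ie' : \int[leb]_x (exponential_pdf d (- x)%R)%:E = 1.
  rewrite -(integral_exponential_pdf d0).
  have := @mpres_ge0_integral R _ _ _ _ _ leb leb
    (fun x : measurableTypeR R => (exponential_pdf d x)%:E) lebesgue_opp.
  by apply=> [|x]; [exact/measurable_EFinP|rewrite lee_fin].
apply: (@le_lt_trans _ _ (\int[leb]_x ((d^-1)%:E *
    ((exponential_pdf d x)%:E + (exponential_pdf d (- x)%R)%:E)))).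
  apply: ge0_le_integral => //.
  - apply/measurable_EFinP; exact: mexp.
  - apply: emeasurable_funM => //; apply: emeasurable_funD; exact/measurable_EFinP.
  - move=> x _; rewrite -EFinD -EFinM lee_fin [leRHS]mulrC ler_pdivlMr// [leLHS]mulrC.
    have [x0|x0] := leP 0%R x.
      rewrite -[leLHS]addr0 lerD//.
      by rewrite exponential_pdfE// /exponential_pdf ger0_norm// mulNr.
    rewrite -[leLHS]add0r lerD//.
    have nx : (0 <= - x)%R by rewrite oppr_ge0 ltW.
    by rewrite (exponential_pdfE _ nx) (ltr0_norm x0) mulNr.
rewrite ge0_integralZl//; last 3 first.
- by apply: emeasurable_funD; exact/measurable_EFinP.
- by move=> x _; rewrite adde_ge0// lee_fin.
- by rewrite lee_fin invr_ge0 ltW.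
rewrite ge0_integralD//; last 4 first.
- by move=> x _; rewrite lee_fin.
- exact/measurable_EFinP.
- by move=> x _; rewrite lee_fin.
- exact/measurable_EFinP.
by rewrite integral_exponential_pdf// Ie' -EFinD -EFinM ltry.
Qed.

Lemma integral_mprod_lty d1 d2 (T1 : measurableType d1) (T2 : measurableType d2)
    (m1 : {sigma_finite_measure set T1 -> \bar R})
    (m2 : {sigma_finite_measure set T2 -> \bar R}) (f : T1 -> R) (g : T2 -> R) :
  measurable_fun setT f -> measurable_fun setT g ->
  (forall x, 0 <= f x)%R -> (forall x, 0 <= g x)%R ->
  \int[m1]_x (f x)%:E < +oo -> \int[m2]_x (g x)%:E < +oo ->
  \int[mprod m1 m2]_z (f z.1 * g z.2)%:E < +oo.
Proof.
move=> mf mg f0 g0 If Ig.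
have -> : \int[mprod m1 m2]_z (f z.1 * g z.2)%:E =
    \int[m1]_x fubini_F m2 (fun z => (f z.1 * g z.2)%:E) x.
  apply: fubini_tonelli1 => [|z]; last by rewrite lee_fin mulr_ge0.
  apply/measurable_EFinP; apply: measurable_funM; exact: measurableT_comp.
rewrite /fubini_F /=.
have -> : \int[m1]_x \int[m2]_y (f x * g y)%:E =
    \int[m1]_x ((f x)%:E * \int[m2]_y (g y)%:E).
  apply: eq_integral => x _; under eq_integral do rewrite EFinM.
  by rewrite ge0_integralZl//; [exact/measurable_EFinP|move=> y _; rewrite lee_fin|rewrite lee_fin].
rewrite ge0_integralZr//; last 3 first.
- exact/measurable_EFinP.
- by move=> x _; rewrite lee_fin.
- by apply: integral_ge0 => x _; rewrite lee_fin.
apply: lte_mul_pinfty => //; first by apply: integral_ge0 => x _; rewrite lee_fin.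
by rewrite ge0_fin_numE//; apply: integral_ge0 => x _; rewrite lee_fin.
Qed.

(** With the sum norm, an exponential factors into functions of one variable. *)
Definition l1norm (x : 'cV[R]_3) : R := (`|x 0 0| + `|x 1 0| + `|x 2 0|)%R.

Lemma measurable_l1norm :
  measurable_fun setT (fun y : coord3 R => l1norm (vec y) : R).
Proof.
by do 2?apply: measurable_funD; apply: measurableT_comp => //; exact: measurable_vec.
Qed.

Lemma integral_leb3_decay (d : R) : (0 < d)%R ->
  \int[leb3]_y (expR (- (d * l1norm (vec y))))%:E < +oo.
Proof.
move=> d0; have I1 := integral_expR_abs_lty d0.
have I2 := integral_mprod_lty (@mexp d) (@mexp d) (fun=> expR_ge0 _) (fun=> expR_ge0 _) I1 I1.
have m2 : measurable_fun setT (fun z : measurableTypeR R * measurableTypeR R =>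
    expR (- (d * `|z.1|)) * expR (- (d * `|z.2|)) : R)%R.
  apply: measurable_funM; first exact: measurableT_comp (@mexp d) measurable_fst.
  exact: measurableT_comp (@mexp d) measurable_snd.
have := integral_mprod_lty m2 (@mexp d)
  (fun=> mulr_ge0 (expR_ge0 _) (expR_ge0 _)) (fun=> expR_ge0 _) I2 I1.
apply: le_lt_trans; rewrite le_eqVlt; apply/orP; left; apply/eqP.
apply: eq_integral => y _; congr (_%:E).
by rewrite -!expRD /l1norm !mxE /=; congr expR; ring.
Qed.

Lemma integral_leb6_decay (d : R) : (0 < d)%R ->
  \int[leb6]_z (expR (- (d * (l1norm (vec z.1) + l1norm (vec z.2)))))%:E < +oo.
Proof.
move=> d0; have I1 := integral_leb3_decay d0.
have m1 : measurable_fun setT (fun y : coord3 R => expR (- (d * l1norm (vec y))) : R).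
  apply: measurableT_comp => //; apply: measurableT_comp => //.
  by apply: measurable_funM => //; exact: measurable_l1norm.
have := integral_mprod_lty m1 m1 (fun=> expR_ge0 _) (fun=> expR_ge0 _) I1 I1.
apply: le_lt_trans; rewrite le_eqVlt; apply/orP; left; apply/eqP.
apply: eq_integral => y _; congr (_%:E).
by rewrite -expRD; congr expR; ring.
Qed.

Lemma integral_decay_lty (E : 'cV[R]_3 -> 'cV[R]_3 -> R) (C d : R) : (0 < d)%R ->
  measurable_fun setT (fun z : coord3 R * coord3 R => E (vec z.1) (vec z.2) : R) ->
  (forall x v, E x v <= C - d * (l1norm x + l1norm v))%R ->
  \int[leb6]_z (expR (E (vec z.1) (vec z.2)))%:E < +oo.
Proof.
move=> d0 mE EC.
have md : measurable_fun setT (fun z : coord3 R * coord3 R =>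
    (expR (- (d * (l1norm (vec z.1) + l1norm (vec z.2)))))%:E).
  apply/measurable_EFinP; apply: measurableT_comp => //; apply: measurableT_comp => //.
  apply: measurable_funM => //; apply: measurable_funD.
    exact: measurableT_comp measurable_l1norm measurable_fst.
  exact: measurableT_comp measurable_l1norm measurable_snd.
apply: (@le_lt_trans _ _ (\int[leb6]_z ((expR C)%:E *
    (expR (- (d * (l1norm (vec z.1) + l1norm (vec z.2)))))%:E))).
  apply: ge0_le_integral => //.
  - by apply/measurable_EFinP; apply: measurableT_comp.
  - exact: emeasurable_funM.
  - by move=> z _; rewrite -EFinM lee_fin -expRD ler_expR.
rewrite ge0_integralZl//.
apply: lte_mul_pinfty => //.
exact: integral_leb6_decay.
Qed.

Lemma leb6_setT : @leb6 R setT = +oo.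
Proof.
have l1 : @lebesgue_measure R setT = +oo.
  have := @lebesgue_measure_itv R `]-oo, +oo[; rewrite set_itvNyy => -> //=.
have X (d1 d2 : measure_display) (T1 : measurableType d1) (T2 : measurableType d2)
    (m1 : {sigma_finite_measure set T1 -> \bar R})
    (m2 : {sigma_finite_measure set T2 -> \bar R}) :
    m1 setT = +oo -> m2 setT = +oo -> mprod m1 m2 setT = +oo.
  move=> E1 E2; rewrite -setXTT; transitivity (m1 setT * m2 setT).
    exact: product_measure1E.
  by rewrite E1 E2 mulyy.
have l2 := X _ _ _ _ (@lebesgue_measure R) (@lebesgue_measure R) l1 l1.
have l3 := X _ _ _ _ (mprod (@lebesgue_measure R) (@lebesgue_measure R)) (@lebesgue_measure R) l2 l1.
exact: (X _ _ _ _ leb3 leb3 l3 l3).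
Qed.

Lemma leb6_flip : mpres (fun z => (z.1, coords (- vec z.2))) (@leb6 R) (@leb6 R).
Proof.
apply: (mpres_skew (m1 := leb3) (n1 := leb3) (m2 := leb3) (n2 := leb3)
  (f := fun x => x) (g := fun _ y => coords (- vec y))) => [||_].
- exact: mpres_id.
- exact: measurableT_comp (leb3_opp.1) measurable_snd.
- exact: leb3_opp.
Qed.

Lemma leb6_translation (a c : 'cV[R]_3) :
  mpres (fun z => (coords (vec z.1 + a), coords (vec z.2 + c))) (@leb6 R) (@leb6 R).
Proof.
apply: (mpres_skew (m1 := leb3) (n1 := leb3) (m2 := leb3) (n2 := leb3)
  (f := fun y => coords (vec y + a)) (g := fun _ y => coords (vec y + c))) => [||_].
- exact: leb3_translation.
- exact: measurableT_comp (leb3_translation c).1 measurable_snd.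
- exact: leb3_translation.
Qed.

(* Averages of exp E over two measure preserving images are bounded below by
   convexity of exp. *)
Lemma integral_exp_ge (E : coord3 R * coord3 R -> R) (s t : coord3 R * coord3 R -> coord3 R * coord3 R)
    (D : set (coord3 R * coord3 R)) (c : R) : measurable D ->
  measurable_fun setT E -> mpres s (@leb6 R) (@leb6 R) -> mpres t (@leb6 R) (@leb6 R) ->
  (forall z, D z -> 2 * c <= E (s z) + E (t z))%R ->
  (expR c)%:E * leb6 D <= \int[leb6]_z (expR (E z))%:E.
Proof.
move=> mD mE ps pt Ec.
have me : measurable_fun setT (fun z => (expR (E z))%:E).
  by apply/measurable_EFinP; exact: measurableT_comp.
have e0 z : 0 <= (expR (E z))%:E by rewrite lee_fin expR_ge0.
set I := \int[leb6]_z (expR (E z))%:E.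
have Is : \int[leb6]_z (expR (E (s z)))%:E = I by exact: (mpres_ge0_integral ps me e0).
have It : \int[leb6]_z (expR (E (t z)))%:E = I by exact: (mpres_ge0_integral pt me e0).
have ms : measurable_fun setT (fun z => (expR (E (s z)))%:E).
  exact: measurableT_comp me ps.1.
have mt : measurable_fun setT (fun z => (expR (E (t z)))%:E).
  exact: measurableT_comp me pt.1.
suff h : 2%:E * ((expR c)%:E * leb6 D) <= I + I.
  have I0 : 0 <= I by exact: integral_ge0.
  clear Is It; clearbody I; case: I I0 h => [r _|_ _|]; [|by rewrite leey|by rewrite leeNy_eq].
  rewrite -EFinD; case: (leb6 D) => [x| |].
  - by rewrite -!EFinM !lee_fin; lra.
  - by rewrite gt0_muley ?lte_fin ?expR_gt0// gt0_muley ?lte_fin// leye_eq.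
  - by rewrite gt0_muleNy ?lte_fin ?expR_gt0// leNye.
have -> : I + I = \int[leb6]_z (expR (E (s z)))%:E + \int[leb6]_z (expR (E (t z)))%:E.
  by rewrite Is It.
rewrite -ge0_integralD//.
rewrite muleA -EFinM -integral_cst//.
apply: (@le_trans _ _ (\int[leb6]_(z in D) ((expR (E (s z)))%:E + (expR (E (t z)))%:E))).
  apply: ge0_le_integral => //.
  - by move=> z _; rewrite lee_fin mulr_ge0// expR_ge0.
  - by apply: measurable_funTS; exact: emeasurable_funD.
  - move=> z Dz; rewrite -EFinD lee_fin.
    have -> : expR (E (s z)) = (expR (E (s z) / 2) ^+ 2)%R.
      by rewrite expr2 -expRD -splitr.
    have -> : expR (E (t z)) = (expR (E (t z) / 2) ^+ 2)%R.
      by rewrite expr2 -expRD -splitr.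
    apply: (@le_trans _ _ (2 * (expR (E (s z) / 2) * expR (E (t z) / 2)))%R).
      rewrite ler_pM2l// -expRD ler_expR; have := Ec z Dz; lra.
    have := sqr_ge0 (expR (E (s z) / 2) - expR (E (t z) / 2)); nra.
apply: ge0_subset_integral => //; first exact: emeasurable_funD.
by move=> z _; rewrite adde_ge0.
Qed.

End decay.

Section gibbs_integrability.
Context {R : realType}.
Implicit Types (x v w : 'cV[R]_3) (Phi : 'cV[R]_3 -> R).

Definition gibbs_exponent Phi (a l : R) w x v : R :=
  a + l * (Phi x + dot v v / 2) + dot (cross w x) v.

Lemma dot_crossE w x v : dot (cross w x) v = dot w (cross x v).
Proof. by rewrite (dotE (cross w x)) (dotE w) /cross !mxE /=; ring. Qed.

Lemma continuous_gibbs_exponent Phi a l w : continuous Phi ->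
  continuous (fun z : 'cV[R]_3 * 'cV[R]_3 => gibbs_exponent Phi a l w z.1 z.2).
Proof.
move=> cP z0.
have c1 : z.1 @[z --> z0] --> z0.1 by exact: cvg_fst.
have c2 : z.2 @[z --> z0] --> z0.2 by exact: cvg_snd.
apply: cvgD.
  apply: cvgD; first exact: cvg_cst.
  apply: cvgM; first exact: cvg_cst.
  apply: cvgD; first exact: (@cvg_comp _ _ _ _ Phi _ _ _ c1 (cP _)).
  by apply: cvgM; [exact: cvg_dot|exact: cvg_cst].
under eq_fun do rewrite (dotE (cross _ _)) /cross !mxE /=.
rewrite (dotE (cross _ _)) /cross !mxE /=.
have k (i : 'I_3) : (z : 'cV[R]_3 * 'cV[R]_3).1 i 0 @[z --> z0] --> z0.1 i 0.
  exact: cvg_coef.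
have k' (i : 'I_3) : (z : 'cV[R]_3 * 'cV[R]_3).2 i 0 @[z --> z0] --> z0.2 i 0.
  exact: cvg_coef.
apply: cvgD; [apply: cvgD|]; apply: cvgM => //; apply: cvgB;
  apply: cvgM => //; exact: cvg_cst.
Qed.

Lemma measurable_gibbs_exponent Phi a l w : continuous Phi ->
  measurable_fun setT (fun z : coord3 R * coord3 R =>
    gibbs_exponent Phi a l w (vec z.1) (vec z.2) : R).
Proof.
move=> cP.
apply: (measurable_continuous_vec2
  (f := fun z : 'cV[R]_3 * 'cV[R]_3 => gibbs_exponent Phi a l w z.1 z.2)).
exact: continuous_gibbs_exponent.
Qed.

(** Reversing v cancels the rotation term; with [l] nonnegative the average of the two exponents is
    at least [a] on the whole space, which has infinite measure. *)
Lemma gibbs_exponent_not_integrable Phi a l w : continuous Phi ->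
  (forall x, 0 <= Phi x) -> 0 <= l ->
  (\int[leb6]_z (expR (gibbs_exponent Phi a l w (vec z.1) (vec z.2)))%:E = +oo)%E.
Proof.
move=> cP P0 l0; have mE := measurable_gibbs_exponent a l w cP.
have := integral_exp_ge (c := a) measurableT mE (mpres_id leb6) leb6_flip.
rewrite leb6_setT gt0_muley ?lte_fin ?expR_gt0// leye_eq => h; apply/eqP/h.
move=> z _; rewrite /gibbs_exponent /= coordsK dotNl !dotNr opprK.
have : 0 <= l * (Phi (vec z.1) + dot (vec z.2) (vec z.2) / 2).
  by rewrite mulr_ge0// addr_ge0// divr_ge0// dot_ge0.
lra.
Qed.

Lemma dot_le_sqr (e : R) v w : 0 < e -> dot w v <= e / 2 * dot v v + dot w w / (2 * e).
Proof.
move=> e0; have := dot_ge0 (e *: v - w).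
rewrite dotBl !dotBr !dotZl !dotZr (dotC v w) => h.
rewrite -(ler_pM2l (_ : 0 < 2 * e)) ?mulr_gt0//.
have -> : 2 * e * (e / 2 * dot v v + dot w w / (2 * e)) = e ^+ 2 * dot v v + dot w w.
  by field; rewrite gt_eqF.
nra.
Qed.

Lemma cross_sqr_le w x : dot (cross w x) (cross w x) <= dot w w * dot x x.
Proof. by rewrite dot_cross_sqr lerBlDr lerDl sqr_ge0. Qed.

Lemma l1norm_le_sqr (e : R) x : 0 < e -> l1norm x <= e * dot x x + 3 / (4 * e).
Proof.
move=> e0; have h (t : R) : `|t| <= e * (t * t) + 1 / (4 * e).
  rewrite -expr2 -(real_normK (num_real t)); have := sqr_ge0 (2 * e * `|t| - 1).
  set s := `|t| => hs; rewrite -(ler_pM2l (_ : 0 < 4 * e)) ?mulr_gt0//.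
  have -> : 4 * e * (e * s ^+ 2 + 1 / (4 * e)) = 4 * e ^+ 2 * s ^+ 2 + 1.
    by field; rewrite gt_eqF.
  nra.
have := h (x 0 0); have := h (x 1 0); have := h (x 2 0).
rewrite /l1norm dotE.
have -> : 3 / (4 * e) = 1 / (4 * e) + 1 / (4 * e) + 1 / (4 * e) by field; rewrite gt_eqF.
by rewrite !mulrDr; lra.
Qed.

Lemma gibbs_gt2_decay p a l w : 2 < p -> l < 0 -> exists C, forall x v,
  gibbs_exponent (potential_gt2 p) a l w x v <= C - 1 * (l1norm x + l1norm v).
Proof.
move=> p2 l0; pose al := - l; have al0 : 0 < al by rewrite oppr_gt0.
(* Completing the square bounds the rotation by al |v|^2 / 4 + |w|^2 |x|^2 / al; the extra 1 pays
   for [l1norm x]. *)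
have [C0 PC] := potential_gt2_growth ((dot w w / al + 1) / al) p2.
exists (a + al * C0 + 3 / (4 * 1) + 3 / (4 * (al / 4))) => x v.
have a40 : 0 < al / 4 by rewrite divr_gt0.
have a20 : 0 < al / 2 by rewrite divr_gt0.
have h1 := l1norm_le_sqr x ltr01; have h2 := l1norm_le_sqr v a40.
have h3 := dot_le_sqr v (cross w x) a20.
have h4 := cross_sqr_le w x.
have h5 : dot (cross w x) (cross w x) / (2 * (al / 2)) <= dot w w / al * dot x x.
  rewrite [2 * _]mulrC mulfVK ?pnatr_eq0// mulrAC ler_wpM2r// invr_ge0 ltW//.
have h6 : (dot w w / al + 1) * dot x x <= al * potential_gt2 p x + al * C0.
  rewrite -mulrDr; have := PC x; rewrite -(ler_pM2l al0) => h; apply: le_trans h; rewrite le_eqVlt.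
  by apply/orP; left; apply/eqP; field; rewrite gt_eqF.
rewrite /gibbs_exponent; have -> : l = - al by rewrite opprK.
move: h1 h2 h3 h5 h6; set X := dot x x; set V := dot v v.
by rewrite mulrDl !mul1r; lra.
Qed.

Lemma gibbs_lt2_decay p a l : 1 < p -> l < 0 -> exists C d, 0 < d /\ forall x v,
  gibbs_exponent (potential_lt2 p) a l 0 x v <= C - d * (l1norm x + l1norm v).
Proof.
move=> p1 l0; pose al := - l; have al0 : 0 < al by rewrite oppr_gt0.
(* Each |x_i| is at most p Phi, so [l1norm x] is at most 3 p Phi. The constant [e] below satisfies d
   e = al / 2, the coefficient of |v|^2. *)
pose d := al / (3 * p); have p0 : 0 < p by lra.
have d0 : 0 < d by rewrite divr_gt0// mulr_gt0.
pose e := al / (2 * d); have e0 : 0 < e by rewrite divr_gt0// mulr_gt0.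
exists (a + d * (3 / (4 * e))), d; split => // x v.
have h1 : d * l1norm x <= al * potential_lt2 p x.
  have h (i : 'I_3) : `|x i 0| <= p * potential_lt2 p x.
    apply: le_trans (potential_lt2_growth x p1).
    rewrite -ler_sqr ?nnegrE ?enorm_ge0// real_normK ?num_real// enorm_sqr.
    by rewrite /dot (bigD1 i)//= -expr2 lerDl sumr_ge0// => j _; rewrite -expr2 sqr_ge0.
  have : l1norm x <= 3 * (p * potential_lt2 p x).
    by have := h 0; have := h 1; have := h 2; rewrite /l1norm; lra.
  rewrite -(ler_pM2l d0) => k; apply: le_trans k _; rewrite le_eqVlt.
  by apply/orP; left; apply/eqP; rewrite /d; field; rewrite gt_eqF.
have h2 : d * l1norm v <= al * (dot v v / 2) + d * (3 / (4 * e)).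
  have := l1norm_le_sqr v e0; rewrite -(ler_pM2l d0) mulrDr => k; apply: le_trans k _.
  rewrite le_eqVlt; apply/orP; left; apply/eqP; rewrite mulrDr; congr (_ + _).
  by rewrite /e; field; rewrite gt_eqF.
rewrite /gibbs_exponent [dot (cross 0 x) v](_ : _ = 0); last first.
  by rewrite dot_crossE dot0l.
have -> : l = - al by rewrite opprK.
move: h1 h2; move: (dot v v) (potential_lt2 p x) (3 / (4 * e)) (l1norm x) (l1norm v).
by clearbody al d; clear => r1 r2 r3 r4 r5; rewrite !mulrDr; lra.
Qed.

(** Along (t b, (t / al) d) with d = cross w b, rotation and kinetic energy together contribute t^2
    |d|^2 / (2 al), while the potential costs only order t^p. Averaging over t and - t removes the
    terms linear in t on a unit cube. *)
Lemma gibbs_lt2_rotation_not_integrable p a l w : 1 < p < 2 -> w != 0 ->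
  (\int[leb6]_z (expR (gibbs_exponent (potential_lt2 p) a l w (vec z.1) (vec z.2)))%:E
    = +oo)%E.
Proof.
move=> /andP[p1 p2] w0; have p0 : 0 < p by lra.
have cP : continuous (potential_lt2 p).
  by move=> x; apply: differentiable_continuous; exact: differentiable_potential_lt2.
have [l0|l0] := leP 0 l.
  by apply: gibbs_exponent_not_integrable => // x; exact: potential_lt2_ge0.
pose al := - l; have al0 : 0 < al by rewrite oppr_gt0.
have [b d0] : exists b, cross w b != 0.
  apply: contrapT => /forallNP h; move/eqP: w0; apply; apply: cross_eq0 => x v.
  by have /negP := h x; rewrite negbK => /eqP ->; rewrite dot0l.
set d := cross w b in d0.
have b0 : b != 0.
  apply/eqP => bE; move: d0; rewrite /d bE => /eqP; apply.
  by apply: cV3P; rewrite /cross !mxE /=; ring.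
have bb : 0 < dot b b by rewrite lt0r dot_eq0 b0 dot_ge0.
have dd : 0 < dot d d by rewrite lt0r dot_eq0 d0 dot_ge0.
pose q := p / 2; have q1 : 0 < 1 - q by rewrite /q; lra.
pose sh (t : R) (z : coord3 R * coord3 R) :=
  (coords (vec z.1 + t *: b), coords (vec z.2 + (t / al) *: d)).
pose I3 : set (coord3 R) := ([set` `[0, 1]%R] `*` [set` `[0, 1]%R]) `*` [set` `[0, 1]%R].
have mI1 : measurable ([set` `[0, 1]%R] : set (measurableTypeR R)) by exact: measurable_itv.
have mI3 : measurable I3 by do 2?apply: measurableX.
have lI3 : leb3 I3 = 1%E.
  have l1 : lebesgue_measure ([set` `[0, 1]%R] : set (measurableTypeR R)) = 1%E.
    by rewrite lebesgue_measure_itv /= lte_fin ltr01 -EFinB subr0.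
  transitivity (mprod (@lebesgue_measure R) (@lebesgue_measure R)
    ([set` `[0, 1]%R] `*` [set` `[0, 1]%R]) * lebesgue_measure ([set` `[0, 1]%R] : set (measurableTypeR R)))%E.
    by apply: product_measure1E => //; exact: measurableX.
  rewrite l1 mule1; transitivity (lebesgue_measure ([set` `[0, 1]%R] : set (measurableTypeR R)) *
    lebesgue_measure ([set` `[0, 1]%R] : set (measurableTypeR R)))%E.
    exact: product_measure1E.
  by rewrite l1 mule1.
have lD : leb6 (I3 `*` I3) = 1%E.
  transitivity (leb3 I3 * leb3 I3)%E; first exact: product_measure1E.
  by rewrite lI3 mule1.
have mE := measurable_gibbs_exponent a l w cP.
set E := fun z => _ in mE.
(* y = 7 + 2 t^2 |b|^2 bounds 1 + |x +- t b|^2 on the unit cube. *)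
pose k := dot d d / (4 * al * dot b b).
have k0 : 0 < k by rewrite divr_gt0// !mulr_gt0.
(* [a'] collects the cost of the cube, where |x|^2 and |v|^2 are at most 3, and the 7 k lost in
   passing from y - 7 to y. *)
pose a' := a - 7 * k - 3 / 2 * (al + dot w w + 1).
have key (y : R) : 7 <= y ->
    ((expR (a' + k * y - al / p * y `^ q))%:E <= \int[leb6]_z (expR (E z))%:E)%E.
  move=> y7; pose t := Num.sqrt ((y - 7) / (2 * dot b b)).
  have t2 : t ^+ 2 = (y - 7) / (2 * dot b b).
    by rewrite sqr_sqrtr// divr_ge0 ?subr_ge0// mulr_ge0// dot_ge0.
  have msh s : mpres (sh s) (@leb6 R) (@leb6 R) by exact: leb6_translation.
  have := integral_exp_ge (c := a' + k * y - al / p * y `^ q)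
    (measurableX mI3 mI3) mE (msh t) (msh (- t)).
  rewrite lD mule1; apply => z [[/= [z11 z12] z13] [[z21 z22] z23]].
  have cube (c : coord3 R) : [set` `[0, 1]%R] c.1.1 -> [set` `[0, 1]%R] c.1.2 ->
      [set` `[0, 1]%R] c.2 -> dot (vec c) (vec c) <= 3.
    rewrite /= !in_itv /= => /andP[? ?] /andP[? ?] /andP[? ?].
    by rewrite dotE !mxE /=; nra.
  have x3 := cube _ z11 z12 z13; have v3 := cube _ z21 z22 z23.
  rewrite /E /sh /= !coordsK; move: (vec z.1) (vec z.2) x3 v3 => x v x3 v3.
  have Pb (s : R) : s ^+ 2 = t ^+ 2 -> potential_lt2 p (x + s *: b) <= y `^ q / p.
    move=> s2; rewrite /potential_lt2 ler_pM2r ?invr_gt0// japanese_powR.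
    rewrite ge0_ler_powR ?nnegrE//.
    - by rewrite /q divr_ge0// ltW.
    - by rewrite addr_ge0// dot_ge0.
    - by apply: le_trans y7.
    - have := dot_ge0 (x - s *: b).
      rewrite !dotDl !dotDr !dotNl !dotNr !dotZl !dotZr (dotC b x).
      have sb : s * (s * dot b b) = (y - 7) / 2.
        by rewrite mulrA -expr2 s2 t2; field; rewrite gt_eqF.
      lra.
  have P1 := Pb _ (erefl (t ^+ 2)); have P2 := Pb (- t) (sqrrN t).
  have c1 : - (3 / 2 * (dot w w + 1)) <= dot (cross w x) v.
    have := dot_ge0 (cross w x + v); rewrite dotDl !dotDr (dotC v).
    have := cross_sqr_le w x; have : dot w w * dot x x <= dot w w * 3 by rewrite ler_wpM2l// dot_ge0.
    move: (dot w w * dot x x) (dot (cross w x) (cross w x)) (dot (cross w x) v) (dot w w) => r1 r2 r3 r4.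
    by clear -v3; lra.
  have crossD s : cross w (x + s *: b) = cross w x + s *: d.
    by apply: cV3P; rewrite /d /cross !mxE /=; ring.
  have tk : t * (t * dot d d / al) = 2 * (k * (y - 7)).
    by rewrite !mulrA -expr2 t2 /k; field; rewrite !gt_eqF.
  have aP1 := ler_wpM2l (ltW al0) P1; have aP2 := ler_wpM2l (ltW al0) P2.
  have av := ler_wpM2l (ltW al0) v3.
  rewrite /gibbs_exponent !crossD.
  rewrite !dotDl !dotDr !dotZl !dotZr (dotC d v).
  have -> : al / p * y `^ q = al * (y `^ q / p) by rewrite mulrAC mulrA.
  have lE : l = - al by rewrite opprK.
  have ta : al * (t / al) = t by rewrite mulrC divfK// gt_eqF.
  have td : t * (t / al * dot d d) = 2 * (k * (y - 7)).
    by rewrite -tk; field; rewrite gt_eqF.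
  have ta2 : al * (t / al * (t / al * dot d d)) = 2 * (k * (y - 7)).
    by rewrite -td [LHS]mulrA ta.
  rewrite ![- t / al]mulNr.
  move: ta2 td aP1 aP2 av c1; rewrite /a' lE.
  move: (dot v d) (dot v v) (dot d d) (y `^ q / p) (dot w w) => r1 r2 r3 r4 r5.
  move: (potential_lt2 _ _) (potential_lt2 _ _) (dot (cross w x) v) => r6 r7 r8.
  move: (dot (cross w x) d) (t / al) => r9 r10.
  clearbody al k; clear; lra.
have gt (N : R) : (N%:E <= \int[leb6]_z (expR (E z))%:E)%E.
  (* The first entry keeps y above 7, the second bounds the potential by half of k y, and the third
     makes the other half reach N - a'. *)
  pose K := Num.max (Num.max 7 (2 * al / (p * k))) (2 / k * (N - a')).
  have [y y2 yK] := powR_unbounded K q1.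
  have y0 : 0 < y by lra.
  have yq : y `^ (1 - q) <= y.
    by rewrite -[leRHS](powRr1 (ltW y0)) ler_powR//; rewrite /q; lra.
  have [K1 K2 K3] : [/\ 7 < y `^ (1 - q), 2 * al / (p * k) < y `^ (1 - q)
      & 2 / k * (N - a') < y `^ (1 - q)].
    by move: yK; rewrite !gt_max => /andP[/andP[-> ->] ->].
  apply: le_trans (key y _); last by lra.
  rewrite lee_fin; apply: le_trans (expR_ge1Dx _).
  have h1 : al / p * y `^ q <= k / 2 * y.
    have yE : y = y `^ (1 - q) * y `^ q.
      by rewrite -powRD ?subrK ?powRr1 ?ltW// gt_eqF ?implybT.
    rewrite {2}yE mulrA ler_wpM2r ?powR_ge0//.
    apply: le_trans (ler_wpM2l (ltW (divr_gt0 k0 (ltr0Sn _ 1))) (ltW K2)).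
    by rewrite le_eqVlt; apply/orP; left; apply/eqP; field; rewrite !gt_eqF.
  have h2 : N - a' <= k / 2 * y.
    have : 2 / k * (N - a') <= y by lra.
    rewrite -(ler_pM2l (divr_gt0 k0 (ltr0Sn _ 1))) => h; apply: le_trans h.
    by rewrite le_eqVlt; apply/orP; left; apply/eqP; field; rewrite gt_eqF.
  by lra.
by apply/eqyP => A _; exact: gt.
Qed.

End gibbs_integrability.

(** * Classification of equilibria *)

Section gibbs_classification.
Context {R : realType}.
Implicit Types (x v w : 'cV[R]_3).

(** Restriction to the line through y along z reduces this to the chain rule in one variable. *)
Lemma is_derive_comp1 (V : normedModType R) (h : R -> R) (f : V -> R) (y z : V) (d l : R) :
  is_derive (f y) 1 h d -> is_derive y z f l -> is_derive y z (fun u => h (f u)) (d * l).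
Proof.
move=> hd fl.
have f1 : is_derive (0 : R) 1 (fun s : R => f (y + s *: z)) l.
  by apply: is_derive_line; rewrite scale0r addr0.
have h1 : is_derive ((fun s : R => f (y + s *: z)) 0) 1 h d by rewrite /= scale0r addr0.
have /cvg_is_derive c := is_derive1_comp h1 f1.
apply: is_derive_cvg; apply: cvg_trans c; apply: near_eq_cvg; apply: nearW => t /=.
by rewrite [t *: 1]mulr1 addr0 scale0r addr0 (addrC y).
Qed.

(** Extends time to the real line, so that two-sided derivatives make sense; only positive times are
    exploited. *)
Definition abs_nng (s : R) : {nonneg R} := `|s|%:nng.

Lemma differentiable_ln_comp (V : normedModType R) (f : V -> R) (y : V) : 0 < f y ->
  differentiable f y -> differentiable (fun u => ln (f u)) y.
Proof.
move=> f0 df; apply: (differentiable_comp (f := f) (g := @ln R)) => //.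
by apply/derivable1_diffP; apply: ex_derive; exact: is_derive1_ln.
Qed.

Variables Phi psi : 'cV[R]_3 -> R.
Hypothesis dPhi : forall x v, is_derive x v Phi (psi x * dot x v).
Hypothesis gradPhi : forall x, grad Phi x = psi x *: x.
Hypothesis PhiN : forall x, Phi (- x) = Phi x.
Hypothesis psiN : forall x, psi (- x) = psi x.
Hypothesis virial_not_quadratic : exists u r,
  2 * (Phi (r *: u) - Phi 0) + psi (r *: u) * dot (r *: u) (r *: u) !=
  r ^+ 2 * (2 * (Phi u - Phi 0) + psi u * dot u u).
Hypothesis psi_not_const : forall u, u != 0 -> exists2 r, r != 0 & psi (r *: u) != psi u.
Variables (gamma : R) (b : R -> R) (M : {nonneg R} -> 'cV[R]_3 -> 'cV[R]_3 -> R).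
Hypothesis hb : angular_kernel b.

Theorem equilibrium_gibbs : equilibria Phi (collision_kernel gamma b) M ->
  exists a l w, forall t x v, M t x v = expR (gibbs_exponent Phi a l w x v).
Proof.
move=> [[dM iM] M0 _ tM QM].
have dMv t x v : differentiable (M t x) v.
  have dp : differentiable (fun v : 'cV[R]_3 => (x, v)) v.
    by apply: differentiable_pair; [exact: differentiable_cst|exact: ex_diff].
  exact: (differentiable_comp (f := fun v : 'cV[R]_3 => (x, v))
    (g := fun z : 'cV[R]_3 * 'cV[R]_3 => M t z.1 z.2) dp (dM t x v)).
have dMx t x v : differentiable (fun y => M t y v) x.
  have dp : differentiable (fun y : 'cV[R]_3 => (y, v)) x.
    by apply: differentiable_pair; [exact: ex_diff|exact: differentiable_cst].
  exact: (differentiable_comp (f := fun y : 'cV[R]_3 => (y, v))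
    (g := fun z : 'cV[R]_3 * 'cV[R]_3 => M t z.1 z.2) dp (dM t x v)).
have [mb b0 _ _ _] := hb.
have [c0 [c01 gl]] := gain_loss_eq0 gamma hb.
(* The coefficients are selected pointwise in (t, x), without regularity; the angle [c0] is already
   fixed for all of them. *)
have /choice[abl ablE] : forall tx : {nonneg R} * 'cV[R]_3, exists abl : R * 'cV[R]_3 * R,
    forall v, ln (M tx.1 tx.2 v) = abl.1.1 + dot abl.1.2 v + abl.2 * (dot v v / 2).
  move=> [t x]; have cM : continuous (M t x).
    by move=> v; apply: differentiable_continuous; exact: dMv.
  have [a [be [lam E]]] := maxwellian c01 (dMv t x) (M0 t x)
    (gl _ cM (H_theorem b0 (M0 t x) (iM t x) (QM t x))).
  by exists (a, be, lam).
pose g (s : R) x v := ln (M (abs_nng s) x v).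
have dgv s x v : differentiable (g s x) v by exact: differentiable_ln_comp.
have dgx s x v : differentiable (fun y => g s y v) x by exact: differentiable_ln_comp.
have dgZ (t : R) x v k w : 0 < t ->
    'd (fun y => g t y v) x (k *: w) = k * 'd (fun y => g t y v) x w.
  by move=> _; rewrite linearZ.
have [|a [l [w gE]]] := transport_rigidity dPhi PhiN psiN virial_not_quadratic psi_not_const
  (g := g) (A := fun s x => (abl (abs_nng s, x)).1.1)
  (B := fun s x => (abl (abs_nng s, x)).1.2) (L := fun s x => (abl (abs_nng s, x)).2)
  (fun t x v _ => ablE (_, x) v) (Dx := fun s x v u => 'd (fun y => g s y v) x u)
  dgZ
  (fun t x v w _ => differentiable_is_derive w (dgx t x v)).
  move=> t x v t0; set tn := abs_nng t.
  have tE : tn%:num = t by rewrite /= gtr0_norm.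
  have := tM tn x v; rewrite tE gradPhi => tr.
  have dt : is_derive t 1 (fun s : R => M (abs_nng s) x v)
      ('D_(psi x *: x) (M tn x) v - 'D_v (fun y => M tn y v) x).
    (* Times near a positive time are nonnegative, so the restriction to [0, +oo[ in the transport
       equation is void there. *)
    have sh : h + t @[h --> (0 : R)^'] --> within [set s : R | 0 <= s] t^'.
      have c : h + t @[h --> (0 : R)] --> t.
        by rewrite -[X in _ --> X]add0r; apply: cvgD; [exact: cvg_id|exact: cvg_cst].
      move=> A A1; have {}A1 : \forall s \near t, s != t -> 0 <= s -> A s by exact: A1.
      have A2 := c _ A1; have A3 := c _ (near_gt0 t0).
      suff : \forall h \near (0 : R)^', A (h + t) by [].
      near=> h.
      have h0 : h != 0 by near: h; exact: nbhs_dnbhs_neq.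
      have /= A4 : (h + t != t -> 0 <= h + t -> A (h + t)) by near: h; exact: nbhs_dnbhs.
      have /= A5 : 0 < h + t by near: h; exact: nbhs_dnbhs.
      by apply: A4; rewrite ?ltW// -subr_eq0 addrK.
    apply: is_derive_cvg; apply: cvg_trans (cvg_comp _ _ sh tr).
    apply: near_eq_cvg; apply: nearW => h /=.
    by rewrite [h *: 1]mulr1 addrK mulrC.
  have dl := is_derive_comp1 (is_derive1_ln (M0 tn x v)) dt.
  have e1 : (M tn x v)^-1 * 'D_(psi x *: x) (M tn x) v =
      psi x * dot x ((abl (tn, x)).1.2 + (abl (tn, x)).2 *: v).
    have h1 := is_derive_comp1 (is_derive1_ln (M0 tn x v))
      (differentiable_is_derive (psi x *: x) (dMv tn x v)).
    have h2 : is_derive v (psi x *: x) (fun u => ln (M tn x u))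
        (dot (abl (tn, x)).1.2 (psi x *: x) + (abl (tn, x)).2 * dot v (psi x *: x)).
      have -> : (fun u => ln (M tn x u)) = (fun u => (abl (tn, x)).1.1 + dot (abl (tn, x)).1.2 u) +
          (abl (tn, x)).2 \*: (fun u => dot u u / 2).
        by apply/funext => u; exact: ablE (tn, x) u.
      apply: is_deriveD; last first.
        by have := is_deriveZ (abl (tn, x)).2 (is_derive_sqr v (psi x *: x)).
      have := is_deriveD (is_derive_cst (abl (tn, x)).1.1 v (psi x *: x))
        (is_derive_dot v (psi x *: x) (abl (tn, x)).1.2).
      by rewrite add0r.
    rewrite deriveE// (is_derive_unique h1 h2) !dotZr dotDr dotZr (dotC v) (dotC (abl _).1.2).
    ring.
  have e2 : (M tn x v)^-1 * 'D_v (fun y => M tn y v) x = 'd (fun y => g t y v) x v.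
    have h1 := is_derive_comp1 (is_derive1_ln (M0 tn x v))
      (differentiable_is_derive v (dMx tn x v)).
    rewrite (deriveE _ (dMx tn x v)); apply: (is_derive_unique h1).
    exact: (differentiable_is_derive v (dgx t x v)).
  by move: dl; rewrite mulrBr e1 e2.
exists a, l, w => t x v.
have pos (s : R) : 0 < s -> M (abs_nng s) x v = expR (gibbs_exponent Phi a l w x v).
  by move=> s0; rewrite /gibbs_exponent -(gE s x v s0) /g lnK ?posrE.
have [t0|t0] := ltP 0 t%:num.
  have -> : t = abs_nng t%:num by apply/val_inj; rewrite /= gtr0_norm.
  exact: pos.
have tE : t%:num = 0 by apply/eqP; rewrite eq_le t0 ge0.
(* Rigidity covers positive times only. At time 0 the difference quotient converges, so its
   numerator tends to 0; and for s > 0 that numerator does not depend on s. *)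
have := tM t x v; rewrite tE => tr.
have {}tr : (expR (gibbs_exponent Phi a l w x v) - M t x v) / s @[s --> (0 : R)^'+] -->
    'D_(grad Phi x) (M t x) v - 'D_v (fun y => M t y v) x.
  have sh : s @[s --> (0 : R)^'+] --> within [set s : R | 0 <= s] (0 : R)^'.
    move=> A A1; have {A1} : \forall s \near (0 : R), s != 0 -> 0 <= s -> A s by exact: A1.
    apply: filterS => s As s0; apply: As; first by rewrite gt_eqF.
    exact: ltW.
  apply: cvg_trans (cvg_comp _ _ sh tr); apply: near_eq_cvg; near=> s.
  by rewrite /= pos// subr0.
have c0' : s @[s --> (0 : R)^'+] --> (0 : R) by exact: cvg_at_right_filter cvg_id.
have {}tr : s * ((expR (gibbs_exponent Phi a l w x v) - M t x v) / s) @[s --> (0 : R)^'+]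
    --> 0 * ('D_(grad Phi x) (M t x) v - 'D_v (fun y => M t y v) x) by exact: cvgM.
rewrite mul0r in tr.
have cc : expR (gibbs_exponent Phi a l w x v) - M t x v @[s --> (0 : R)^'+] --> (0 : R).
  apply: cvg_trans tr; apply: near_eq_cvg; near=> s.
  by rewrite /= mulrC divfK// gt_eqF.
have /eqP : expR (gibbs_exponent Phi a l w x v) - M t x v = 0.
  by rewrite -(cvg_lim _ cc)//; apply/esym; apply: cvg_lim => //; exact: cvg_cst.
by rewrite subr_eq0 => /eqP ->.
Unshelve. all: by end_near. Qed.

End gibbs_classification.

(** * Gibbs functions are equilibria *)

Section collision_measurability.
Context {R : realType} d (Z : measurableType d).
Implicit Types F G : Z -> 'cV[R]_3.

Notation mcoef F := (forall i : 'I_3, measurable_fun setT (fun z => F z i 0 : R)).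

Lemma measurable_continuous_coef (f : 'cV[R]_3 -> R) F : continuous f -> mcoef F ->
  measurable_fun setT (fun z => f (F z)).
Proof.
move=> cf mF.
have -> : (fun z => f (F z)) = (fun y => f (vec y)) \o (fun z => coords (F z)).
  by apply/funext => z /=; rewrite coordsK.
exact: measurableT_comp (measurable_continuous_vec cf) (measurable_coords mF).
Qed.

Lemma mcoefD F G : mcoef F -> mcoef G -> mcoef (fun z => F z + G z).
Proof. by move=> mF mG i; under eq_fun do rewrite mxE; exact: measurable_funD. Qed.

Lemma mcoefB F G : mcoef F -> mcoef G -> mcoef (fun z => F z - G z).
Proof. by move=> mF mG i; under eq_fun do rewrite !mxE; exact: measurable_funB. Qed.

Lemma mcoefZ (k : Z -> R) F : measurable_fun setT k ->
  mcoef F -> mcoef (fun z => k z *: F z).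
Proof. by move=> mk mF i; under eq_fun do rewrite mxE; exact: measurable_funM. Qed.

Lemma measurable_enorm_coef F : mcoef F ->
  measurable_fun setT (fun z => enorm (F z)).
Proof. by move=> mF; apply: measurable_continuous_coef => //; exact: continuous_enorm. Qed.

Lemma measurable_kernel (gamma : R) (b : R -> R) F G : measurable_fun setT b ->
  mcoef F -> mcoef G ->
  measurable_fun setT (fun z => collision_kernel gamma b (F z) (G z)).
Proof.
move=> mb mF mG; have mn := measurable_enorm_coef mF; apply: measurable_funM.
  exact: measurableT_comp (measurable_powR _) mn.
apply: (measurableT_comp (f := b)) => //.
have md : mcoef (fun z => direction (F z)).
  apply: mcoefZ => //; under eq_fun do rewrite -powR_inv1 ?enorm_ge0//.
  exact: measurableT_comp (measurable_powR _) mn.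
under eq_fun do rewrite dotE.
by apply: measurable_funD; [apply: measurable_funD|]; exact: measurable_funM.
Qed.

Lemma mcoef_post_collision F G (S : Z -> 'cV[R]_3) : mcoef F -> mcoef G -> mcoef S ->
  mcoef (fun z => post_collision (F z) (G z) (S z)).
Proof.
move=> mF mG mS; apply: mcoefD; first by apply: mcoefZ => //; exact: mcoefD.
apply: mcoefZ => //; apply: measurable_funM => //; apply: measurable_enorm_coef.
exact: mcoefB.
Qed.

Lemma mcoef_post_collision_star F G (S : Z -> 'cV[R]_3) : mcoef F -> mcoef G -> mcoef S ->
  mcoef (fun z => post_collision_star (F z) (G z) (S z)).
Proof.
move=> mF mG mS; apply: mcoefB; first by apply: mcoefZ => //; exact: mcoefD.
apply: mcoefZ => //; apply: measurable_funM => //; apply: measurable_enorm_coef.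
exact: mcoefB.
Qed.

End collision_measurability.

Section gibbs_equilibrium.
Context {R : realType}.
Implicit Types (x v w : 'cV[R]_3).

Lemma dot_post_collision v w (s : 'cV[R]_3) : enorm s = 1 ->
  dot (post_collision v w s) (post_collision v w s) +
  dot (post_collision_star v w s) (post_collision_star v w s) = dot v v + dot w w.
Proof.
move=> s1; have ss : dot s s = 1 by rewrite -enorm_sqr s1 expr1n.
rewrite /post_collision /post_collision_star.
rewrite !(dotBl, dotBr, dotDl, dotDr, dotZl, dotZr) ss.
have := enorm_sqr (v - w); rewrite dotBl !dotBr (dotC w v) => e.
set r := enorm _ in e *; move: e; move: (dot s v) (dot s w) (dot v s) (dot w s) => k1 k2 k3 k4.
by move=> e; transitivity ((dot v v + 2 * dot v w + dot w w + r ^+ 2) / 2); [field|rewrite e; field].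
Qed.

Lemma post_collisionD v w (s : 'cV[R]_3) :
  post_collision v w s + post_collision_star v w s = v + w.
Proof. by apply/matrixP => i j; rewrite !mxE; field. Qed.

Variables Phi psi : 'cV[R]_3 -> R.
Hypothesis dfPhi : forall x, differentiable Phi x.
Hypothesis dPhi : forall x v, is_derive x v Phi (psi x * dot x v).
Hypothesis gradPhi : forall x, grad Phi x = psi x *: x.
Hypothesis Phi_ge0 : forall x, 0 <= Phi x.
Variables (gamma : R) (b : R -> R).
Hypothesis hb : angular_kernel b.
Notation B := (collision_kernel gamma b).

Let cPhi : continuous Phi.
Proof. by move=> x; exact: differentiable_continuous. Qed.

Variables (a l : R) (w : 'cV[R]_3).
Let E x v := gibbs_exponent Phi a l w x v.
Let M x v := expR (E x v).

Let differentiable_exponent z : differentiable (fun z : 'cV[R]_3 * 'cV[R]_3 => E z.1 z.2) z.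
Proof.
have d1 : differentiable (fst : 'cV[R]_3 * 'cV[R]_3 -> 'cV[R]_3) z.
  by apply: linear_differentiable => y; exact: cvg_fst.
have d2 : differentiable (snd : 'cV[R]_3 * 'cV[R]_3 -> 'cV[R]_3) z.
  by apply: linear_differentiable => y; exact: cvg_snd.
have e1 (i : 'I_3) : differentiable (fun z : 'cV[R]_3 * 'cV[R]_3 => z.1 i 0) z.
  exact: (differentiable_comp d1 (differentiable_coord _ _ _)).
have e2 (i : 'I_3) : differentiable (fun z : 'cV[R]_3 * 'cV[R]_3 => z.2 i 0) z.
  exact: (differentiable_comp d2 (differentiable_coord _ _ _)).
have dP : differentiable (fun z : 'cV[R]_3 * 'cV[R]_3 => Phi z.1) z.
  exact: (differentiable_comp d1 (dfPhi _)).
have dS : differentiable (fun z : 'cV[R]_3 * 'cV[R]_3 => dot z.2 z.2) z.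
  exact: (differentiable_comp d2 (differentiable_sqr _)).
have -> : (fun z : 'cV[R]_3 * 'cV[R]_3 => E z.1 z.2) = cst a +
    l \*: ((fun z : 'cV[R]_3 * 'cV[R]_3 => Phi z.1) + 2^-1 \*: (fun z : 'cV[R]_3 * 'cV[R]_3 => dot z.2 z.2)) +
    ((w 1 0 \*: (fun z : 'cV[R]_3 * 'cV[R]_3 => z.1 2 0) - w 2 0 \*: (fun z : 'cV[R]_3 * 'cV[R]_3 => z.1 1 0)) * (fun z : 'cV[R]_3 * 'cV[R]_3 => z.2 0 0) +
     (w 2 0 \*: (fun z : 'cV[R]_3 * 'cV[R]_3 => z.1 0 0) - w 0 0 \*: (fun z : 'cV[R]_3 * 'cV[R]_3 => z.1 2 0)) * (fun z : 'cV[R]_3 * 'cV[R]_3 => z.2 1 0) +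
     (w 0 0 \*: (fun z : 'cV[R]_3 * 'cV[R]_3 => z.1 1 0) - w 1 0 \*: (fun z : 'cV[R]_3 * 'cV[R]_3 => z.1 0 0)) * (fun z : 'cV[R]_3 * 'cV[R]_3 => z.2 2 0)).
  apply/funext => y; rewrite /E /gibbs_exponent (dotE (cross _ _)) /cross !mxE /=.
  by rewrite [dot _ _ / 2]mulrC.
apply: differentiableD.
  apply: differentiableD; first exact: differentiable_cst.
  apply: differentiableZ; apply: differentiableD => //.
  exact: differentiableZ.
by apply: differentiableD; [apply: differentiableD|]; apply: differentiableM => //;
  apply: differentiableB; apply: differentiableZ.
Qed.

Let differentiable_gibbs z : differentiable (fun z : 'cV[R]_3 * 'cV[R]_3 => M z.1 z.2) z.
Proof.
apply: (differentiable_comp (f := fun z : 'cV[R]_3 * 'cV[R]_3 => E z.1 z.2) (g := @expR R)).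
  exact: differentiable_exponent.
by apply/derivable1_diffP; apply: ex_derive; exact: is_derive_expR.
Qed.

(** At fixed x the exponent is a combination of 1, v and |v|^2, whose sums over the two particles
    are conserved. *)
Let collision_invariant x v v' (s : 'cV[R]_3) : enorm s = 1 ->
  M x (post_collision_star v v' s) * M x (post_collision v v' s) = M x v' * M x v.
Proof.
move=> s1; rewrite -!expRD; congr expR.
have := dot_post_collision v v' s1.
have := congr1 (dot (cross w x)) (post_collisionD v v' s); rewrite !(dotDr (post_collision _ _ _)) (dotDr v).
rewrite /E /gibbs_exponent => h1 /(congr1 ( *%R (l / 2))) h2; lra.
Qed.

Let continuous_exponent x : continuous (E x).
Proof.
move=> v; apply: differentiable_continuous.
apply: (differentiable_comp (f := fun v : 'cV[R]_3 => (x, v))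
  (g := fun z : 'cV[R]_3 * 'cV[R]_3 => E z.1 z.2)).
  by apply: differentiable_pair; [exact: differentiable_cst|exact: ex_diff].
exact: differentiable_exponent.
Qed.

Let continuous_gibbs x : continuous (M x).
Proof.
move=> v; apply: differentiable_continuous.
apply: (differentiable_comp (f := fun v : 'cV[R]_3 => (x, v))
  (g := fun z : 'cV[R]_3 * 'cV[R]_3 => M z.1 z.2)).
  by apply: differentiable_pair; [exact: differentiable_cst|exact: ex_diff].
exact: differentiable_gibbs.
Qed.

(** The integrand vanishes at every unit sigma, hence almost everywhere, however singular [b] is;
    what has to be checked is measurability. *)
Let integrable_entropy x : (mprod leb6 sphere).-integrable setT (EFin \o entropy_integrand B (M x)).
Proof.
have [mb _ _ _ _] := hb.
have m1 (i : 'I_3) : measurable_fun setT (fun z : coord3 R * coord3 R * coord3 R =>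
    vec z.1.1 i 0 : measurableTypeR R).
  exact: measurableT_comp (measurable_vec_fst i) measurable_fst.
have m2 (i : 'I_3) : measurable_fun setT (fun z : coord3 R * coord3 R * coord3 R =>
    vec z.1.2 i 0 : measurableTypeR R).
  exact: measurableT_comp (measurable_vec_snd i) measurable_fst.
have m3 (i : 'I_3) : measurable_fun setT (fun z : coord3 R * coord3 R * coord3 R =>
    vec z.2 i 0 : measurableTypeR R).
  exact: measurableT_comp (measurable_vec i) measurable_snd.
have me : measurable_fun setT (EFin \o entropy_integrand B (M x)).
  apply/measurable_EFinP; apply: measurable_funM.
    apply: measurable_funM.
      by apply: measurable_kernel => //; exact: mcoefB.
    apply: measurable_funB; apply: measurable_funM; apply: measurable_continuous_coef => //.
      exact: mcoef_post_collision_star.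
    exact: mcoef_post_collision.
  rewrite /M; under eq_fun do rewrite expRK.
  by apply: measurable_continuous_coef => //; exact: continuous_exponent.
apply/integrableP; split => //.
have -> : (\int[mprod leb6 sphere]_z `|(EFin \o entropy_integrand B (M x)) z| = 0)%E.
  apply/(ae_eq_integral_abs (mprod leb6 sphere) measurableT me).
  have := ae_mprod_snd (@leb6 R) (@sphere_unit R); apply: filterS => z s1 _ /=.
  by rewrite /entropy_integrand collision_invariant// subrr mulr0 mul0r.
by rewrite ltry.
Qed.

Let Q_gibbs x v : Q B (M x) (M x) v = 0%E.
Proof.
have [mb _ _ _ _] := hb.
rewrite /Q; set f := fun z => _.
have mf : measurable_fun setT f.
  apply/measurable_EFinP; apply: measurable_funM.
    by apply: measurable_kernel => //; [apply: mcoefB => //; exact: measurable_vec_fst|exact: measurable_vec_snd].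
  have mv := @measurable_vec_fst R; have ms := @measurable_vec_snd R.
  apply: measurable_funB; apply: measurable_funM => //; apply: measurable_continuous_coef => //.
    by apply: mcoef_post_collision_star.
  by apply: mcoef_post_collision.
transitivity (\int[mprod leb3 sphere]_(z in setT) cst 0 (z : coord3 R * coord3 R))%E; last exact: integral0.
apply: ae_eq_integral => //.
have := ae_mprod_snd leb3 (@sphere_unit R); apply: filterS => z s1 _ /=.
by rewrite /f collision_invariant// subrr mulr0.
Qed.

(** The two energy contributions cancel. The rotation contributes nothing, because [cross w x] is
    orthogonal to x and so to the gradient, and [cross v w] is orthogonal to v. *)
Let transport_gibbs : transport_equation Phi (fun _ => M).
Proof.
move=> t x v; have -> : 'D_(grad Phi x) (M x) v - 'D_v (fun y => M y v) x = 0.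
  have h1 : is_derive v (grad Phi x) (M x) (M x v * (l * dot v (grad Phi x) + dot (cross w x) (grad Phi x))).
    apply: (is_derive_comp1 (is_derive_expR _)).
    have -> : E x = cst (a + l * Phi x) + l \*: (fun u => dot u u / 2) + dot (cross w x).
      apply/funext => u; rewrite /E /gibbs_exponent /= mulrDr addrA //.
    apply: is_deriveD; last exact: is_derive_dot.
    have := is_deriveD (is_derive_cst (a + l * Phi x) v (grad Phi x))
      (is_deriveZ l (is_derive_sqr v (grad Phi x))).
    by rewrite add0r.
  have h2 : is_derive x v (fun y => M y v) (M x v * (l * (psi x * dot x v))).
    apply: (is_derive_comp1 (is_derive_expR _)).
    have -> : (fun y => E y v) = cst (a + l * (dot v v / 2)) + l \*: Phi + dot (cross v w).
      apply/funext => u; rewrite /E /gibbs_exponent /=.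
      have -> : dot (cross w u) v = dot (cross v w) u by rewrite !dotE /cross !mxE /=; ring.
      by transitivity (a + l * (dot v v / 2) + l * Phi u + dot (cross v w) u); [ring|].
    have -> : l * (psi x * dot x v) = 0 + l * (psi x * dot x v) + dot (cross v w) v.
      by rewrite [dot (cross v w) v]dotC dot_crossl addr0 add0r.
    apply: is_deriveD; last exact: is_derive_dot.

  rewrite (@derive_val _ _ _ _ _ _ _ h1) (@derive_val _ _ _ _ _ _ _ h2) gradPhi.
  by rewrite !dotZr (dotC (cross w x)) dot_crossr (dotC v); ring.
apply: cvg_near_cst; apply: nearW => s /=.
by rewrite subrr mul0r.
Qed.

(** Half of the decay, given up by passing from [l] to [l / 2], pays for the weight in [total]. *)
Lemma gibbs_equilibrium : l < 0 ->
  (\int[leb6]_z (expR (gibbs_exponent Phi a (l / 2) w (vec z.1) (vec z.2)))%:E < +oo)%E ->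
  equilibria Phi B (fun _ x v => expR (gibbs_exponent Phi a l w x v)).
Proof.
move=> l0 Il; split.
- by split=> [_ x v|_ x]; [exact: differentiable_gibbs|exact: integrable_entropy].
- by move=> *; exact: expR_gt0.
- move=> _; rewrite /total.
  have mE := measurable_gibbs_exponent a l w cPhi.
  have mE2 := measurable_gibbs_exponent a (l / 2) w cPhi.
  have mP : measurable_fun setT (fun z : coord3 R * coord3 R => Phi (vec z.1) : measurableTypeR R).
    by apply: measurable_continuous_coef => //; exact: measurable_vec_fst.
  have mn : measurable_fun setT (fun z : coord3 R * coord3 R => enorm (vec z.2) : measurableTypeR R).
    by apply: measurable_enorm_coef; exact: measurable_vec_snd.
  (* With y the energy, the weight is at most 1 + 2 y, and k (1 - (l / 2) y) = 1 + 2 y - (l / 2) y -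
     4 / l: this k produces the coefficient 2, and the rest is nonnegative. *)
  pose k := 1 - 4 / l; have k0 : 0 <= k by rewrite /k -[4 / l]opprK -mulrN -invrN; apply: addr_ge0 => //; rewrite opprK divr_ge0// oppr_ge0 ltW.
  apply: (@le_lt_trans _ _ (\int[leb6]_z (k%:E *
    (expR (gibbs_exponent Phi a (l / 2) w (vec z.1) (vec z.2)))%:E))%E).
    apply: ge0_le_integral => //.
    + move=> z _; rewrite lee_fin mulr_ge0// ?expR_ge0// !addr_ge0// sqr_ge0//.
    + apply/measurable_EFinP; apply: measurable_funM; last exact: measurableT_comp.
      by do 2?apply: measurable_funD => //; exact: measurable_funX.
    + apply: emeasurable_funM => //; apply/measurable_EFinP; exact: measurableT_comp.
    + move=> z _; rewrite -EFinM lee_fin enorm_sqr.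
      set x := vec z.1; set v := vec z.2; set y := Phi x + dot v v / 2.
      have y0 : 0 <= y by rewrite addr_ge0// divr_ge0// dot_ge0.
      have -> : gibbs_exponent Phi a (l / 2) w x v = - (l / 2) * y + gibbs_exponent Phi a l w x v.
        by rewrite /gibbs_exponent -/y; lra.
      rewrite [X in k * X]expRD mulrA; apply: ler_wpM2r; first exact: expR_ge0.
      have P0 := Phi_ge0 x; have V0 := dot_ge0 v.
      apply: (@le_trans _ _ (k * (1 + - (l / 2) * y))); last first.
        by rewrite ler_wpM2l// expR_ge1Dx.
      have -> : k * (1 + - (l / 2) * y) = 1 + 2 * y - l / 2 * y + (- 4 / l).
        by rewrite /k; field; rewrite lt_eqF.
      have : 0 <= - 4 / l by rewrite mulNr -mulrN -invrN divr_ge0// oppr_ge0 ltW.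
      have : 0 <= - (l / 2 * y) by rewrite -mulNr mulr_ge0//; lra.
      rewrite /y; lra.
  rewrite ge0_integralZl//; first exact: lte_mul_pinfty.
  by apply/measurable_EFinP; exact: measurableT_comp.
- exact: transport_gibbs.
- by move=> _ x v; exact: Q_gibbs.
Qed.

End gibbs_equilibrium.

(** * Moments of exponential families *)

(* The sets {y in K | J y <= J z}, z in K, form a filter basis, which makes
   compactness applicable without mentioning the infimum of J. *)
Lemma compact_lsc_min (R : realType) (X : topologicalType) (K : set X) (J : X -> \bar R) :
  compact K -> K !=set0 ->
  (forall x c, K x -> (c < J x)%E -> \forall y \near x, (c < J y)%E) ->
  exists2 x, K x & forall y, K y -> (J x <= J y)%E.
Proof.
move=> cK [x0 Kx0] lsc; apply: contrapT => noMin.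
have {}noMin x : K x -> exists2 y, K y & (J y < J x)%E.
  move=> Kx; apply: contrapT => h; apply: noMin; exists x => // y Ky.
  by rewrite leNgt; apply/negP => yx; apply: h; exists y.
pose B (z : X) := [set y | K y /\ (J y <= J z)%E].
have FF : Filter (filter_from K B).
  apply: filter_from_filter; first by exists x0.
  move=> i j Ki Kj; have [ij|/ltW ji] := leP (J i) (J j).
    by exists i => // y [Ky yi]; do 2?split => //; exact: le_trans ij.
  by exists j => // y [Ky yj]; do 2?split => //; exact: le_trans ji.
have /compact_near_coveringP/(_ _ _ (fun z x => (J z < J x)%E) FF) := cK.
case=> [x Kx|z Kz h].
  have [y Ky yx] := noMin x Kx.
  exists ([set x' | (J y < J x')%E], B y) => /=.
    by split; [exact: lsc|exists y].
  by move=> [x' z] /= [yx' [_ zy]]; exact: le_lt_trans yx'.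
by have /(_ _ Kz) := h z (conj Kz (lexx _)); rewrite ltxx.
Qed.

Section exponential_inequalities.
Context {R : realType}.

Lemma expR_le_quadratic (y : R) : expR y <= 1 + y + y ^+ 2 * expR `|y|.
Proof.
have h1 : expR y - 1 <= y * expR y.
  have := expR_ge1Dx (- y); rewrite expRN => h.
  have := ler_wpM2l (expR_ge0 y) h; rewrite mulfV ?gt_eqF ?expR_gt0//; lra.
have h2 : y * (expR y - 1) <= y ^+ 2 * expR `|y|.
  have [y0|y0] := leP 0 y.
    by rewrite ger0_norm// expr2 -mulrA ler_wpM2l.
  rewrite ltr0_norm//; have := expR_ge1Dx y; have : 1 <= expR (- y).
    by rewrite -[leLHS]expR0 ler_expR oppr_ge0 ltW.
  move=> e1 e2; apply: (@le_trans _ _ (y ^+ 2)).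
    by rewrite expr2; nra.
  by rewrite ler_peMr// sqr_ge0.
by move: h2; rewrite mulrBr mulr1; lra.
Qed.

Lemma expR_ge_sqr (y : R) : 0 <= y -> y ^+ 2 / 2 <= expR y.
Proof.
by move=> y0; apply: le_trans (expR_ge1Dxn 1 y0); rewrite lerDr.
Qed.

Lemma expR_norm_le (y : R) : expR `|y| <= expR y + expR (- y).
Proof.
have [y0|y0] := leP 0 y; first by rewrite ger0_norm// lerDl expR_ge0.
by rewrite ltr0_norm// lerDr expR_ge0.
Qed.

(** The first-order condition at a minimum: divide by small t of either sign. *)
Lemma eq_of_quadratic_bound (e v g k : R) : 0 < e -> 0 <= k ->
  (forall t, `|t| <= e -> t * v <= t * g + t ^+ 2 * k) -> g = v.
Proof.
move=> e0 k0 h.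
have close (r : R) : (forall t : R, 0 < t -> t <= e -> r <= t * k) -> r <= 0.
  move=> hr; rewrite leNgt; apply/negP => r0.
  pose t := Num.min e (r / (2 * (k + 1))).
  have t0 : 0 < t by rewrite lt_min e0 divr_gt0// mulr_gt0// ltr_wpDl.
  have := hr t t0; rewrite ge_min lexx => /(_ isT).
  apply/negP; rewrite -ltNge; apply: (@le_lt_trans _ _ (r / (2 * (k + 1)) * k)).
    by rewrite ler_wpM2r// ge_min lexx orbT.
  rewrite mulrAC ltr_pdivrMr ?mulr_gt0 ?ltr_wpDl// ltr_pM2l//; lra.
apply/eqP; rewrite eq_le; apply/andP; split; rewrite -subr_le0; apply: close => t t0 te.
  have := h (- t); rewrite normrN gtr0_norm// => /(_ te) ht.
  by rewrite -(ler_pM2l t0); lra.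
have := h t; rewrite gtr0_norm// => /(_ te) ht; rewrite -(ler_pM2l t0); lra.
Qed.

End exponential_inequalities.

Section exponential_family.
Context {R : realType} {d} {T : measurableType d}.
Variables (mu : {measure set T -> \bar R}) (n : nat) (phi : 'I_n -> T -> R) (V : 'I_n -> R).
Hypothesis mphi : forall i, measurable_fun setT (phi i).
Implicit Types (L : 'rV[R]_n).

Definition pairing (c : 'I_n -> R) L : R := \sum_i L 0 i * c i.

Definition partition_function L : \bar R :=
  (\int[mu]_z (expR (pairing (phi ^~ z) L))%:E)%E.

Hypothesis finite_somewhere : exists L, (partition_function L < +oo)%E.
(** Room on both sides in each coordinate direction dominates [phi] times the density, and makes a
    minimizer a critical point. *)
Hypothesis open_domain : forall L (i : 'I_n), (partition_function L < +oo)%E ->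
  exists2 e : R, 0 < e & forall s, `|s| = e ->
    (partition_function (L + s *: delta_mx 0 i)%R < +oo)%E.
(** Along a ray s L, one of the two terms of the functional then tends to +oo: the linear one in the
    first case, the integral in the second. *)
Hypothesis nondegenerate : forall L, L != 0 -> pairing V L < 0 \/
  ~ mu.-negligible [set z | 0 < pairing (phi ^~ z) L].

Let J L : \bar R := (partition_function L - (pairing V L)%:E)%E.
Let l1 (c : 'I_n -> R) : R := \sum_i `|c i|.

Let l1_ge0 c : 0 <= l1 c.
Proof. by apply: sumr_ge0. Qed.

Let coord_le L i : `|L 0 i| <= `|L|.
Proof.
rewrite [leRHS]/Num.norm /= mx_normrE.
exact: (@le_bigmax _ _ _ 0 (fun ij : 'I_1 * 'I_n => `|L ij.1 ij.2|) (0, i)).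
Qed.

Let pairing_le c L : `|pairing c L| <= `|L| * l1 c.
Proof.
apply: le_trans (ler_norm_sum _ _ _) _; rewrite mulr_sumr ler_sum// => i _.
by rewrite normrM ler_wpM2r.
Qed.

Let pairingD c L1 L2 : pairing c (L1 + L2) = pairing c L1 + pairing c L2.
Proof. by rewrite -big_split; apply: eq_bigr => i _; rewrite mxE mulrDl. Qed.

Let pairingZ c k L : pairing c (k *: L) = k * pairing c L.
Proof. by rewrite mulr_sumr; apply: eq_bigr => i _; rewrite mxE mulrA. Qed.

Let pairingB c L1 L2 : pairing c (L1 - L2) = pairing c L1 - pairing c L2.
Proof. by rewrite pairingD -scaleN1r pairingZ mulN1r. Qed.

Let pairing_near c L1 L2 : `|pairing c L1 - pairing c L2| <= `|L1 - L2| * l1 c.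
Proof. by rewrite -pairingB. Qed.

Let pairing_delta c s i : pairing c (s *: delta_mx 0 i) = s * c i.
Proof.
rewrite pairingZ /pairing (bigD1 i)//= big1 ?addr0 ?mxE ?eqxx ?mul1r// => j ji.
by rewrite mxE (negbTE ji) andbF mul0r.
Qed.

Let measurable_pairing L : measurable_fun setT (fun z => pairing (phi ^~ z) L).
Proof. by apply: measurable_sum => i; exact: measurable_funM. Qed.

Let measurable_density L : measurable_fun setT (fun z => (expR (pairing (phi ^~ z) L))%:E).
Proof. by apply/measurable_EFinP; exact: measurableT_comp. Qed.

Let density_ge0 L z : (0 <= (expR (pairing (phi ^~ z) L))%:E)%E.
Proof. by rewrite lee_fin expR_ge0. Qed.

(** On this set all of [phi] is bounded by k, so replacing L by L' changes the density by at most a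
    factor exp (k |L' - L|). *)
Let A (k : nat) := [set z | l1 (phi ^~ z) <= k%:R].

Let mA k : measurable (A k).
Proof.
have ml : measurable_fun setT (fun z => l1 (phi ^~ z)).
  by apply: measurable_sum => i; exact: measurableT_comp.
rewrite -[A k]setTI; have -> : A k = (fun z => l1 (phi ^~ z)) @^-1` `]-oo, k%:R].
  by apply/seteqP; split => z /=; rewrite in_itv.
by apply: ml => //; exact: measurable_itv.
Qed.

Let A_nondecreasing : nondecreasing_seq A.
Proof.
move=> j k jk; rewrite subsetEset => z /= h; apply: le_trans h _.
by rewrite ler_nat.
Qed.

Let A_cover : \bigcup_k A k = setT.
Proof.
apply/seteqP; split => // z _.
by exists (Num.bound (l1 (phi ^~ z))) => //=; apply: ltW; exact: archi_boundP.
Qed.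

Let near_dist L (e : R) : 0 < e -> \forall L' \near L, `|L - L'| < e.
Proof. by move=> e0; apply: (@cvgr_dist_lt _ _ _ (nbhs L) _ id L _ _ e0); exact: cvg_id. Qed.

(** The integrals over [A k] increase to the partition function, so one of them already exceeds the
    level; on [A k] the density varies in a controlled way, so the excess persists nearby. *)
Let lsc_J L c : (c < J L)%E -> \forall L' \near L, (c < J L')%E.
Proof.
move=> cJ; have cy : (c < +oo)%E by apply: lt_le_trans cJ _; rewrite leey.
rewrite /J lteBrDr// in cJ.
pose S k := (\int[mu]_(z in A k) (expR (pairing (phi ^~ z) L))%:E)%E.
have [k Sk] : exists k, (c + (pairing V L)%:E < S k)%E.
  apply: contrapT => /forallNP h; move: cJ; apply/negP; rewrite -leNgt.
  have := @ge0_nondecreasing_set_cvg_integral _ _ _ A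
    (fun z => (expR (pairing (phi ^~ z) L))%:E) mu A_nondecreasing mA
    (fun k => measurable_funTS (measurable_density L)) (fun k z _ => density_ge0 L z).
  rewrite A_cover => cS; rewrite /partition_function -(cvg_lim _ cS)//.
  apply: lime_le; first by apply/cvg_ex; exists (partition_function L).
  by apply: nearW => k; rewrite leNgt; apply/negP; exact: h.
have low L' : ((expR (- (`|L' - L| * k%:R)))%:E * S k <= partition_function L')%E.
  rewrite /S -ge0_integralZl//; last exact: measurable_funTS (measurable_density L).
  apply: (@le_trans _ _ (\int[mu]_(z in A k) (expR (pairing (phi ^~ z) L'))%:E)%E).
    apply: ge0_le_integral => //.
    - by apply: emeasurable_funM => //; exact: measurable_funTS (measurable_density L).
    - exact: measurable_funTS (measurable_density L').
    - move=> z Az; rewrite -EFinM lee_fin -expRD ler_expR.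
      have := pairing_near (phi ^~ z) L' L; have : `|L' - L| * l1 (phi ^~ z) <= `|L' - L| * k%:R.
        by rewrite ler_wpM2l.
      by rewrite ler_norml => h1 /andP[h2 h3]; lra.
  apply: ge0_subset_integral => //.
have S0 : (0 <= S k)%E by exact: integral_ge0.
case: (S k) Sk S0 low => [s| |]// Sk S0 low; last first.
  near=> L'; have := low L'; rewrite gt0_muley ?lte_fin ?expR_gt0// leye_eq => /eqP E.
  by rewrite /J E.
case: c cy cJ Sk => [c| |]// cy cJ Sk; last first.
  near=> L'; rewrite lteBrDr//; apply: lt_le_trans (low L').
  by rewrite -EFinM ltNyr.
rewrite -EFinD lte_fin in Sk; rewrite lee_fin in S0.
(* A displacement r = |L' - L| costs at most r k s in the integral and r [l1 V] in the pairing; the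
   summand 1 keeps the denominator positive. *)
pose g := (s - (c + pairing V L)) / (l1 V + k%:R * s + 1).
have W0 : 0 < l1 V + k%:R * s + 1.
  by rewrite ltr_wpDl// addr_ge0// mulr_ge0.
have g0 : 0 < g by rewrite divr_gt0// subr_gt0.
near=> L'.
have Lg : `|L' - L| < g by rewrite distrC; near: L'; exact: near_dist.
rewrite lteBrDr//; apply: lt_le_trans (low L'); rewrite -EFinD -EFinM lte_fin.
have h1 := pairing_near V L' L; rewrite ler_norml in h1; case/andP: h1 => _ h1.
have h2 : (1 - `|L' - L| * k%:R) * s <= expR (- (`|L' - L| * k%:R)) * s.
  by rewrite ler_wpM2r// expR_ge1Dx.
have h3 : `|L' - L| * (l1 V + k%:R * s + 1) < s - (c + pairing V L).
  by rewrite -ltr_pdivlMr.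
by have := normr_ge0 (L' - L); lra.
Unshelve. all: by end_near. Qed.

Let integral_ge_cst (B : set T) (k : R) L : measurable B -> 0 <= k ->
  (forall z, B z -> k <= expR (pairing (phi ^~ z) L)) ->
  (k%:E * mu B <= partition_function L)%E.
Proof.
move=> mB k0 h; rewrite -integral_cst//.
apply: (@le_trans _ _ (\int[mu]_(z in B) (expR (pairing (phi ^~ z) L))%:E)%E).
  apply: ge0_le_integral => //.
  exact: measurable_funTS (measurable_density L).
exact: ge0_subset_integral.
Qed.

(** Growth is stated uniformly near a direction, so that compactness of the unit sphere applies. If
    V . L < 0, the linear term grows; otherwise the integral grows at least quadratically in s,
    thanks to a set [B k] of positive measure where the exponent is at least 1/(k + 1). *)
Let coercive_direction (K : R) L : `|L| = 1 ->
  \forall L' \near L & s \near +oo, (K%:E <= J (s *: L'))%E.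
Proof.
move=> L1; have L0 : L != 0 by rewrite -normr_eq0 L1 oner_eq0.
have W0 := l1_ge0 V.
have [VL|nN] := nondegenerate L0.
  pose e := - pairing V L / (2 * (l1 V + 1)).
  have e0 : 0 < e by rewrite divr_gt0 ?oppr_gt0// mulr_gt0// ltr_wpDl.
  pose s0 := 2 * `|K| / - pairing V L.
  exists ([set L' | `|L - L'| < e], [set s | s0 < s]) => /=.
    split; first exact: near_dist.
    by apply: nbhs_pinfty_gt; rewrite num_real.
  move=> [L' s] /= [Le ss].
  have s00 : 0 <= s0 by rewrite divr_ge0 ?mulr_ge0// oppr_ge0 ltW.
  have h1 := pairing_near V L L'; rewrite ler_norml in h1; case/andP: h1 => h1 _.
  have h2 : `|L - L'| * l1 V <= - pairing V L / 2.
    apply: (@le_trans _ _ (e * (l1 V + 1))).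
      by apply: ler_pM => //; [exact: ltW|lra].
    by rewrite /e le_eqVlt; apply/orP; left; apply/eqP; field; lra.
  apply: (@le_trans _ _ (- (s * pairing V L'))%:E).
    rewrite lee_fin; apply: le_trans (ler_norm K) _.
    have h3 : `|K| <= s * (- pairing V L / 2).
      rewrite -ler_pdivrMr; last by rewrite divr_gt0// oppr_gt0.
      apply: le_trans (ltW ss); rewrite /s0 le_eqVlt; apply/orP; left; apply/eqP.
      by field; rewrite lt_eqF.
    apply: le_trans h3 _; rewrite -mulrN ler_wpM2l//; first exact: le_trans (ltW ss).
    by lra.
  rewrite /J pairingZ -[leLHS]add0e EFinN leeD2r//.
  exact: integral_ge0.
pose B (k : nat) := A k `&` [set z | k.+1%:R^-1 <= pairing (phi ^~ z) L].
have mB k : measurable (B k).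
  apply: measurableI => //; rewrite -[X in measurable X]setTI.
  have -> : [set z | k.+1%:R^-1 <= pairing (phi ^~ z) L] =
      (fun z => pairing (phi ^~ z) L) @^-1` `[k.+1%:R^-1, +oo[.
    by apply/seteqP; split => z /=; rewrite in_itv/= andbT.
  by apply: measurable_pairing => //; exact: measurable_itv.
have [k muB] : exists k, (0 < mu (B k))%E.
  apply: contrapT => /forallNP h; apply: nN.
  apply: (negligibleS (A := \bigcup_k B k)).
    move=> z /= pz; have [k1 _ h1] : (\bigcup_k A k) z by rewrite A_cover.
    have := archi_boundP (ltW (_ : 0 < (pairing (phi ^~ z) L)^-1)).
    rewrite invr_gt0 pz => /(_ isT); set k2 := Num.bound _ => h2.
    exists (maxn k1 k2) => //; split; rewrite /A /=.
      by apply: le_trans h1 _; rewrite ler_nat leq_maxl.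
    rewrite -[leRHS]invrK lef_pV2 ?posrE ?invr_gt0//.
    by apply: le_trans (ltW h2) _; rewrite ler_nat leqW// leq_maxr.
  apply: negligible_bigcup => k; apply/negligibleP => //; apply/eqP.
  by have /negP := h k; rewrite lt0e negb_and measure_ge0 orbF negbK.
(* The measure of [B k] may be infinite; a positive real lower bound is enough. *)
have [m [m0 mB']] : exists m : R, 0 < m /\ (m%:E <= mu (B k))%E.
  case: (mu (B k)) muB => [r| |]//; first by rewrite lte_fin => r0; exists r.
  by exists 1; split => //; rewrite leey.
(* For |L - L'| < e, the exponent on [B k] loses at most e (k + 1) = ep, which is half of 1/(k +
   1). *)
pose e : R := (2 * k.+1%:R * k.+1%:R)^-1; pose ep : R := (2 * k.+1%:R)^-1.
have e0 : 0 < e by rewrite invr_gt0 !mulr_gt0.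
have ep0 : 0 < ep by rewrite invr_gt0 mulr_gt0.
have e1 : e <= 1.
  by rewrite invf_le1 ?mulr_gt0// -!natrM -[1]/(1%:R) ler_nat muln_gt0.
(* For s > s0 one gets s (m ep^2 s / 2 - 2 [l1 V]) >= |K|; this enters through exp y >= y^2 / 2 and
   |L'| <= 2. *)
pose s0 := 1 + 2 * (2 * l1 V + `|K|) / (m * ep ^+ 2).
exists ([set L' | `|L - L'| < e], [set s | s0 < s]) => /=.
  split; first exact: near_dist.
  by apply: nbhs_pinfty_gt; rewrite num_real.
move=> [L' s] /= [Le ss].
have me0 : 0 < m * ep ^+ 2 by rewrite mulr_gt0// exprn_gt0.
have s1 : 1 <= s.
  apply: le_trans (ltW ss); rewrite lerDl divr_ge0//; last exact: ltW.
  by rewrite mulr_ge0// addr_ge0// mulr_ge0.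
have sge0 : 0 <= s by lra.
have sK : 2 * l1 V + `|K| <= m * ep ^+ 2 / 2 * s.
  rewrite -ler_pdivrMl ?divr_gt0//; apply: le_trans (ltW ss).
  have -> : s0 = 1 + (m * ep ^+ 2 / 2)^-1 * (2 * l1 V + `|K|).
    by rewrite /s0; congr (_ + _); field; rewrite !gt_eqF.
  by rewrite lerDr.
have I1 : ((expR (s * ep))%:E * mu (B k) <= partition_function (s *: L'))%E.
  apply: integral_ge_cst; rewrite ?expR_ge0// => z [Az pz].
  rewrite ler_expR pairingZ ler_wpM2l//.
  have := pairing_near (phi ^~ z) L L'; rewrite ler_norml => /andP[_ h1].
  have h2 : `|L - L'| * l1 (phi ^~ z) <= e * k.+1%:R.
    apply: ler_pM => //; first exact: ltW.
    by apply: le_trans Az _; rewrite ler_nat.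
  have h3 : e * k.+1%:R = ep by rewrite /e /ep; field; rewrite ?pnatr_eq0.
  have h4 : k.+1%:R^-1 = ep + ep by rewrite /ep; field; rewrite ?pnatr_eq0.
  by move: h1 h2 pz => /=; rewrite h3 h4; lra.
have N2 : `|L'| <= 2.
  have := ler_normB L (L - L'); rewrite subKr L1; lra.
have h5 := pairing_le V L'.
apply: (@le_trans _ _ (m * (s ^+ 2 * ep ^+ 2 / 2) - s * (2 * l1 V))%:E).
  rewrite lee_fin; apply: le_trans (ler_norm K) _.
  have -> : m * (s ^+ 2 * ep ^+ 2 / 2) - s * (2 * l1 V) = s * (m * ep ^+ 2 / 2 * s - 2 * l1 V) by ring.
  by apply: le_trans (ler_wpM2l sge0 (_ : `|K| <= _)); [rewrite ler_peMl|lra].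
rewrite /J EFinB; apply: leeB.
  apply: le_trans I1; apply: (@le_trans _ _ ((expR (s * ep))%:E * m%:E)%E).
    rewrite -EFinM lee_fin mulrC ler_wpM2r//; first exact: ltW.
    by rewrite -exprMn; apply: expR_ge_sqr; rewrite mulr_ge0// ltW.
  by rewrite lee_wpmul2l// lee_fin expR_ge0.
rewrite lee_fin pairingZ ler_wpM2l//; apply: le_trans (ler_norm _) _.
by apply: le_trans h5 _; rewrite ler_wpM2r.
Qed.

(** Compactness of the unit sphere turns the local thresholds for s into a common one. *)
Let coercive (K : R) : exists r : R, forall L, r < `|L| -> (K%:E <= J L)%E.
Proof.
pose S := [set L : 'rV[R]_n | `|L| = 1].
have cS : compact S.
  apply: bounded_closed_compact.
    by exists 1; split => // M M1 L /= ->; exact: ltW.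
  have -> : S = (fun L => `|L|) @^-1` [set 1] by [].
  apply: closed_comp => [L _|]; last exact: closed_eq.
  exact: norm_continuous.
have /compact_near_coveringP/(_ _ (+oo : set_system R) (fun s L => (K%:E <= J (s *: L))%E)) := cS.
case=> [L /= L1|M [Mr MK]]; first exact: coercive_direction.
exists (Num.max M 0) => L; rewrite gt_max => /andP[ML L0].
have := MK _ ML (`|L|^-1 *: L); rewrite scalerA mulfV ?gt_eqF// scale1r; apply.
by rewrite /S /= normrZ normfV normr_id mulVf// gt_eqF.
Qed.

Let minimizer : exists2 L, (partition_function L < +oo)%E & forall L', (J L <= J L')%E.
Proof.
have [L0 I0] := finite_somewhere.
have JL0 : J L0 \is a fin_num.
  by rewrite fin_numB/= andbT ge0_fin_numE//; exact: integral_ge0.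
have [r rJ] := coercive (fine (J L0)).
pose S := [set L : 'rV[R]_n | `|L| <= Num.max r `|L0|].
have cS : compact S.
  apply: bounded_closed_compact.
    exists (Num.max r `|L0|); split => [|M M1 L /= h]; first exact: num_real.
    exact: le_trans (ltW M1).
  have -> : S = (fun L => `|L|) @^-1` [set x | x <= Num.max r `|L0|] by [].
  apply: closed_comp => [L _|]; last exact: closed_le.
  exact: norm_continuous.
have S0 : S L0 by rewrite /S /= le_max lexx orbT.
have [L SL Lmin] := compact_lsc_min cS (ex_intro _ _ S0) (fun L c _ => @lsc_J L c).
have Lmin' L' : (J L <= J L')%E.
  have [h|h] := leP `|L'| (Num.max r `|L0|); first exact: Lmin.
  apply: le_trans (Lmin _ S0) _; rewrite -(fineK JL0); apply: rJ.
  by apply: le_lt_trans h; rewrite le_max lexx.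
exists L => //; rewrite ltey; apply/eqP => IL.
have := Lmin' L0; rewrite {1}/J IL leye_eq => /eqP E.
by move: JL0; rewrite E.
Qed.

(** The partition function is not differentiated. A quadratic upper bound for exp, integrated
    against the dominating function [h], turns minimality into t V_i <= t G + O(t^2) for small t of
    both signs. *)
Theorem exponential_family_moments : exists2 L, (partition_function L < +oo)%E &
  forall i, mu.-integrable setT (fun z => (phi i z * expR (pairing (phi ^~ z) L))%:E) /\
    (\int[mu]_z (phi i z * expR (pairing (phi ^~ z) L))%:E = (V i)%:E)%E.
Proof.
have [L IL Lmin] := minimizer; exists L => // i.
have [e e0 eI] := open_domain i IL.
set p := fun z => pairing (phi ^~ z) L.
pose h z := expR (p z + e * phi i z) + expR (p z - e * phi i z).
have mp : measurable_fun setT p by exact: measurable_pairing.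
have mh : measurable_fun setT h.
  apply: measurable_funD; apply: measurableT_comp => //.
    by apply: measurable_funD => //; exact: measurable_funM.
  by apply: measurable_funB => //; exact: measurable_funM.
have h0 z : 0 <= h z by rewrite addr_ge0// expR_ge0.
have ih : mu.-integrable setT (EFin \o h).
  apply/integrableP; split; first exact/measurable_EFinP.
  have -> : (\int[mu]_z `|(EFin \o h) z| = partition_function (L + e *: delta_mx 0 i)%R +
      partition_function (L + (- e) *: delta_mx 0 i)%R)%E.
    rewrite /partition_function -ge0_integralD//; apply: eq_integral => z _ /=.
    by rewrite ger0_norm// -EFinD !pairingD !pairing_delta mulNr.
  by apply: lte_add_pinfty; apply: eI; rewrite ?normrN gtr0_norm.
have he z : expR (p z) * expR (e * `|phi i z|) <= h z.
  have -> : e * `|phi i z| = `|e * phi i z| by rewrite normrM gtr0_norm.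
  by rewrite /h !expRD -mulrDr ler_wpM2l ?expR_ge0// expR_norm_le.
have iphi : mu.-integrable setT (fun z => (phi i z * expR (p z))%:E).
  apply: (@le_integrable _ _ _ mu setT measurableT _ (fun z => (e^-1 * h z)%:E)).
  - apply/measurable_EFinP; apply: measurable_funM => //; exact: measurableT_comp.
  - move=> z _ /=; rewrite lee_fin [leRHS]ger0_norm; last by rewrite mulr_ge0// invr_ge0 ltW.
    rewrite normrM (ger0_norm (expR_ge0 _)) ler_pdivlMl// mulrA.
    apply: le_trans (he z); rewrite mulrC ler_wpM2l ?expR_ge0//.
    by apply: le_trans (expR_ge1Dx _); rewrite lerDr.
  - have := integrableZl measurableT e^-1 ih; apply: eq_integrable => // z _ /=.
split => //.
have iexp : mu.-integrable setT (fun z => (expR (p z))%:E).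
  apply/integrableP; split; first exact: measurable_density.
  by under eq_integral do rewrite gee0_abs ?lee_fin ?expR_ge0//.
pose G := (\int[mu]_z (phi i z * expR (p z)))%R.
(* From y^2 / 2 <= exp y at y = e |u| / 2: this gives u^2 <= (8 / e^2) exp (e |u| / 2), and the same
   exponential is left to control the quadratic remainder. *)
pose C := 8 / e ^+ 2; pose H := (\int[mu]_z (h z))%R.
have C0 : 0 <= C by rewrite divr_ge0// sqr_ge0.
have H0 : 0 <= H by apply: Rintegral_ge0.
have GE : (\int[mu]_z (phi i z * expR (p z))%:E = G%:E)%E.
  by rewrite /G /Rintegral fineK//; exact: integrable_fin_num.
have HE : (\int[mu]_z (h z)%:E = H%:E)%E.
  by rewrite /H /Rintegral fineK//; exact: integrable_fin_num.
have taylor t z : `|t| <= e / 2 -> expR (p z + t * phi i z) <=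
    expR (p z) + t * (phi i z * expR (p z)) + t ^+ 2 * C * h z.
  move=> te; rewrite expRD.
  apply: le_trans (ler_wpM2l (expR_ge0 _) (expR_le_quadratic _)) _.
  rewrite [leLHS]mulrDr [X in X + _ <= _]mulrDr mulr1 -!addrA lerD2l; apply: lerD; first by rewrite mulrCA (mulrC (expR _)).
  rewrite exprMn; set u := phi i z.
  have u1 : u ^+ 2 <= C * expR (e / 2 * `|u|).
    have e20 : 0 <= e / 2 * `|u| by rewrite mulr_ge0// divr_ge0// ltW.
    have := ler_wpM2l C0 (expR_ge_sqr e20); apply: le_trans.
    rewrite exprMn real_normK ?num_real// /C le_eqVlt; apply/orP; left; apply/eqP.
    by field; rewrite gt_eqF.
  have u2 : expR `|t * u| <= expR (e / 2 * `|u|) by rewrite ler_expR normrM ler_wpM2r.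
  have u3 : expR (e / 2 * `|u|) * expR (e / 2 * `|u|) = expR (e * `|u|).
    by rewrite -expRD -mulrDl -splitr.
  apply: (@le_trans _ _ (t ^+ 2 * C * (expR (p z) * expR (e * `|u|)))).
    rewrite -u3; have -> : t ^+ 2 * C * (expR (p z) * (expR (e / 2 * `|u|) * expR (e / 2 * `|u|))) =
      expR (p z) * (t ^+ 2 * (C * expR (e / 2 * `|u|)) * expR (e / 2 * `|u|)) by ring.
    rewrite ler_wpM2l ?expR_ge0//; apply: ler_pM => //.
    - by apply: mulr_ge0; exact: sqr_ge0.
    - by apply: ler_wpM2l => //; exact: sqr_ge0.
  by apply: ler_wpM2l => //; apply: mulr_ge0 => //; exact: sqr_ge0.
have stat (t : R) : `|t| <= e / 2 -> t * V i <= t * G + t ^+ 2 * C * H.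
  move=> te; have := Lmin (L + t *: delta_mx 0 i)%R.
  have pE z : pairing (phi ^~ z) (L + t *: delta_mx 0 i)%R = p z + t * phi i z.
    by rewrite pairingD pairing_delta.
  have Ile : (partition_function (L + t *: delta_mx 0 i)%R <=
      partition_function L + (t * G + t ^+ 2 * C * H)%:E)%E.
    have i1 := integrableZl measurableT t iphi.
    have i2 := integrableZl measurableT (t ^+ 2 * C) ih.
    apply: (@le_trans _ _ (\int[mu]_z ((expR (p z))%:E + (t%:E * (phi i z * expR (p z))%:E +
        (t ^+ 2 * C)%:E * (h z)%:E)))%E).
      apply: ge0_le_integral => //.

      - apply: emeasurable_funD; first exact: measurable_density.
        by apply: emeasurable_funD; [exact: measurable_int i1|exact: measurable_int i2].
      - by move=> z _; rewrite -!EFinM -!EFinD lee_fin addrA pE; exact: taylor.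
    rewrite integralD//; last exact: integrableD.
    by rewrite integralD// !integralZl// GE HE -!EFinM -EFinD.
  have fI : partition_function L \is a fin_num by rewrite ge0_fin_numE//; exact: integral_ge0.
  rewrite /J pairingD pairing_delta; move: Ile.
  rewrite -(fineK fI); case: (partition_function (L + _)) => [r| |]//.
  by rewrite -!EFinD !lee_fin; lra.
rewrite GE; congr (_%:E).
apply: (@eq_of_quadratic_bound _ (e / 2) _ _ (C * H)); first by rewrite divr_gt0.
  by rewrite mulr_ge0.
by move=> t te; rewrite mulrA; exact: stat.
Qed.

End exponential_family.

(** * Equilibria and their moments *)

Section gibbs_nonvanishing.
Context {R : realType}.
Implicit Types (x v w : 'cV[R]_3) (Phi : 'cV[R]_3 -> R).

(** A set of full measure is dense, and failure of [P] is an open condition. *)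
Lemma ae_leb6_everywhere (P : 'cV[R]_3 -> 'cV[R]_3 -> Prop) :
  {ae @leb6 R, forall z, P (vec z.1) (vec z.2)} ->
  (forall x v, ~ P x v -> \forall z \near (x, v), ~ P z.1 z.2) ->
  forall x v, P x v.
Proof.
move=> aeP opP x v; apply: contrapT => nP.
have [e /= e0 eP] := (nbhs_ballP _ _).1 (opP x v nP).
have [y [y1 y2]] := ae_leb6_dense x v e0 aeP.
exact: (eP (vec y.1, vec y.2)).
Qed.

Lemma ae_leb6_le0 (f : 'cV[R]_3 * 'cV[R]_3 -> R) : continuous f ->
  {ae @leb6 R, forall z, f (vec z.1, vec z.2) <= 0} -> forall z, f z <= 0.
Proof.
move=> cf h [x v]; apply: (ae_leb6_everywhere (P := fun x v => f (x, v) <= 0) h) => {}x {}v.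
move=> /negP; rewrite -ltNge => fz.
have : \forall z \near (x, v), 0 < f z by exact: (cvgr_gt _ (cf (x, v))).
by apply: filterS => -[y u] /= fy; apply/negP; rewrite -ltNge.
Qed.

Lemma ae_leb6_eq (f g : 'cV[R]_3 * 'cV[R]_3 -> R) : continuous f -> continuous g ->
  {ae @leb6 R, forall z, f (vec z.1, vec z.2) = g (vec z.1, vec z.2)} -> f = g.
Proof.
move=> cf cg h; have cfg : continuous (fun z => `|f z - g z|).
  by move=> z; apply: cvg_norm; apply: cvgB; [exact: cf|exact: cg].
apply/funext => z; apply/eqP; rewrite -subr_eq0 -normr_le0; apply: (ae_leb6_le0 cfg).
by move: h; apply: filterS => y ->; rewrite subrr normr0.
Qed.

Lemma measurable_point3 (y : coord3 R) : measurable [set y].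
Proof.
case: y => -[y1 y2] y3.
have -> : [set (y1, y2, y3)] = ([set y1] `*` [set y2]) `*` [set y3].
  by apply/seteqP; split => [z -> //|[[? ?] ?] [[/= -> ->] ->]].
by apply: measurableX => //; exact: measurableX.
Qed.

Lemma quadratic_gt0 (l a P q : R) : 0 < l -> 0 <= P -> l * q = 2 * `|a| ->
  0 < a + l * (P + (1 + q) ^+ 2 / 2).
Proof.
move=> l0 P0 lq; have := ler_norm (- a); rewrite normrN => na.
have lP : 0 <= l * P by rewrite mulr_ge0// ltW.
have lqq : 0 <= l * q ^+ 2 by rewrite mulr_ge0 ?sqr_ge0// ltW.
have -> : a + l * (P + (1 + q) ^+ 2 / 2) = a + l * P + l / 2 + l * q + l * q ^+ 2 / 2.
  by field.
by have := normr_ge0 a; rewrite lq; lra.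
Qed.

Lemma expR_increments_ge0 (s t : R) : 0 <= (s - t) * (expR s - expR t).
Proof.
have [st|/ltW ts] := leP s t; first by rewrite mulr_le0// subr_le0// ler_expR.
by rewrite mulr_ge0// subr_ge0// ler_expR.
Qed.

(* An exponent with l < 0 is strictly concave in v, so that it vanishes at most
   at one v if it is nowhere positive. *)
Lemma gibbs_exponent_neq0_ae Phi a l w : continuous Phi ->
  (forall x v, gibbs_exponent Phi a l w x v <= 0) -> l < 0 ->
  {ae @leb6 R, forall z, gibbs_exponent Phi a l w (vec z.1) (vec z.2) != 0}.
Proof.
move=> cP E0 l0; have mE := measurable_gibbs_exponent a l w cP.
set E := fun z => _ in mE; pose Z := E @^-1` [set 0].
have mZ : measurable Z by rewrite -[Z]setTI; exact: mE.
exists Z; split => //; last first.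
  by move=> z /= /negP; rewrite negbK => /eqP.
rewrite /leb6 /mprod /=; apply: integral0_eq => y _ /=.
apply/eqP; rewrite -measure_le0.
have [Z0|/set0P[u0 Zu0]] := eqVneq (xsection Z y) set0.
  by rewrite Z0 measure0.
rewrite -(leb3_point u0); apply: le_measure; rewrite ?inE.
- exact: measurable_xsection.
- exact: measurable_point3.
move=> u Zu /=; apply: vec_inj; apply/eqP; rewrite -subr_eq0 -dot_eq0.
have {Zu} Eu : E (y, u) = 0 by move: Zu; rewrite /xsection /= inE.
have {Zu0} Eu0 : E (y, u0) = 0 by move: Zu0; rewrite /xsection /= inE.
move: Eu Eu0; rewrite /E /=; move: (vec u) (vec u0) (vec y) => v v0 x.
have h := E0 x (2^-1 *: (v + v0)).
rewrite /gibbs_exponent !(dotZl, dotZr, dotDl, dotDr) (dotC v0 v) in h.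
rewrite /gibbs_exponent => h1 h2.
have qE : dot (v - v0) (v - v0) = dot v v - dot v v0 - (dot v v0 - dot v0 v0).
  by rewrite dotBl !dotBr (dotC v0 v).
have : 0 <= l * dot (v - v0) (v - v0) by rewrite qE; lra.
by rewrite nmulr_rge0// => q1; rewrite eq_le q1 dot_ge0.
Qed.

End gibbs_nonvanishing.

Section moments_bijection.
Context {R : realType}.
Implicit Types (F G : 'cV[R]_3 -> 'cV[R]_3 -> R).
Variable Phi : 'cV[R]_3 -> R.
Hypothesis cPhi : continuous Phi.
Hypothesis Phi_ge0 : forall x, 0 <= Phi x.
Variables (n : nat) (phi : 'I_n -> coord3 R * coord3 R -> R).
Hypothesis mphi : forall i, measurable_fun setT (phi i).
Hypothesis phi_bound : forall i, exists2 C, 0 <= C & forall z,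
  `|phi i z| <= C * (Phi (vec z.1) + enorm (vec z.2) ^+ 2 + 1).
(** [i1] is the index of the energy, while [A] and [W] read the constant and the rotation vector off
    a parameter. This serves both ranges of p, with [W] identically zero when p < 2. *)
Variables (i1 : 'I_n) (A : 'rV[R]_n -> R) (W : 'rV[R]_n -> 'cV[R]_3).
Let E L x v := gibbs_exponent Phi (A L) (L 0 i1) (W L) x v.
Hypothesis pairingE : forall L z, pairing (phi ^~ z) L = E L (vec z.1) (vec z.2).
Hypothesis parameters_inj : forall L, A L = 0 -> L 0 i1 = 0 -> W L = 0 -> L = 0.
Hypothesis integrableE : forall L,
  (\int[leb6]_z (expR (E L (vec z.1) (vec z.2)))%:E < +oo)%E <-> L 0 i1 < 0.
Variable equilibrium : set ({nonneg R} -> 'cV[R]_3 -> 'cV[R]_3 -> R).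
Hypothesis equilibriumP : forall M, equilibrium M <->
  exists2 L : 'rV[R]_n, L 0 i1 < 0 & forall t x v, M t x v = expR (E L x v).
Hypothesis equilibrium_total : forall M t, equilibrium M -> (Defs.total Phi (M t) < +oo)%E.
Variables (V : Type) (m : ('cV[R]_3 -> 'cV[R]_3 -> R) -> V).

Let on6 F (z : coord3 R * coord3 R) : R := F (vec z.1) (vec z.2).
Let weight (z : coord3 R * coord3 R) : R := Phi (vec z.1) + enorm (vec z.2) ^+ 2 + 1.
Let moment F i := (\int[leb6]_z (phi i z * on6 F z))%R.

Definition admissible F := [/\ measurable_fun setT (on6 F),
  forall x v, 0 <= F x v & (Defs.total Phi F < +oo)%E].

Hypothesis momentsP : forall F G, admissible F -> admissible G ->
  (m F = m G <-> forall i, moment F i = moment G i).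

Let weight_ge1 z : 1 <= weight z.
Proof. by rewrite /weight lerDr addr_ge0// sqr_ge0. Qed.

Let weighted_ge0 F z : (forall x v, 0 <= F x v) -> (0 <= (weight z * on6 F z)%:E)%E.
Proof.
move=> F0; rewrite lee_fin; apply: mulr_ge0; last exact: F0.
exact: le_trans ler01 (weight_ge1 z).
Qed.

Let measurable_weight : measurable_fun setT weight.
Proof.
apply: measurable_funD => //; apply: measurable_funD.
  by apply: measurable_continuous_coef => //; exact: measurable_vec_fst.
by apply: measurable_funX; apply: measurable_enorm_coef; exact: measurable_vec_snd.
Qed.

Let integrable_weight F : admissible F ->
  (@leb6 R).-integrable setT (fun z => (weight z * on6 F z)%:E).
Proof.
move=> [mF F0 tF]; apply/integrableP; split.
  by apply/measurable_EFinP; exact: measurable_funM.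
apply: le_lt_trans tF; rewrite /Defs.total le_eqVlt; apply/orP; left; apply/eqP.
by apply: eq_integral => z _; rewrite gee0_abs//; exact: weighted_ge0.
Qed.

Lemma integrable_moment F i : admissible F ->
  (@leb6 R).-integrable setT (fun z => (phi i z * on6 F z)%:E).
Proof.
move=> aF; have [mF F0 _] := aF; have [C C0 hC] := phi_bound i.
have iw := integrableZl measurableT C (integrable_weight aF).
apply: (le_integrable measurableT _ _ iw).
  by apply/measurable_EFinP; exact: measurable_funM.
move=> z _; rewrite -EFinM /abse lee_fin mulrA [leLHS]normrM [leRHS]normrM.
apply: ler_wpM2r; first exact: normr_ge0.
by apply: le_trans (hC z) _; exact: ler_norm.
Qed.

Let momentE F i : admissible F ->
  (\int[leb6]_z (phi i z * on6 F z)%:E = (moment F i)%:E)%E.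
Proof.
move=> aF; rewrite /moment /Rintegral fineK//.
by apply: integrable_fin_num => //; exact: integrable_moment.
Qed.

Let integrable_pairing F L : admissible F ->
  (@leb6 R).-integrable setT (fun z => (E L (vec z.1) (vec z.2) * on6 F z)%:E) /\
  (\int[leb6]_z (E L (vec z.1) (vec z.2) * on6 F z)%:E = (pairing (moment F) L)%:E)%E.
Proof.
move=> aF.
have e z : (E L (vec z.1) (vec z.2) * on6 F z)%:E =
    (\sum_(i <- index_enum 'I_n) (L 0 i)%:E * (phi i z * on6 F z)%:E)%E.
  rewrite -pairingE /pairing mulr_suml -sumEFin; apply: eq_bigr => i _.
  by rewrite -EFinM mulrA.
have ii i : (@leb6 R).-integrable setT (fun z => ((L 0 i)%:E * (phi i z * on6 F z)%:E)%E).
  by apply: integrableZl => //; exact: integrable_moment.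
split.
  apply: eq_integrable (integrable_sum measurableT _ (fun i _ => ii i)) => // z _.
  exact/esym/e.
rewrite (eq_integral _ _ (fun z _ => e z)) integral_sum//.
rewrite /pairing -sumEFin; apply: eq_bigr => i _.
by rewrite integralZl ?momentE// ?EFinM//; exact: integrable_moment.
Qed.

Let mE L : measurable_fun setT (fun z : coord3 R * coord3 R => E L (vec z.1) (vec z.2) : R).
Proof. exact: measurable_gibbs_exponent. Qed.

Let continuous_E L : continuous (fun z : 'cV[R]_3 * 'cV[R]_3 => E L z.1 z.2).
Proof. exact: continuous_gibbs_exponent. Qed.

Let integral_gt0 F : admissible F -> (0 < Defs.total Phi F)%E ->
  ~ {ae @leb6 R, forall z, on6 F z = 0}.
Proof.
move=> aF; have iw := integrable_weight aF; have [mF F0 tF] := aF.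
move=> + aeF; rewrite /Defs.total.
have -> : (\int[leb6]_z ((Phi (vec z.1) + enorm (vec z.2) ^+ 2 + 1) * F (vec z.1) (vec z.2))%:E
    = \int[leb6]_(z in setT) cst 0 (z : coord3 R * coord3 R))%E.
  apply: ae_eq_integral => //; first exact: measurable_int iw.
  by move: aeF; apply: filterS => z; rewrite /on6 => -> _; rewrite mulr0.
by rewrite integral0 ltxx.
Qed.

(** If E is nonpositive almost everywhere, it is so everywhere by continuity, and then it is nonzero
    almost everywhere. The integral of E F is therefore nonpositive, and it cannot be 0, since F
    would vanish almost everywhere. *)
Let nondegenerate_moments F L : initial_datum Phi F -> L != 0 ->
  pairing (moment F) L < 0 \/ ~ (@leb6 R).-negligible [set z | 0 < pairing (phi ^~ z) L].
Proof.
move=> [mF F0 /andP[t0 tF]] L0; have aF : admissible F by [].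
have [ng|] := pselect ((@leb6 R).-negligible [set z | 0 < pairing (phi ^~ z) L]); last by right.
left.
have Ele x v : E L x v <= 0.
  apply: (ae_leb6_le0 (@continuous_E L) _ (x, v)).
  by apply: negligibleS ng => z /= /negP; rewrite -ltNge pairingE.
have Eneq : {ae @leb6 R, forall z, E L (vec z.1) (vec z.2) != 0}.
  have [l0|l0|l0] := ltgtP (L 0 i1) 0.
  - exact: gibbs_exponent_neq0_ae.
  (* A positive energy coefficient would make E positive at x = 0 and large speed. *)
  - exfalso; pose v r : 'cV[R]_3 := r *: delta_mx 0 0.
    have dv r : dot (v r) (v r) = r ^+ 2.
      by rewrite /v dotZl dotZr dot_delta mxE eqxx /= mulr1.
    have h r : A L + L 0 i1 * (Phi 0 + r ^+ 2 / 2) <= 0.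
      have := Ele 0 (v r); rewrite /E /gibbs_exponent dv dot_crossE.
      have -> : cross 0 (v r) = 0 by apply: cV3P; rewrite /cross !mxE /=; ring.
      by rewrite dot0r addr0.
    have := h (1 + 2 * `|A L| / L 0 i1); apply/negP; rewrite -ltNge.
    by apply: quadratic_gt0 => //; rewrite mulrC divfK// gt_eqF.
  (* Without energy term E is affine in v, so an upper bound excludes rotation; the constant that is
     left is nonzero because L is. *)
  - have W0 : W L = 0.
      apply: cross_eq0 => x v; apply/eqP; rewrite -[_ == _]negbK; apply/negP => xv.
      have h r : A L + r * dot (cross (W L) x) v <= 0.
        by have := Ele x (r *: v); rewrite /E /gibbs_exponent l0 mul0r addr0 dotZr.
      have := h ((1 - A L) / dot (cross (W L) x) v).
      by rewrite divfK// addrC subrK ler10.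
    have AE x v : E L x v = A L.
      rewrite /E /gibbs_exponent l0 W0 mul0r addr0 dot_crossE dot0l addr0 //.
    have A0 : A L != 0.
      by apply: contra L0 => /eqP A0; apply/eqP; exact: parameters_inj.
    by apply: nearW => z; rewrite AE.
have [iE IE] := integrable_pairing L aF.
have F6 z : 0 <= on6 F z by exact: F0.
have r0 : (0 <= \int[leb6]_z - (E L (vec z.1) (vec z.2) * on6 F z)%:E)%E.
  by apply: integral_ge0 => z _; rewrite -EFinN lee_fin -mulNr mulr_ge0// oppr_ge0.
have IN : (\int[leb6]_z - (E L (vec z.1) (vec z.2) * on6 F z)%:E = (- pairing (moment F) L)%:E)%E.
  by rewrite integralN ?IE//; exact: integrable_add_def.
rewrite lt_neqAle; apply/andP; split; last by move: r0; rewrite IN lee_fin oppr_ge0.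
apply/eqP => p0; apply: (integral_gt0 aF t0).
have ae0 : {ae @leb6 R, forall z, - (E L (vec z.1) (vec z.2) * on6 F z)%:E = 0}%E.
  apply: ge0_integral_eq0_ae; last by rewrite IN p0 oppr0.
    by apply: measurableT_comp => //; exact: measurable_int iE.
  by move=> z; rewrite -EFinN lee_fin -mulNr mulr_ge0// oppr_ge0.
move: ae0; apply: filterS2 Eneq => z Ez /eqP.
by rewrite -EFinN eqe oppr_eq0 mulf_eq0 (negbTE Ez) => /eqP.
Qed.

Let gibbs L x v := expR (E L x v).

Let initial_gibbs (L : 'rV[R]_n) : L 0 i1 < 0 -> initial_datum Phi (gibbs L).
Proof.
move=> l0; have mg : measurable_fun setT (on6 (gibbs L)) by exact: measurableT_comp (@mE L).
have g0 x v : 0 <= gibbs L x v by exact: expR_ge0.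
split => //.
have aF : (Defs.total Phi (gibbs L) < +oo)%E -> admissible (gibbs L) by [].
have tF : (Defs.total Phi (gibbs L) < +oo)%E.
  apply: (@equilibrium_total (fun _ => gibbs L) 0%:nng).
  by apply/equilibriumP; exists L.
have w0 z : (0 <= (weight z * on6 (gibbs L) z)%:E)%E by apply: weighted_ge0.
have [_ _ aF'] := aF tF; rewrite aF' andbT lt_neqAle; apply/andP; split; last first.
  by rewrite /Defs.total; apply: integral_ge0 => z _; exact: w0.
apply/eqP => /esym t0.

have := ge0_integral_eq0_ae (measurable_int _ (integrable_weight (aF tF))) w0 t0.
move=> /(ae_leb6_dense 0 0 ltr01)[y [_ _ /eqP]].
by rewrite eqe mulf_eq0 !gt_eqF ?expR_gt0//; exact: lt_le_trans (weight_ge1 _).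
Qed.

Let admissible_initial F : initial_datum Phi F -> admissible F.
Proof. by move=> [mF F0 /andP[]]. Qed.

Let initial_moments_gibbs F : initial_datum Phi F ->
  exists2 L : 'rV[R]_n, L 0 i1 < 0 & forall i, moment (gibbs L) i = moment F i.
Proof.
move=> iF.
have pf L : partition_function leb6 phi L = (\int[leb6]_z (expR (E L (vec z.1) (vec z.2)))%:E)%E.
  by apply: eq_integral => z _; rewrite pairingE.
have [|L i|L L0|L] := exponential_family_moments (mu := leb6) (V := moment F) mphi.
- exists (- delta_mx 0 i1); rewrite pf; apply/integrableE.
  by rewrite !mxE !eqxx ltrN10.
(* Half of the distance to the boundary of the half space where the integral is finite. *)
- rewrite pf => /integrableE l0; exists (- L 0 i1 / 2); first by rewrite divr_gt0// oppr_gt0.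
  move=> s sL; rewrite pf; apply/integrableE; rewrite !mxE.
  have := ler_norm s; have := ler_norm (- s); rewrite normrN sL.
  by rewrite eqxx /=; case: (i1 == i) => /=; rewrite ?mulr1 ?mulr0; lra.
- exact: nondegenerate_moments.
- rewrite pf => /integrableE l0 h; exists L => // i; have [_] := h i.
  move=> IE; have -> : moment F i = fine (moment F i)%:E by [].
  rewrite -IE /moment /Rintegral; congr fine.
  by apply: eq_integral => z _; rewrite pairingE.
Qed.

(* (g1 - g2) (ln g1 - ln g2) is nonnegative, and its integral is a linear
   combination of the differences of the moments. *)
Let gibbs_moments_inj (L1 L2 : 'rV[R]_n) : L1 0 i1 < 0 -> L2 0 i1 < 0 ->
  (forall i, moment (gibbs L1) i = moment (gibbs L2) i) -> gibbs L1 = gibbs L2.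
Proof.
move=> l1 l2 mm; have a1 := admissible_initial (initial_gibbs l1).
have a2 := admissible_initial (initial_gibbs l2).
have ED z : E (L1 - L2) (vec z.1) (vec z.2) = E L1 (vec z.1) (vec z.2) - E L2 (vec z.1) (vec z.2).
  rewrite -!pairingE /pairing -sumrB; apply: eq_bigr => i _.
  by rewrite !mxE mulrBl.
have [i1' I1] := integrable_pairing (L1 - L2) a1.
have [i2' I2] := integrable_pairing (L1 - L2) a2.
have mmE : moment (gibbs L1) = moment (gibbs L2) by apply/funext.
pose f z := (E L1 (vec z.1) (vec z.2) - E L2 (vec z.1) (vec z.2)) *
  (expR (E L1 (vec z.1) (vec z.2)) - expR (E L2 (vec z.1) (vec z.2))).
have fE z : (f z)%:E = ((E (L1 - L2) (vec z.1) (vec z.2) * on6 (gibbs L1) z)%:E -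
    (E (L1 - L2) (vec z.1) (vec z.2) * on6 (gibbs L2) z)%:E)%E.
  by rewrite -EFinB -mulrBr ED.
have If : (\int[leb6]_z (f z)%:E = 0)%E.
  transitivity (\int[leb6]_z ((E (L1 - L2) (vec z.1) (vec z.2) * on6 (gibbs L1) z)%:E -
    (E (L1 - L2) (vec z.1) (vec z.2) * on6 (gibbs L2) z)%:E))%E.
    by apply: eq_integral => z _; exact: fE.
  by rewrite (integralB measurableT i1' i2') I1 I2 mmE -EFinB subrr.
have mf : measurable_fun setT (fun z => (f z)%:E).
  apply/measurable_EFinP; apply: measurable_funM; apply: measurable_funB; try exact: mE;
    exact: measurableT_comp.
have f0 z : (0 <= (f z)%:E)%E.
  by rewrite lee_fin; exact: expR_increments_ge0.
have ae0 := ge0_integral_eq0_ae mf f0 If.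
have /(ae_leb6_eq (@continuous_E L1) (@continuous_E L2)) EE : {ae @leb6 R, forall z,
    E L1 (vec z.1) (vec z.2) = E L2 (vec z.1) (vec z.2)}.
  apply: filterS ae0 => z /eqP; rewrite eqe /f mulf_eq0 !subr_eq0.
  by move=> /orP[/eqP //|/eqP /expR_inj].
apply/funext => x; apply/funext => v; rewrite /gibbs.
by have /(congr1 (fun g => g (x, v))) /= -> := EE.
Qed.

(** Injectivity holds because [m] recovers the argument, surjectivity because a Gibbs function is
    determined by its moments. Values of F outside the set of moments are arbitrary. *)
Theorem moments_bijection : exists F : V -> {nonneg R} -> 'cV[R]_3 -> 'cV[R]_3 -> R,
  set_bij [set m F | F in initial_datum Phi] equilibrium F /\
  forall c, [set m F | F in initial_datum Phi] c -> forall t, m (F c t) = c.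
Proof.
have /choice[F FP] : forall c, exists M, [set m F | F in initial_datum Phi] c ->
    equilibrium M /\ forall t, m (M t) = c.
  move=> c; have [[F iF <-]|nc] := pselect ([set m F | F in initial_datum Phi] c); last first.
    by exists (fun _ _ _ => 0).
  have [L l0 LF] := initial_moments_gibbs iF; exists (fun _ => gibbs L) => _.
  split; first by apply/equilibriumP; exists L.
  move=> _; apply/momentsP; [|exact: admissible_initial|exact: LF].
  by apply: admissible_initial; exact: initial_gibbs.
exists F; split; last by move=> c /FP[].
have eqE M : equilibrium M -> exists2 L : 'rV[R]_n, L 0 i1 < 0 & M = fun _ => gibbs L.
  move=> /equilibriumP[L l0 ME]; exists L => //.
  by apply/funext => t; apply/funext => x; apply/funext => v; rewrite ME.
split.
- by move=> c /FP[].
- move=> c1 c2; rewrite !inE => /FP[_ h1] /FP[_ h2] F12.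
  by rewrite -(h1 0%:nng) -(h2 0%:nng) F12.
- move=> M /eqE[L l0 ->]; have iL := initial_gibbs l0.
  have mL : [set m F | F in initial_datum Phi] (m (gibbs L)) by exists (gibbs L).
  exists (m (gibbs L)) => //; have [/eqE[L' l0' FE] mF] := FP _ mL.
  have := mF 0%:nng; rewrite FE => mLL; apply/funext => t.
  apply: gibbs_moments_inj; [exact: l0'|exact: l0|].
  apply/momentsP; [|exact: admissible_initial iL|exact: mLL].
  by apply: admissible_initial; exact: initial_gibbs.
Qed.

End moments_bijection.

(** * Conserved quantities for the two families of potentials *)

Section conserved_quantities.
Context {R : realType}.
Implicit Types (x v w : 'cV[R]_3) (Phi : 'cV[R]_3 -> R).

Lemma wedgeE x v (i j : 'I_3) : wedge x v i j = x i 0 * v j 0 - v i 0 * x j 0.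
Proof. by rewrite /wedge !mxE !big_ord1 !mxE. Qed.

Lemma cross_wedge x v : [/\ cross x v 0 0 = wedge x v 1 2, cross x v 1 0 = wedge x v 2 0
  & cross x v 2 0 = wedge x v 0 1].
Proof. by rewrite !wedgeE !mxE /=; split; ring. Qed.

Lemma wedge_cross (i j : 'I_3) : exists k s, forall x v, wedge x v i j = s * cross x v k 0.
Proof.
have ordE (k : 'I_3) : [\/ k = 0, k = 1 | k = 2].
  by case: k => -[|[|[|//]]] kp; [apply: Or31|apply: Or32|apply: Or33]; exact: val_inj.
have E k s : (forall x v, wedge x v i j = s * cross x v k 0) ->
    exists k s, forall x v, wedge x v i j = s * cross x v k 0.
  by exists k, s.
have [Ei|Ei|Ei] := ordE i; have [Ej|Ej|Ej] := ordE j.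
- by apply: (E 0 0) => x v; rewrite wedgeE Ei Ej !mxE /=; ring.
- by apply: (E 2 1) => x v; rewrite wedgeE Ei Ej !mxE /=; ring.
- by apply: (E 1 (-1)) => x v; rewrite wedgeE Ei Ej !mxE /=; ring.
- by apply: (E 2 (-1)) => x v; rewrite wedgeE Ei Ej !mxE /=; ring.
- by apply: (E 0 0) => x v; rewrite wedgeE Ei Ej !mxE /=; ring.
- by apply: (E 0 1) => x v; rewrite wedgeE Ei Ej !mxE /=; ring.
- by apply: (E 1 1) => x v; rewrite wedgeE Ei Ej !mxE /=; ring.
- by apply: (E 0 (-1)) => x v; rewrite wedgeE Ei Ej !mxE /=; ring.
- by apply: (E 0 0) => x v; rewrite wedgeE Ei Ej !mxE /=; ring.
Qed.

Lemma cross_coef_le x v (k : 'I_3) : `|cross x v k 0| <= dot x x + dot v v.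
Proof.
have h (s t y z : R) : `|s * t - y * z| <= s ^+ 2 + t ^+ 2 + (y ^+ 2 + z ^+ 2).
  have := sqr_ge0 (s - t); have := sqr_ge0 (s + t).
  have := sqr_ge0 (y - z); have := sqr_ge0 (y + z).
  have := sqr_ge0 s; have := sqr_ge0 t; have := sqr_ge0 y; have := sqr_ge0 z.
  by rewrite ler_norml; lra.
rewrite !dotE -!expr2 /cross mxE.
have := sqr_ge0 (x 0 0); have := sqr_ge0 (x 1 0); have := sqr_ge0 (x 2 0).
have := sqr_ge0 (v 0 0); have := sqr_ge0 (v 1 0); have := sqr_ge0 (v 2 0).
by case: k => -[|[|[|//]]] kp /=;
  [have := h (x 1 0) (v 2 0) (x 2 0) (v 1 0)|have := h (x 2 0) (v 0 0) (x 0 0) (v 2 0)|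
   have := h (x 0 0) (v 1 0) (x 1 0) (v 0 0)]; lra.
Qed.

(** Angular momentum enters through three components only: the nine entries of [wedge] are linearly
    dependent, and would leave the parameter undetermined by the exponent. *)
Definition invariants Phi (z : coord3 R * coord3 R) : seq R :=
  let x := vec z.1 in let v := vec z.2 in
  [:: 1; Phi x + enorm v ^+ 2 / 2; cross x v 0 0; cross x v 1 0; cross x v 2 0].

Lemma measurable_invariants Phi (i : nat) : continuous Phi ->
  measurable_fun setT (fun z => (invariants Phi z)`_i : R).
Proof.
move=> cP; have m1 := @measurable_vec_fst R; have m2 := @measurable_vec_snd R.
have mw (j k : 'I_3) : measurable_fun setT
    (fun z : coord3 R * coord3 R => wedge (vec z.1) (vec z.2) j k : R).
  under eq_fun do rewrite wedgeE.
  by apply: measurable_funB; apply: measurable_funM => //; do [exact: m1|exact: m2].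
have cE z := cross_wedge (vec z.1) (vec z.2).
case: i => [|[|[|[|[|i]]]]] //=.
- apply: measurable_funD; first exact: (measurable_continuous_coef cP m1).
  apply: measurable_funM => //; apply: measurable_funX; exact: measurable_enorm_coef.
- by have := mw 1 2; congr measurable_fun; apply/funext => z; have [->] := cE z.
- by have := mw 2 0; congr measurable_fun; apply/funext => z; have [_ ->] := cE z.
- by have := mw 0 1; congr measurable_fun; apply/funext => z; have [_ _ ->] := cE z.
Qed.

Lemma total_integral_lty Phi a l w : continuous Phi -> (forall x, 0 <= Phi x) ->
  (Defs.total Phi (fun x v => expR (gibbs_exponent Phi a l w x v)) < +oo)%E ->
  (\int[leb6]_z (expR (gibbs_exponent Phi a l w (vec z.1) (vec z.2)))%:E < +oo)%E.
Proof.
move=> cP P0; apply: le_lt_trans; have mE := measurable_gibbs_exponent a l w cP.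
apply: ge0_le_integral => //.
- by apply/measurable_EFinP; exact: measurableT_comp.
- apply/measurable_EFinP; apply: measurable_funM; last exact: measurableT_comp.
  apply: measurable_funD => //; apply: measurable_funD.
    by apply: measurable_continuous_coef => //; exact: measurable_vec_fst.
  by apply: measurable_funX; apply: measurable_enorm_coef; exact: measurable_vec_snd.
- move=> z _; rewrite lee_fin ler_peMl ?expR_ge0// lerDr addr_ge0 ?sqr_ge0//.
Qed.

End conserved_quantities.

Section potential_gt2.
Context {R : realType}.
Variables (gamma : R) (b : R -> R) (p : R).
Hypotheses (hb : angular_kernel b) (p2 : 2 < p).
Notation Phi := (@potential_gt2 R p).
Notation B := (collision_kernel gamma b).

Let cPhi : continuous Phi.
Proof. by move=> x; apply: differentiable_continuous; exact: differentiable_potential_gt2. Qed.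

Let P0 x : 0 <= Phi x.
Proof. exact: potential_gt2_ge0. Qed.

Let phi (i : 'I_5) z := (invariants Phi z)`_i.

Let sum5E (f : 'I_5 -> R) : \sum_i f i = f 0 + f 1 + f 2 + f 3 + f 4.
Proof.
rewrite !big_ord_recr big_ord0 /= add0r.
by congr (f _ + f _ + f _ + f _ + f _); exact: val_inj.
Qed.

Let W (L : 'rV[R]_5) : 'cV[R]_3 := \col_i [:: L 0 2; L 0 3; L 0 4]`_i.

Let mphi i : measurable_fun setT (phi i).
Proof. exact: measurable_invariants. Qed.

(** Angular momentum is bounded by |x|^2 + |v|^2, and |x|^2 by the potential up to a constant,
    because p > 2. *)
Let phi_bound i : exists2 C, 0 <= C & forall z,
  `|phi i z| <= C * (Phi (vec z.1) + enorm (vec z.2) ^+ 2 + 1).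
Proof.
have [C hC] := potential_gt2_growth 1 p2.
exists (1 + `|C|) => [|z]; first by rewrite addr_ge0.
rewrite enorm_sqr; have := hC (vec z.1); have := P0 (vec z.1).
have := dot_ge0 (vec z.2); have := ler_norm C; have := normr_ge0 C.
have cc := cross_coef_le (vec z.1) (vec z.2).
rewrite /phi /invariants enorm_sqr; move: cc.
move: (vec z.1) (vec z.2) => x v cc C0 C1 v0 Px hx.
have CP : 0 <= `|C| * (Phi x + dot v v) by rewrite mulr_ge0// addr_ge0.
have -> : (1 + `|C|) * (Phi x + dot v v + 1) = Phi x + dot v v + 1 + `|C| + `|C| * (Phi x + dot v v).
  by ring.
have c0 := cc 0; have c1 := cc 1; have c2 := cc 2.
case: i => -[|[|[|[|[|//]]]]] ip /=; rewrite ?normr1 ?(ger0_norm (addr_ge0 _ _))//; lra.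
Qed.

Let pairingE L z : pairing (phi ^~ z) L = gibbs_exponent Phi (L 0 0) (L 0 1) (W L) (vec z.1) (vec z.2).
Proof.
rewrite /pairing sum5E /gibbs_exponent dot_crossE (dotE (W L)) /phi /invariants /= enorm_sqr /W ![(\col__ _) _ _]mxE /=.
by ring.
Qed.

Let parameters_inj (L : 'rV[R]_5) : L 0 0 = 0 -> L 0 1 = 0 -> W L = 0 -> L = 0.
Proof.
move=> L0 L1 W0.
have L2 : L 0 2 = 0 by have := congr1 (fun w : 'cV[R]_3 => w 0 0) W0; rewrite !mxE.
have L3 : L 0 3 = 0 by have := congr1 (fun w : 'cV[R]_3 => w 1 0) W0; rewrite !mxE.
have L4 : L 0 4 = 0 by have := congr1 (fun w : 'cV[R]_3 => w 2 0) W0; rewrite !mxE.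
apply/rowP => -[[|[|[|[|[|//]]]]] ip]; rewrite mxE.
- by rewrite -L0; congr (L _ _); exact: val_inj.
- by rewrite -L1; congr (L _ _); exact: val_inj.
- by rewrite -L2; congr (L _ _); exact: val_inj.
- by rewrite -L3; congr (L _ _); exact: val_inj.
- by rewrite -L4; congr (L _ _); exact: val_inj.
Qed.

Let gibbs_integrable a l w : (\int[leb6]_z
  (expR (gibbs_exponent Phi a l w (vec z.1) (vec z.2)))%:E < +oo)%E <-> l < 0.
Proof.
split=> [I|l0].
  by rewrite ltNge; apply/negP => l0; move: I; rewrite gibbs_exponent_not_integrable.
have [C hC] := gibbs_gt2_decay a w p2 l0.
exact: (integral_decay_lty ltr01 (measurable_gibbs_exponent a l w cPhi) hC).
Qed.

Let equilibriumP M : equilibria Phi B M <-> exists2 L : 'rV[R]_5, L 0 1 < 0 &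
  forall t x v, M t x v = expR (gibbs_exponent Phi (L 0 0) (L 0 1) (W L) x v).
Proof.
split=> [eM|[L l0 ME]].
  have [a [l [w ME]]] := equilibrium_gibbs (fun x v => is_derive_potential_gt2 x v p2)
    (fun x => grad_potential_gt2 x p2) (@potential_gt2N R p) (@psi_gt2N R p)
    (virial_gt2_not_quadratic p2) (fun u => @psi_gt2_not_const R p u p2) hb eM.
  have [L [L0 L1 WL]] : exists L : 'rV[R]_5, [/\ L 0 0 = a, L 0 1 = l & W L = w].
    exists (\row_i [:: a; l; w 0 0; w 1 0; w 2 0]`_i); split; rewrite ?mxE//.
    by apply: cV3P; rewrite !mxE.
  exists L; last by move=> t x v; rewrite ME L0 L1 WL.
    rewrite L1; apply/(gibbs_integrable a l w); apply: total_integral_lty => //.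
    have [_ _ + _ _] := eM; move=> /(_ 0%:nng); congr (Defs.total _ _ < _)%E.
    by apply/funext => x; apply/funext => v; exact: ME.
have -> : M = (fun _ x v => expR (gibbs_exponent Phi (L 0 0) (L 0 1) (W L) x v)).
  by apply/funext => t; apply/funext => x; apply/funext => v; exact: ME.
apply: (gibbs_equilibrium (fun x => differentiable_potential_gt2 x p2)
  (fun x v => is_derive_potential_gt2 x v p2) (fun x => grad_potential_gt2 x p2) P0 gamma hb l0).
by apply/gibbs_integrable; rewrite pmulr_llt0.
Qed.

(** Each cross component is an entry of [wedge], and each entry is a constant times a cross
    component. Taking this constant out of the integral uses the integrability that admissibility
    provides. *)
Let momentsP F G : admissible Phi F -> admissible Phi G ->
  (Psi Phi F = Psi Phi G <-> forall i,
    \int[leb6]_z (phi i z * F (vec z.1) (vec z.2)) = \int[leb6]_z (phi i z * G (vec z.1) (vec z.2))).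
Proof.
move=> aF aG; pose mom (k : nat) F := \int[leb6]_z ((invariants Phi z)`_k * F (vec z.1) (vec z.2)).
have massE H : mass H = mom 0%N H by apply: eq_Rintegral => z _; rewrite /= mul1r.
have angE H (i j : 'I_3) (k : nat) :
    (forall z, wedge (vec z.1) (vec z.2) i j = (invariants Phi z)`_k) ->
    angular_momentum H i j = mom k H.
  by move=> h; rewrite mxE; apply: eq_Rintegral => z _; rewrite h.
split=> [[m0 m1 m2] i|h].
  have w2 : mom 2%N F = mom 2%N G.
    by rewrite -!(angE _ 1 2) ?m2// => z; have [<- _ _] := cross_wedge (vec z.1) (vec z.2).
  have w3 : mom 3%N F = mom 3%N G.
    by rewrite -!(angE _ 2 0) ?m2// => z; have [_ <- _] := cross_wedge (vec z.1) (vec z.2).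
  have w4 : mom 4%N F = mom 4%N G.
    by rewrite -!(angE _ 0 1) ?m2// => z; have [_ _ <-] := cross_wedge (vec z.1) (vec z.2).
  case: i => -[|[|[|[|[|//]]]]] ip; [|exact: m1|exact: w2|exact: w3|exact: w4].
  by move: m0; rewrite !massE.
have mm k (k5 : (k < 5)%N) : mom k F = mom k G by exact: (h (Ordinal k5)).
rewrite /Psi; congr (_, _, _); [by rewrite !massE mm|exact: (mm 1%N)|].
apply/matrixP => i j; rewrite !mxE; have [k [s ijE]] := @wedge_cross R i j.
have cE z : cross (vec z.1) (vec z.2) k 0 = (invariants Phi z)`_(k.+2).
  by case: k {ijE} => -[|[|[|//]]] kp /=; congr (cross _ _ _ _); exact: val_inj.
have k5 : (k.+2 < 5)%N by case: k {ijE cE}.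
have E H : admissible Phi H -> \int[leb6]_z (wedge (vec z.1) (vec z.2) i j * H (vec z.1) (vec z.2)) =
    s * mom k.+2 H.
  move=> aH; rewrite -RintegralZl//.
    by apply: eq_Rintegral => z _; rewrite ijE cE mulrA.
  exact: (integrable_moment cPhi P0 mphi phi_bound (Ordinal k5) aH).
by rewrite !E// mm.
Qed.

Theorem moments_gt2_bijection :
  exists F : R * R * 'M[R]_3 -> {nonneg R} -> 'cV[R]_3 -> 'cV[R]_3 -> R,
    set_bij (moments_gt2 Phi) (equilibria Phi B) F /\
    forall V, moments_gt2 Phi V -> forall t, Psi Phi (F V t) = V.
Proof.
apply: (moments_bijection cPhi P0 mphi phi_bound pairingE parameters_inj
  (fun L => gibbs_integrable (L 0 0) (L 0 1) (W L)) equilibriumP _ momentsP).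
by move=> M t [].
Qed.

End potential_gt2.

Section potential_lt2.
Context {R : realType}.
Variables (gamma : R) (b : R -> R) (p : R).
Hypotheses (hb : angular_kernel b) (p12 : 1 < p < 2).
Notation Phi := (@potential_lt2 R p).
Notation B := (collision_kernel gamma b).

Let p1 : 1 < p. Proof. by case/andP: p12. Qed.
Let p2 : p < 2. Proof. by case/andP: p12. Qed.
Let p0 : 0 < p. Proof. exact: lt_trans p1. Qed.
Let p02 : 0 < p < 2. Proof. by rewrite p0. Qed.

Let cPhi : continuous Phi.
Proof. by move=> x; apply: differentiable_continuous; exact: differentiable_potential_lt2. Qed.

Let P0 x : 0 <= Phi x.
Proof. exact: potential_lt2_ge0. Qed.

Let phi (i : 'I_2) z := (invariants Phi z)`_i.

Let mphi i : measurable_fun setT (phi i).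
Proof. exact: measurable_invariants. Qed.

Let phi_bound i : exists2 C, 0 <= C & forall z,
  `|phi i z| <= C * (Phi (vec z.1) + enorm (vec z.2) ^+ 2 + 1).
Proof.
exists 1 => // z; rewrite mul1r enorm_sqr; have := P0 (vec z.1); have := dot_ge0 (vec z.2).
rewrite /phi /invariants enorm_sqr.
move: (vec z.1) (vec z.2) => x v v0 Px.
case: i => -[|[|//]] ip /=; first by rewrite normr1; lra.
by rewrite ger0_norm; lra.
Qed.

Let pairingE (L : 'rV[R]_2) z :
  pairing (phi ^~ z) L = gibbs_exponent Phi (L 0 0) (L 0 1) 0 (vec z.1) (vec z.2).
Proof.
rewrite /pairing !big_ord_recr big_ord0 /= add0r /gibbs_exponent dot_crossE dot0l addr0.
rewrite /phi /invariants /= enorm_sqr mulr1.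
by congr (L _ _ + L _ _ * _); exact: val_inj.
Qed.

Let parameters_inj (L : 'rV[R]_2) : L 0 0 = 0 -> L 0 1 = 0 -> 0 = 0 :> 'cV[R]_3 -> L = 0.
Proof.
move=> L0 L1 _; apply/rowP => -[[|[|//]] ip]; rewrite mxE.
- by rewrite -L0; congr (L _ _); exact: val_inj.
- by rewrite -L1; congr (L _ _); exact: val_inj.
Qed.

Let gibbs_integrable a l : (\int[leb6]_z
  (expR (gibbs_exponent Phi a l 0 (vec z.1) (vec z.2)))%:E < +oo)%E <-> l < 0.
Proof.
split=> [I|l0].
  by rewrite ltNge; apply/negP => l0; move: I; rewrite gibbs_exponent_not_integrable.
have [C [d [d0 hC]]] := gibbs_lt2_decay a p1 l0.
exact: (integral_decay_lty d0 (measurable_gibbs_exponent a l 0 cPhi) hC).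
Qed.

Let equilibriumP M : equilibria Phi B M <-> exists2 L : 'rV[R]_2, L 0 1 < 0 &
  forall t x v, M t x v = expR (gibbs_exponent Phi (L 0 0) (L 0 1) 0 x v).
Proof.
split=> [eM|[L l0 ME]].
  have [a [l [w ME]]] := equilibrium_gibbs (fun x v => is_derive_potential_lt2 x v p0)
    (fun x => grad_potential_lt2 x p0) (@potential_lt2N R p) (@psi_lt2N R p)
    (virial_lt2_not_quadratic p02) (fun u => @psi_lt2_not_const R p u p2) hb eM.
  have I : (\int[leb6]_z (expR (gibbs_exponent Phi a l w (vec z.1) (vec z.2)))%:E < +oo)%E.
    apply: total_integral_lty => //.
    have [_ _ + _ _] := eM; move=> /(_ 0%:nng); congr (Defs.total _ _ < _)%E.
    by apply/funext => x; apply/funext => v; exact: ME.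
  have w0 : w = 0.
    apply/eqP/negP => /negP w0; move: I.
    by rewrite gibbs_lt2_rotation_not_integrable.
  have [L [L0 L1]] : exists L : 'rV[R]_2, L 0 0 = a /\ L 0 1 = l.
    by exists (\row_i [:: a; l]`_i); rewrite !mxE.
  exists L; last by move=> t x v; rewrite ME w0 L0 L1.
  by rewrite L1; apply/(gibbs_integrable a l); rewrite w0 in I.
have -> : M = (fun _ x v => expR (gibbs_exponent Phi (L 0 0) (L 0 1) 0 x v)).
  by apply/funext => t; apply/funext => x; apply/funext => v; exact: ME.
apply: (gibbs_equilibrium (fun x => differentiable_potential_lt2 x p0)
  (fun x v => is_derive_potential_lt2 x v p0) (fun x => grad_potential_lt2 x p0) P0 gamma hb l0).
by apply/gibbs_integrable; rewrite pmulr_llt0.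
Qed.

Let momentsP F G : admissible Phi F -> admissible Phi G ->
  ((mass F, energy Phi F) = (mass G, energy Phi G) <-> forall i,
    \int[leb6]_z (phi i z * F (vec z.1) (vec z.2)) = \int[leb6]_z (phi i z * G (vec z.1) (vec z.2))).
Proof.
move=> aF aG; pose mom (k : nat) F := \int[leb6]_z ((invariants Phi z)`_k * F (vec z.1) (vec z.2)).
have massE H : mass H = mom 0%N H by apply: eq_Rintegral => z _; rewrite /= mul1r.
split=> [[m0 m1] i|h].
  case: i => -[|[|//]] ip; last exact: m1.
  by move: m0; rewrite !massE.
congr (_, _); last exact: (h 1).
by rewrite !massE; exact: (h 0).
Qed.

Theorem moments_lt2_bijection :
  exists F : R * R -> {nonneg R} -> 'cV[R]_3 -> 'cV[R]_3 -> R,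
    set_bij (moments_lt2 Phi) (equilibria Phi B) F /\
    forall V, moments_lt2 Phi V -> forall t, (mass (F V t), energy Phi (F V t)) = V.
Proof.
apply: (moments_bijection (m := fun F => (mass F, energy Phi F)) cPhi P0 mphi phi_bound pairingE
  parameters_inj (fun L => gibbs_integrable (L 0 0) (L 0 1)) equilibriumP _ momentsP).
by move=> M t [].
Qed.

End potential_lt2.

Theorem theorem1p10 (R : realType) (gamma : R) (b : R -> R)
    (hgamma : -3 < gamma <= 1) (hb : angular_kernel b) :
  (forall p : R, 2 < p ->
    let Phi := potential_gt2 p in
    exists F : R * R * 'M[R]_3 -> {nonneg R} -> 'cV[R]_3 -> 'cV[R]_3 -> R,
      set_bij (moments_gt2 Phi) (equilibria Phi (collision_kernel gamma b)) F /\
      forall V, moments_gt2 Phi V -> forall t, Psi Phi (F V t) = V) /\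
  (forall p : R, 1 < p < 2 ->
    let Phi := potential_lt2 p in
    exists F : R * R -> {nonneg R} -> 'cV[R]_3 -> 'cV[R]_3 -> R,
      set_bij (moments_lt2 Phi) (equilibria Phi (collision_kernel gamma b)) F /\
      forall V, moments_lt2 Phi V -> forall t,
        (Psi Phi (F V t)).1.1 = V.1 /\ (Psi Phi (F V t)).1.2 = V.2).
Proof.
split=> p hp; first exact: moments_gt2_bijection.
have [F [bF FV]] := moments_lt2_bijection gamma hb hp.
exists F; split => // V /FV FVt t.
by split; [exact: (congr1 fst (FVt t))|exact: (congr1 snd (FVt t))].
Qed.
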